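(* Let $p$ be an odd prime, let $q>1$ be a power of $p$, and let $E/\mathbb{F}_q$ be an elliptic curve. Write $q=r^2$ with $r\in\mathbb{R}$, where in the case that $q$ is a perfect square, $r$ is chosen to be the (possibly negative) integer square root of $q$ satisfying $r\equiv 1 \pmod 4$. Then $E$ is Legendre isogenous if and only if $|E(\mathbb{F}_q)|\in 4\mathbb{Z}\setminus\{(r+1)^2\}$.
   Context: For $\lambda\in\mathbb{F}_q\setminus\{0,1\}$, the Legendre elliptic curve $E_\lambda/\mathbb{F}_q$ is the elliptic curve given by $y^2=x(x-1)(x-\lambda)$. An elliptic curve $E/\mathbb{F}_q$ is called Legendre isogenous if it is isogenous over $\mathbb{F}_q$ to $E_\lambda$ for some $\lambda\in\mathbb{F}_q\setminus\{0,1\}$. All isogenies are defined over the base field $\mathbb{F}_q$. *)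

(* Defs.v *)
From mathcomp Require Import all_boot all_order all_algebra all_field.
From mathcomp Require Import reals.
From mathcomp Require Import mpoly ring.

Set Implicit Arguments.
Unset Strict Implicit.
Unset Printing Implicit Defensive.

Import Order.TTheory GRing.Theory Num.Theory.
Local Open Scope ring_scope.

(* y^2 + a1 xy + a3 y = x^3 + a2 x^2 + a4 x + a6, not assumed smooth *)
Record weierstrass (F : Type) : Type :=
  Weierstrass { a1 : F; a2 : F; a3 : F; a4 : F; a6 : F }.

Section Curves.
Variable F : fieldType.
Implicit Type W : weierstrass F.

(* The standard b-invariants and discriminant, valid in every characteristic. *)
Definition b2 W : F := a1 W ^+ 2 + 4 * a2 W.
Definition b4 W : F := 2 * a4 W + a1 W * a3 W.
Definition b6 W : F := a3 W ^+ 2 + 4 * a6 W.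
Definition b8 W : F :=
  a1 W ^+ 2 * a6 W + 4 * a2 W * a6 W - a1 W * a3 W * a4 W
  + a2 W * a3 W ^+ 2 - a4 W ^+ 2.
Definition disc W : F :=
  - b2 W ^+ 2 * b8 W - 8 * b4 W ^+ 3 - 27 * b6 W ^+ 2
  + 9 * b2 W * b4 W * b6 W.

Definition elliptic W : bool := disc W != 0.

(* [None] is the point at infinity O = [0 : 1 : 0], the only point of the
   projective curve outside the affine chart. *)
Definition on_curve W (P : option (F * F)) : bool :=
  if P is Some (x, y) then
    y ^+ 2 + a1 W * x * y + a3 W * y
    == x ^+ 3 + a2 W * x ^+ 2 + a4 W * x + a6 W
  else true.

Definition point W : Type := {P : option (F * F) | on_curve W P}.

Definition origin W : point W := exist (on_curve W) None isT.

(* Homogeneous coordinates: (x, y) is [x : y : 1], O is [0 : 1 : 0]. *)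
Definition proj_coord W (P : point W) : 'I_3 -> F :=
  fun i => nth 0 (if val P is Some (x, y) then [:: x; y; 1] else [:: 0; 1; 0]) i.

(* y^2 = x (x - 1) (x - lam) *)
Definition legendre (lam : F) : weierstrass F :=
  Weierstrass 0 (- (1 + lam)) 0 lam 0.

Lemma on_curve_legendre lam x y :
  on_curve (legendre lam) (Some (x, y)) =
  (y ^+ 2 == x * (x - 1) * (x - lam)).
Proof. by rewrite /on_curve /=; congr (_ == _); ring. Qed.

Lemma elliptic_legendre lam :
  (2 : F) != 0 -> elliptic (legendre lam) = (lam != 0) && (lam != 1).
Proof.
move=> nz2; rewrite /elliptic.
have -> : disc (legendre lam) = 2 ^+ 4 * (lam ^+ 2 * (lam - 1) ^+ 2).
  by rewrite /disc /b2 /b4 /b6 /b8 /=; ring.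
by rewrite mulf_eq0 expf_eq0 (negPf nz2) andbF mulf_eq0 !expf_eq0 /= subr_eq0
  negb_or.
Qed.

End Curves.

Definition card_points (F : finFieldType) (W : weierstrass F) : nat :=
  #|[pred P : option (F * F) | on_curve W P]|.

Section BaseChange.
Variables (F K : fieldType) (iota : {rmorphism F -> K}).

Definition base_change (W : weierstrass F) : weierstrass K :=
  Weierstrass (iota (a1 W)) (iota (a2 W)) (iota (a3 W))
              (iota (a4 W)) (iota (a6 W)).

Variables W1 W2 : weierstrass F.
Let E1 := base_change W1.
Let E2 := base_change W2.

Definition eval_triple (f : 'I_3 -> {mpoly F[3]}) (P : point E1) : 'I_3 -> K :=
  fun i => (map_mpoly iota (f i)).@[proj_coord P].

(* phi is given by P |-> [f_0(P) : f_1(P) : f_2(P)] wherever the f_i do not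
   all vanish. *)
Definition represents (f : 'I_3 -> {mpoly F[3]}) (phi : point E1 -> point E2) :
    Prop :=
  forall P : point E1, (exists i, eval_triple f P i != 0) ->
  exists2 c : K, c != 0 &
    forall i, eval_triple f P i = c * proj_coord (phi P) i.

(* Morphisms of projective curves defined over F, as maps on K-points (meant
   for K algebraically closed): around each point, a triple of homogeneous
   polynomials of the same degree with coefficients in F. *)
Definition morphism_over (phi : point E1 -> point E2) : Prop :=
  forall P : point E1, exists (d : nat) (f : 'I_3 -> {mpoly F[3]}),
    [/\ forall i, f i \is d.-homog,
        exists i, eval_triple f P i != 0
      & represents f phi].

Definition isogeny_over (phi : point E1 -> point E2) : Prop :=
  [/\ morphism_over phi,
      phi (origin E1) = origin E2
    & exists P, phi P <> origin E2].

End BaseChange.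

Section Closure.
Variable F : countFieldType.

Definition alg_closure : countClosedFieldType :=
  projT1 (countable_algebraic_closure F).

Definition to_closure : {rmorphism F -> alg_closure} :=
  sval (projT2 (countable_algebraic_closure F)).

Lemma to_closure_integral : integralRange to_closure.
Proof. exact: svalP (projT2 (countable_algebraic_closure F)). Qed.

End Closure.

Definition isogenous (F : countFieldType) (E1 E2 : weierstrass F) : Prop :=
  exists phi : point (base_change (to_closure F) E1) ->
               point (base_change (to_closure F) E2),
    isogeny_over phi.

Definition legendre_isogenous (F : countFieldType) (E : weierstrass F) : Prop :=
  exists lam : F, [/\ lam != 0, lam != 1 & isogenous E (legendre lam)].

(* Main.v *)
(* An isogeny phi over F_q commutes with Frobenius, so counting the kernel of
   phi o (1 - Frob) = (1 - Frob) o phi in two ways shows that isogenous curves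
   have the same number N of points.

   Only if: a Legendre curve has full rational 2-torsion, so 4 | N. The degree
   of m - Frob is m^2 - (q + 1 - N) m + q (the parallelogram law, obtained from
   the x-coordinates of P + Q and P - Q). If N = (r + 1)^2 it vanishes at
   m = -r, hence Frob = -r, which is -1 on the 4-torsion. But if Frobenius
   negates the point (1 + s, s (1 + s)) of order 4, where s^2 = 1 - lam, then
   its abscissa is rational, so s and its ordinate are too, and it is fixed.

   If: y^2 = (x - e1)(x - e2)(x - e3) is Legendre up to a change of variables
   over F_q when some e_j - e_i is a square. If E has a single rational point
   of order 2, parity of N yields a rational point of order 4, and dividing by
   the point of order 2 gives such a curve. If E has full 2-torsion and is not
   Legendre isogenous, then so is each quotient by a point of order 2, and by
   induction on k Frobenius is a scalar on E[2^k], congruent to -1 mod 4. For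
   large k some m in that class makes m - Frob of degree d with 2 d + 1 < 4^k,
   yet it kills the 4^k points of E[2^k]; so d = 0, and then q = m^2 and
   N = (m - 1)^2. *)
From HB Require Import structures.
Require Import Defs.
From mathcomp Require Import all_boot all_order all_algebra all_field.
From mathcomp Require Import reals mpoly ring zify.

Set Implicit Arguments.
Unset Strict Implicit.
Unset Printing Implicit Defensive.

Import Order.TTheory GRing.Theory Num.Theory.
Local Open Scope ring_scope.

(** * Polynomials over an algebraically closed field *)

(** An isogeny is given only as a map on points over the closure, locally described by forms, so
    additivity, kernels and degrees have to be extracted from polynomial identities. Three devices
    do this. A form vanishing over infinitely many abscissas vanishes on the whole curve, so
    identities between morphisms need checking only at generic points; associativity of the group
    law is obtained in this way. A morphism phi that fixes the origin is additive because phi (H +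
    R) + phi (H - R) is even in R: its coordinates are rational functions of the abscissa of R, and
    a curve of genus one has no nonconstant rational parametrisation. The degree of an endomorphism
    alpha is taken to be the degree of the rational function of x that gives the abscissa of alpha
    P. The parallelogram law then compares sizes of polynomials, and the degree of 1 - Frob is found
    to be N by counting multiplicities at the elements of F_q. *)

Definition hE (R : comNzRingType) := (@horner_exp R, @hornerD R, @hornerN R, @hornerM R,
  @hornerC R, @hornerX R).

(** Together with [eqD] and [eqM] this proves an equation as an explicit linear combination of
    hypotheses: the combination is supplied and [ring] compares the two differences. *)
Lemma lin_comb (V : zmodType) (a b c d : V) : c = d -> a - b = c - d -> a = b.
Proof. by move=> ->; rewrite subrr => /subr0_eq. Qed.

Lemma eqD (V : zmodType) (a b c d : V) : a = b -> c = d -> a + c = b + d.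
Proof. by move=> -> ->. Qed.

Lemma eqM (R : pzRingType) (k a b : R) : a = b -> k * a = k * b.
Proof. by move=> ->. Qed.

Section ClosedFieldPoly.
Variable K : closedFieldType.
Implicit Types (a b p q r s : {poly K}).

Lemma closed_sqrt (c : K) : exists d : K, d ^+ 2 = c.
Proof.
have /closed_rootP [s] : size ('X^2 - c%:P : {poly K}) != 1%N by rewrite size_XnsubC.
by rewrite rootE !hornerE subr_eq0 => /eqP <-; exists s.
Qed.

Lemma closed_avoid (l : seq K) : exists x, x \notin l.
Proof.
set p : {poly K} := \prod_(c <- 0 :: l) ('X - c%:P).
have sp : (1 < size p)%N by rewrite size_prod_XsubC.
have /closed_rootP [x] : size (p + 1) != 1%N.
  by rewrite size_polyDl ?size_poly1 // neq_ltn sp orbT.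
rewrite rootE hornerD hornerC => /eqP px; exists x; apply/negP => xl.
suff /rootP p0 : root p x by move/eqP: px; rewrite p0 add0r oner_eq0.
by rewrite root_prod_XsubC inE xl orbT.
Qed.

Definition nocroot a b := forall z, a.[z] = 0 -> b.[z] != 0.

Lemma nocroot_sym a b : nocroot a b -> nocroot b a.
Proof. by move=> h z bz; apply/eqP => /h; rewrite bz eqxx. Qed.

Lemma nocroot_coprimep a b : nocroot a b <-> coprimep a b.
Proof.
split=> [h|/Pdiv.ClosedField.coprimepP h z /rootP /h //].
by apply/Pdiv.ClosedField.coprimepP => z /rootP /h.
Qed.

(** A root z of p is a root of r but not of q, so [(X - z)^2] divides p; dividing p by it and r by X
    - z lowers the degree. A constant p is a square because K is closed. *)
Lemma nocroot_square_factor p q r :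
  nocroot p q -> p * q = r ^+ 2 -> exists s, p = s ^+ 2.
Proof.
have [n] := ubnP (size p); elim: n p r => // n IHn p r sp nc e.
have [p1 | p1] := leqP (size p) 1.
  have [s sE] := closed_sqrt p`_0; exists s%:P.
  by rewrite -polyC_exp sE; apply: size1_polyC.
have /closed_rootP [z pz] : size p != 1%N by rewrite gtn_eqF.
have [p' pE] := factor_theorem _ _ pz; rewrite pE in pz nc e sp.
have qz : q.[z] != 0 by apply: nc; apply/rootP.
have /factor_theorem [r' rE] : root r z.
  by rewrite rootE -sqrf_eq0 -horner_exp -e hornerM (rootP pz) mul0r.
have nX : 'X - z%:P != 0 :> {poly K} by rewrite polyXsubC_eq0.
have e' : p' * q = r' ^+ 2 * ('X - z%:P).
  by apply: (mulIf nX); rewrite mulrAC e rE; ring.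
have /factor_theorem [p'' p'E] : root p' z.
  have := congr1 (horner^~ z) e'; rewrite !hornerM hornerXsubC subrr mulr0.
  by move/eqP; rewrite mulf_eq0 (negPf qz) orbF.
have p''0 : p'' != 0.
  apply/eqP => p''0; move: p1; rewrite pE p'E p''0 !mul0r size_poly0 //.
have [|||s sE] := IHn p'' r'.
- move: sp; rewrite p'E !size_Mmonic ?monicXsubC ?mulf_neq0 //.
  by rewrite !size_XsubC !addn2 /= ltnS => /ltnW.
- move=> y y0; apply: nc; rewrite p'E !hornerM y0 !mul0r //.
- by apply: (mulIf nX); rewrite -e' p'E mulrAC.
by exists (s * ('X - z%:P)); rewrite pE p'E sE; ring.
Qed.

Lemma half_size (u a : {poly K}) n :
  (1 < n)%N -> (size a <= n)%N -> a = u ^+ 2 -> (size u < n)%N.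
Proof.
move=> n1 sa aE; have [->|u0] := eqVneq u 0; first by rewrite size_poly0; lia.
have := sa; rewrite aE expr2 size_mul // -[in _ -> _]ltnS.
have : (0 < size u)%N by rewrite size_poly_gt0.
by case: (size u) => // m _; rewrite addSn /=; lia.
Qed.

(* Fermat descent: L_1 = u^2 and L_2 = v^2 turn L_3, L_4 into differences of
   squares, whose linear factors are four squares in the pencil of (u, v). *)
Lemma pencil_squares_const (char2 : (2 : K) != 0) a b
    (al be : 'I_4 -> K) (s : 'I_4 -> {poly K}) :
  nocroot a b ->
  (forall i j, i != j -> al i * be j != al j * be i) ->
  (forall i, (al i)%:P * a + (be i)%:P * b = s i ^+ 2) ->
  (size a <= 1)%N /\ (size b <= 1)%N.
Proof.
have [n] := ubnP (maxn (size a) (size b)).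
elim: n a b al be s => // n IHn a b al be s sz nc ind sq.
have [n1|n1] := leqP n 1; first by lia.
have /andP [sa sb] : (size a <= n)%N && (size b <= n)%N by rewrite -geq_max.
pose i k : 'I_4 := inord k.
have ij (k l : nat) : (k < 4)%N -> (l < 4)%N -> k != l -> i k != i l.
  by move=> k4 l4; apply: contra => /eqP/(congr1 val) /=; rewrite !inordK // => ->.
have ind' (k l : nat) : (k < 4)%N -> (l < 4)%N -> k != l ->
    al (i k) * be (i l) - al (i l) * be (i k) != 0.
  by move=> k4 l4 kl; rewrite subr_eq0; apply/ind/ij.
set D := al (i 0) * be (i 1) - al (i 1) * be (i 0).
have D0 : D != 0 by apply: ind'.
set u := s (i 0); set v := s (i 1).
have uE : (al (i 0))%:P * a + (be (i 0))%:P * b = u ^+ 2 by apply: sq.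
have vE : (al (i 1))%:P * a + (be (i 1))%:P * b = v ^+ 2 by apply: sq.
have DP : D%:P = (al (i 0))%:P * (be (i 1))%:P - (al (i 1))%:P * (be (i 0))%:P.
  by rewrite polyCB !polyCM.
have DV : D%:P * D^-1%:P = 1 by rewrite -polyCM divff.
have aE : a = D^-1%:P * ((be (i 1))%:P * u ^+ 2 - (be (i 0))%:P * v ^+ 2).
  by rewrite -uE -vE -[LHS]mul1r -DV DP; ring.
have bE : b = D^-1%:P * ((al (i 0))%:P * v ^+ 2 - (al (i 1))%:P * u ^+ 2).
  by rewrite -uE -vE -[LHS]mul1r -DV DP; ring.
(* Coordinates of the k-th form in terms of [u^2] and [v^2], by Cramer's rule. *)
pose pp k := (al (i k) * be (i 1) - al (i 1) * be (i k)) / D.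
pose qq k := (be (i k) * al (i 0) - be (i 0) * al (i k)) / D.
have LE k : (pp k)%:P * u ^+ 2 + (qq k)%:P * v ^+ 2 = s (i k) ^+ 2.
  by rewrite -sq aE bE /pp /qq !(polyCM, polyCB); ring.
(* The sign on [qq] turns each remaining form into [P^2 u^2 - Q^2 v^2], a product of two linear
   forms in u and v. *)
have [P3 P3E] := closed_sqrt (pp 2); have [Q3 Q3E] := closed_sqrt (- qq 2).
have [P4 P4E] := closed_sqrt (pp 3); have [Q4 Q4E] := closed_sqrt (- qq 3).
have pp2 : pp 2 != 0 by rewrite mulf_neq0 ?invr_eq0 //; apply: ind'.
have pp3 : pp 3 != 0 by rewrite mulf_neq0 ?invr_eq0 //; apply: ind'.
have qq2 : qq 2 != 0.
  by rewrite mulf_neq0 ?invr_eq0 // [be _ * al _]mulrC [be _ * _]mulrC; apply: ind'.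
have qq3 : qq 3 != 0.
  by rewrite mulf_neq0 ?invr_eq0 // [be _ * al _]mulrC [be _ * _]mulrC; apply: ind'.
have pq : pp 2 * qq 3 != pp 3 * qq 2.
  rewrite -subr_eq0.
  have -> : pp 2 * qq 3 - pp 3 * qq 2 =
     (al (i 2) * be (i 3) - al (i 3) * be (i 2)) / D.
    by rewrite /pp /qq; move: D0; rewrite /D => D0; field.
  by rewrite mulf_neq0 ?invr_eq0 //; apply: ind'.
have fact k (P Q : K) : P ^+ 2 = pp k -> Q ^+ 2 = - qq k ->
    (P%:P * u + (- Q)%:P * v) * (P%:P * u + Q%:P * v) = s (i k) ^+ 2.
  move=> PE QE; rewrite -LE -PE -[qq k]opprK -QE !polyCN !polyC_exp; ring.
have ncuv : nocroot u v.
  move=> z uz; apply/eqP => vz.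
  have az : a.[z] = 0 by rewrite aE !hE uz vz; ring.
  have := nc _ az; rewrite bE !hE uz vz.
  by rewrite expr0n /= !(mulr0, subrr) eqxx.
have ncPQ (P Q : K) : P != 0 -> Q != 0 ->
    nocroot (P%:P * u + (- Q)%:P * v) (P%:P * u + Q%:P * v).
  move=> P0 Q0 z; rewrite !hornerE => e1; apply/eqP => e2.
  have : 2 * P * u.[z] = 0 by apply: (lin_comb (eqD e1 e2)); ring.
  move/eqP; rewrite !mulf_eq0 (negPf char2) (negPf P0) /= => /eqP uz.
  have : 2 * Q * v.[z] = 0 by apply: (lin_comb (eqD e2 (eqM (-1) e1))); ring.
  by move/eqP; rewrite !mulf_eq0 (negPf char2) (negPf Q0) /= (negPf (ncuv _ uz)).
have sq0 (x y : K) : x ^+ 2 = y -> y != 0 -> x != 0.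
  by move=> <-; rewrite expf_eq0.
have P30 := sq0 _ _ P3E pp2; have P40 := sq0 _ _ P4E pp3.
have Q30 : Q3 != 0 by apply: sq0 Q3E _; rewrite oppr_eq0.
have Q40 : Q4 != 0 by apply: sq0 Q4E _; rewrite oppr_eq0.
have [s1 s1E] := nocroot_square_factor (ncPQ _ _ P30 Q30) (fact 2%N _ _ P3E Q3E).
have [s2 s2E] := nocroot_square_factor (nocroot_sym (ncPQ _ _ P30 Q30))
  (etrans (mulrC _ _) (fact 2%N _ _ P3E Q3E)).
have [s3 s3E] := nocroot_square_factor (ncPQ _ _ P40 Q40) (fact 3%N _ _ P4E Q4E).
have [s4 s4E] := nocroot_square_factor (nocroot_sym (ncPQ _ _ P40 Q40))
  (etrans (mulrC _ _) (fact 3%N _ _ P4E Q4E)).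
have ne1 (P Q : K) : P != 0 -> Q != 0 -> P * Q != P * - Q.
  by move=> P0 Q0; rewrite -subr_eq0 mulrN opprK -mulr2n -mulr_natl !mulf_neq0.
have ne2 (Q Q' : K) : Q ^+ 2 = - qq 2 -> Q' ^+ 2 = - qq 3 -> P3 * Q' != P4 * Q.
  move=> QE Q'E; apply: contra pq => /eqP e; apply/eqP.
  have : (P3 * Q') ^+ 2 = (P4 * Q) ^+ 2 by rewrite e.
  by rewrite !exprMn P3E P4E QE Q'E !mulrN => /oppr_inj.
have N2 (x : K) : (- x) ^+ 2 = x ^+ 2 by rewrite sqrrN.
(* The factors of the last two forms are four pairwise independent squares in the pencil of u and v,
   whose sizes are smaller. *)
have [su sv] : (size u <= 1)%N /\ (size v <= 1)%N.
  apply: (IHn u v (fun j => nth (0 : K) [:: P3; P3; P4; P4] j)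
    (fun j => nth (0 : K) [:: - Q3; Q3; - Q4; Q4] j) (fun j => nth (0 : {poly K}) [:: s1; s2; s3; s4] j)).
  - have comb (c d : K) : (size (c%:P * a + d%:P * b)%R <= n)%N.
      apply: leq_trans (size_polyD _ _) _; rewrite !mul_polyC geq_max.
      by rewrite (leq_trans (size_scale_leq _ _) sa) (leq_trans (size_scale_leq _ _) sb).
    rewrite gtn_max (half_size n1 _ uE) ?comb // (half_size n1 _ vE) ?comb //.
  - by [].
  - case=> [[|[|[|[|//]]]] j4] [[|[|[|[|//]]]] l4] //= _;
     rewrite ?(ne1, ne2) ?N2 // eq_sym ?(ne1, ne2) ?N2 //.
  - by case=> [[|[|[|[|//]]]] j4] /=.
rewrite aE bE (size1_polyC su) (size1_polyC sv).
by rewrite -!(polyC_exp, polyCM, polyCB) !size_polyC !leq_b1.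
Qed.
Lemma coprime_fraction (c d : {poly K}) : d != 0 ->
  exists g a b, [/\ g != 0, c = a * g, d = b * g & nocroot a b].
Proof.
move=> d0; have g0 : gcdp c d != 0 by rewrite gcdp_eq0 (negPf d0) andbF.
exists (gcdp c d), (c %/ gcdp c d), (d %/ gcdp c d); split=> //.
- by rewrite divpK ?dvdp_gcdl.
- by rewrite divpK ?dvdp_gcdr.
by apply/nocroot_coprimep/coprimep_div_gcd; rewrite d0 orbT.
Qed.

(** With [x = c0 / c2] and [y = c1 / c2] this is a rational parametrisation of
    [y^2 = (x - e1) (x - e2) (x - e3)]. If [x = a / b] in lowest terms, then b and the three a - e_i
    b are pairwise coprime with square product. So all four are squares in the pencil of a and b,
    which forces a and b to be constant. *)
Lemma genus1_no_rational_curve (char2 : (2 : K) != 0) (e1 e2 e3 : K)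
    (c0 c1 c2 : {poly K}) :
  e1 != e2 -> e1 != e3 -> e2 != e3 -> c2 != 0 ->
  c1 ^+ 2 * c2 = (c0 - e1%:P * c2) * (c0 - e2%:P * c2) * (c0 - e3%:P * c2) ->
  exists x : K, c0 = x%:P * c2.
Proof.
move=> e12 e13 e23 c20 eq1.
have [g [a [b [g0 c0E c2E nc]]]] := coprime_fraction c0 c20.
have b0 : b != 0 by apply: contra c20 => /eqP b0; rewrite c2E b0 mul0r.
pose l e := a - e%:P * b.
have eq2 : (c1 * b) ^+ 2 = g ^+ 2 * (b * (l e1 * l e2 * l e3)).
  apply: (mulfI g0); rewrite /l.
  by move: eq1; rewrite c0E c2E => eq1; apply: (lin_comb (eqM b eq1)); ring.
have /dvdpP [D DE] : g %| c1 * b.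
  by rewrite -(@dvdp_pexp2r _ _ _ 2) // eq2 dvdp_mulr.
have eq3 : b * (l e1 * l e2 * l e3) = D ^+ 2.
  apply: (mulfI (expf_neq0 2 g0)); rewrite -eq2 DE; ring.
have ncl e : nocroot b (l e).
  by move=> z bz; rewrite !hE bz mulr0 subr0; apply: (nocroot_sym nc).
have ncll e e' : e != e' -> nocroot (l e) (l e').
  move=> ee z; rewrite !hE => /subr0_eq az; rewrite az -mulrBl mulf_neq0 ?subr_eq0 //.
  by apply: contraTneq isT => bz; have := nc z; rewrite az bz mulr0 eqxx => /(_ erefl).
have ncM p q r : nocroot p q -> nocroot p r -> nocroot p (q * r).
  by move=> h1 h2 z pz; rewrite hornerM mulf_neq0 ?h1 ?h2.
have sqf p q : nocroot p q -> p * q = b * (l e1 * l e2 * l e3) ->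
    exists s, p = s ^+ 2.
  by move=> pq e; apply: (nocroot_square_factor pq); rewrite e eq3.
have [s0 s0E] : exists s, b = s ^+ 2.
  by apply: (sqf _ (l e1 * l e2 * l e3)) => //; (apply: (ncM); first apply: (ncM)); apply: (ncl).
have [s1 s1E] : exists s, l e1 = s ^+ 2.
  apply: (sqf _ (b * l e2 * l e3)); last by ring.
  by (apply: (ncM); first apply: (ncM)); [exact: nocroot_sym (ncl _) | apply: (ncll) | apply: (ncll)].
have [s2 s2E] : exists s, l e2 = s ^+ 2.
  apply: (sqf _ (b * l e1 * l e3)); last by ring.
  by (apply: (ncM); first apply: (ncM)); [exact: nocroot_sym (ncl _) | apply: (ncll); rewrite eq_sym | apply: (ncll)].
have [s3 s3E] : exists s, l e3 = s ^+ 2.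
  apply: (sqf _ (b * l e1 * l e2)); last by ring.
  by (apply: (ncM); first apply: (ncM)); [exact: nocroot_sym (ncl _) | apply: (ncll); rewrite eq_sym
    | apply: (ncll); rewrite eq_sym].
have [/size1_polyC aE /size1_polyC bE] : (size a <= 1)%N /\ (size b <= 1)%N.
  apply: (@pencil_squares_const char2 a b (fun j => nth (0 : K) [:: 0; 1; 1; 1] j)
    (fun j => nth (0 : K) [:: 1; - e1; - e2; - e3] j)
    (fun j => nth (0 : {poly K}) [:: s0; s1; s2; s3] j)) => //.
  - case=> [[|[|[|[|//]]]] j4] [[|[|[|[|//]]]] l4] //= _;
      rewrite ?(mul0r, mul1r, mulr1, oner_eq0, eqr_opp) // eq_sym ?oner_eq0 // eq_sym //.
  - case=> [[|[|[|[|//]]]] j4] /=; rewrite -?s0E -?s1E -?s2E -?s3E /l ?polyCN; ring.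
exists (a`_0 / b`_0); rewrite c0E c2E mulrA; congr (_ * _).
rewrite {1}aE {2}bE -polyCM divfK //.
by apply: contra b0 => /eqP b00; rewrite bE b00 polyC0.
Qed.

End ClosedFieldPoly.

(** * Smooth cubics and morphisms between them *)

Lemma four_neq0 (K : fieldType) : (2 : K) != 0 -> (4 : K) != 0.
Proof. by move=> n2; rewrite (natrM _ 2 2) mulf_neq0. Qed.

Section Coordinates.
Variables (K : fieldType) (W : weierstrass K).
Implicit Type P : point W.

Definition hv (h : K -> K -> K -> K) (P : point W) : K :=
  if val P is Some (x, y) then h x y 1 else h 0 1 0.

Definition cx := hv (fun x _ _ => x).
Definition cy := hv (fun _ y _ => y).
Definition cz := hv (fun _ _ z => z).

Lemma hvE h P : hv h P = h (cx P) (cy P) (cz P).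
Proof. by rewrite /cx /cy /cz /hv; case: (val P) => [[x y]|]. Qed.

End Coordinates.

(** Completing the square brings every elliptic curve in characteristic other than 2 to this form;
    see [short_curve]. *)
Record scurve (K : fieldType) := SCurve {
  sc_w :> weierstrass K;
  sc_a1 : a1 sc_w = 0;
  sc_a3 : a3 sc_w = 0;
  sc_elliptic : elliptic sc_w;
  sc_char : (2 : K) != 0 }.

Section Cubic.
Variables (K : fieldType) (C : scurve K).

Definition cubic (x : K) := x ^+ 3 + a2 C * x ^+ 2 + a4 C * x + a6 C.
Definition dcubic (x : K) := 3 * x ^+ 2 + 2 * a2 C * x + a4 C.

Lemma on_curveE x y : on_curve C (Some (x, y)) = (y ^+ 2 == cubic x).
Proof. by rewrite /on_curve sc_a1 sc_a3 !mul0r !addr0. Qed.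

(** At a common zero of the cubic and its derivative, a4 and a6 become polynomials in x and a2, and
    the discriminant vanishes identically in these. *)
Lemma dcubic_neq0 x : cubic x = 0 -> dcubic x != 0.
Proof.
rewrite /cubic /dcubic => fx; apply: contra (sc_elliptic C) => /eqP dx.
have a4E : a4 C = - (3 * x ^+ 2 + 2 * a2 C * x).
  by apply: (lin_comb dx); ring.
have a6E : a6 C = 2 * x ^+ 3 + a2 C * x ^+ 2.
  by apply: (lin_comb (eqD fx (eqM (- x) a4E))); ring.
by rewrite /disc /b2 /b4 /b6 /b8 sc_a1 sc_a3 a4E a6E; apply/eqP; ring.
Qed.

Definition aff x y (h : y ^+ 2 = cubic x) : point C :=
  exist _ (Some (x, y)) (etrans (on_curveE x y) (introT eqP h)).

Variant point_spec : point C -> Prop :=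
  | PointO : point_spec (origin C)
  | PointA x y (h : y ^+ 2 = cubic x) : point_spec (aff h).

Lemma pointP P : point_spec P.
Proof.
case: P => [[[x y]|] h].
  have h' : y ^+ 2 = cubic x by apply/eqP; rewrite -on_curveE.
  rewrite (_ : exist _ _ _ = aff h'); first by constructor.
  exact: val_inj.
by rewrite (_ : exist _ _ _ = origin C); [constructor | apply: val_inj].
Qed.

Lemma aff_eq x y h x' y' h' : x = x' -> y = y' -> @aff x y h = @aff x' y' h'.
Proof. by move=> ex ey; apply: val_inj; rewrite /= ex ey. Qed.

Lemma aff_neq_origin x y (h : y ^+ 2 = cubic x) : aff h <> origin C.
Proof. by case. Qed.

Definition cubicP : {poly K} := 'X^3 + (a2 C)%:P * 'X^2 + (a4 C)%:P * 'X + (a6 C)%:P.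

Lemma cubicPE x : cubicP.[x] = cubic x.
Proof. by rewrite !hE. Qed.

Lemma size_cubicP : size cubicP = 4%N.
Proof.
rewrite /cubicP -!addrA size_polyDl ?size_polyXn //.
rewrite ltnS (leq_trans (size_polyD _ _)) // geq_max; apply/andP; split.
  by rewrite mul_polyC (leq_trans (size_scale_leq _ _)) // size_polyXn.
rewrite (leq_trans (size_polyD _ _)) // geq_max; apply/andP; split.
  by rewrite mul_polyC (leq_trans (size_scale_leq _ _)) // size_polyX.
by rewrite (leq_trans (size_polyC_leq1 _)).
Qed.

Lemma cubicP_neq0 : cubicP != 0.
Proof. by rewrite -size_poly_gt0 size_cubicP. Qed.

End Cubic.

(** * The affine coordinate ring of the curve *)

Section AffineFunctions.
Variables (K : closedFieldType) (C : scurve K).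
Implicit Types (A B : {poly K}) (h : K -> K -> K).

Let f := cubic C.

Lemma curve_point_over x : exists y, y ^+ 2 = f x.
Proof. exact: closed_sqrt. Qed.

(** Two of the roots come from the quadratic formula for the cofactor of X - e1; a repeated root
    would be a zero of the derivative. *)
Lemma cubic_roots : exists e1 e2 e3,
  [/\ e1 != e2, e1 != e3, e2 != e3 &
      a2 C = - (e1 + e2 + e3) /\ a4 C = e1 * e2 + e1 * e3 + e2 * e3 /\
      a6 C = - (e1 * e2 * e3)].
Proof.
have n2 := sc_char C; have n4 := four_neq0 n2.
have /closed_rootP [e1 /rootP] : size (cubicP C) != 1%N by rewrite size_cubicP.
rewrite cubicPE => fe1.
pose u := a2 C + e1; pose v := a4 C + e1 * u.
have [d dE] := closed_sqrt (u ^+ 2 - 4 * v).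
pose e2 := (d - u) / 2; pose e3 := (- d - u) / 2.
have u_e : u = - (e2 + e3) by rewrite /e2 /e3; field.
have v_e : v = e2 * e3.
  have -> : v = (u ^+ 2 - d ^+ 2) / 4 by rewrite dE; field; rewrite n4.
  by rewrite /e2 /e3; field; rewrite ?n2 ?n4.
have a2E : a2 C = - (e1 + e2 + e3).
  by apply: (lin_comb u_e); rewrite /u; ring.
have a4E : a4 C = e1 * e2 + e1 * e3 + e2 * e3.
  by apply: (lin_comb v_e); rewrite /v /u a2E; ring.
have a6E : a6 C = - (e1 * e2 * e3).
  by apply: (lin_comb fe1); rewrite /cubic a2E a4E; ring.
have fE x : f x = (x - e1) * (x - e2) * (x - e3).
  by rewrite /f /cubic a2E a4E a6E; ring.
have dfE x : dcubic C x =
    (x - e1) * (x - e2) + (x - e1) * (x - e3) + (x - e2) * (x - e3).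
  by rewrite /dcubic a2E a4E; ring.
have f1 : f e1 = 0 by rewrite fE; ring.
have f2 : f e2 = 0 by rewrite fE; ring.
exists e1, e2, e3; split=> //.
- by apply: contra (dcubic_neq0 f1) => /eqP e; rewrite dfE e; apply/eqP; ring.
- by apply: contra (dcubic_neq0 f1) => /eqP e; rewrite dfE e; apply/eqP; ring.
- by apply: contra (dcubic_neq0 f2) => /eqP e; rewrite dfE e; apply/eqP; ring.
Qed.

(** Parity of degrees: nonzero [A^2] has even degree and nonzero [f B^2] odd degree. So the norm
    [A^2 - f B^2] of A + y B vanishes only for A = B = 0. *)
Lemma norm_neq0 A B : A ^+ 2 = cubicP C * B ^+ 2 -> A = 0 /\ B = 0.
Proof.
have [->|B0] := eqVneq B 0.
  by rewrite expr0n mulr0 => /eqP; rewrite sqrf_eq0 => /eqP.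
have [->|A0] := eqVneq A 0.
  rewrite expr0n => /esym/eqP; rewrite mulf_eq0 sqrf_eq0 (negPf B0).
  by rewrite (negPf (cubicP_neq0 C)).
move/(congr1 (fun p : {poly K} => size p)).
rewrite !expr2 !size_mul ?mulf_neq0 ?cubicP_neq0 // size_cubicP.
move: A0 B0; rewrite -!size_poly_gt0.
by case: (size A) (size B) => // a [] // b _ _; rewrite !addSn !addnS /=; lia.
Qed.

Definition affine_ae (Q : K -> K -> Prop) :=
  exists s : seq K, forall x y, y ^+ 2 = f x -> x \notin s -> Q x y.

(** A point where A + y B vanishes lies over a root of its norm. *)
Lemma affine_zero_dichotomy A B :
  (A = 0 /\ B = 0) \/ affine_ae (fun x y => A.[x] + y * B.[x] != 0).
Proof.
have [/eqP|N0] := eqVneq (A ^+ 2 - cubicP C * B ^+ 2) 0.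
  by rewrite subr_eq0 => /eqP /norm_neq0; left.
right; have [r rE] := closed_field_poly_normal (A ^+ 2 - cubicP C * B ^+ 2).
exists r => x y yx; apply: contra => /eqP e.
have /rootP : (A ^+ 2 - cubicP C * B ^+ 2).[x] = 0.
  rewrite !(cubicPE, hE) -/f -yx -exprMn subr_sqr [X in _ * X]e mulr0 //.
by rewrite rE rootZ ?lead_coef_eq0 // root_prod_XsubC.
Qed.

Lemma affine_ae_exists Q : affine_ae Q -> exists x y, y ^+ 2 = f x /\ Q x y.
Proof.
case=> s h; have [x xs] := closed_avoid s; have [y yx] := curve_point_over x.
by exists x, y; split=> //; apply: h.
Qed.

Lemma affine_zero_coef A B :
  (forall x y, y ^+ 2 = f x -> A.[x] + y * B.[x] = 0) -> A = 0 /\ B = 0.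
Proof.
move=> h; have [//|/affine_ae_exists [x [y [yx]]]] := affine_zero_dichotomy A B.
by rewrite h ?eqxx.
Qed.

(** The ring [K[x, y] / (y^2 - f)], which is [K[x] + y K[x]], presented by functions on points. *)
Definition rfun h := exists A B, forall x y, y ^+ 2 = f x -> h x y = A.[x] + y * B.[x].

Lemma rfun_const c : rfun (fun _ _ => c).
Proof. by exists c%:P, 0 => x y _; rewrite !hE; ring. Qed.

Lemma rfun_poly A : rfun (fun x _ => A.[x]).
Proof. by exists A, 0 => x y _; rewrite !hE; ring. Qed.

Lemma rfun_y : rfun (fun _ y => y).
Proof. by exists 0, 1 => x y _; rewrite !hE; ring. Qed.

Lemma rfun_add h h' : rfun h -> rfun h' -> rfun (fun x y => h x y + h' x y).
Proof.
move=> [A [B e]] [A' [B' e']]; exists (A + A'), (B + B') => x y yx.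
by rewrite e // e' // !hE; ring.
Qed.

Lemma rfun_mul h h' : rfun h -> rfun h' -> rfun (fun x y => h x y * h' x y).
Proof.
move=> [A [B e]] [A' [B' e']].
exists (A * A' + cubicP C * B * B'), (A * B' + A' * B) => x y yx.
by rewrite e // e' // !(cubicPE, hE) -/f -yx; ring.
Qed.

Lemma rfun_opp h : rfun h -> rfun (fun x y => - h x y).
Proof. by move=> [A [B e]]; exists (- A), (- B) => x y yx; rewrite e // !hE; ring. Qed.

Lemma rfun_exp h n : rfun h -> rfun (fun x y => h x y ^+ n).
Proof.
move=> hh; elim: n => [|n IHn]; first by exists 1, 0 => x y _; rewrite expr0 !hE; ring.
have [A [B e]] := rfun_mul hh IHn.
by exists A, B => x y yx; rewrite exprS; apply: e.
Qed.

Lemma rfun_dichotomy h : rfun h ->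
  (forall x y, y ^+ 2 = f x -> h x y = 0) \/ affine_ae (fun x y => h x y != 0).
Proof.
move=> [A [B e]]; have [[A0 B0]|[s hs]] := affine_zero_dichotomy A B.
  by left=> x y yx; rewrite e // A0 B0 !hE; ring.
by right; exists s => x y yx xs; rewrite e //; apply: hs.
Qed.

End AffineFunctions.

(** * Forms in three variables *)

Section Homogeneous.
Variables (F K : fieldType) (iota : {rmorphism F -> K}).
Implicit Types h : K -> K -> K -> K.

Definition vec3 (x y z : K) : 'I_3 -> K := fun i => nth 0 [:: x; y; z] i.

(** A form over F is handled as a function on [K^3], so that [ring] and [field] can work on its
    defining expression; the polynomial itself is only asserted to exist. *)
Definition hpol (d : nat) h := exists2 p : {mpoly F[3]}, p \is d.-homog &
  forall x y z, h x y z = (map_mpoly iota p).@[vec3 x y z].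

Lemma hpol_conv d e h : hpol d h -> d = e -> hpol e h.
Proof. by move=> + <-. Qed.

Lemma hpol_coord (i : 'I_3) : hpol 1 (fun x y z => vec3 x y z i).
Proof.
exists 'X_i; first by rewrite dhomogX; apply/eqP; rewrite /= mdeg1.
by move=> x y z; rewrite map_mpolyX mevalXU.
Qed.

Lemma hpol_x : hpol 1 (fun x _ _ => x).
Proof. by have := hpol_coord (inord 0); rewrite /vec3 !inordK. Qed.

Lemma hpol_y : hpol 1 (fun _ y _ => y).
Proof. by have := hpol_coord (inord 1); rewrite /vec3 !inordK. Qed.

Lemma hpol_z : hpol 1 (fun _ _ z => z).
Proof. by have := hpol_coord (inord 2); rewrite /vec3 !inordK. Qed.

Lemma hpol_const c : hpol 0 (fun _ _ _ => iota c).
Proof.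
exists c%:MP; first by rewrite -[c%:MP]mulr1 mul_mpolyC dhomogZ // dhomog1.
by move=> x y z; rewrite map_mpolyC mevalC.
Qed.

Lemma hpol_nat n : hpol 0 (fun _ _ _ => n%:R).
Proof. by have := hpol_const n%:R; rewrite rmorph_nat. Qed.

Lemma hpol_zero d : hpol d (fun _ _ _ => 0).
Proof. by exists 0; [rewrite rpred0 | move=> *; rewrite !rmorph0]. Qed.

Lemma hpol_add d e h h' : hpol d h -> hpol e h' -> d = e ->
  hpol d (fun x y z => h x y z + h' x y z).
Proof.
move=> [p pd pE] [q qd qE] e_d; rewrite -e_d in qd; exists (p + q); first exact: rpredD.
by move=> x y z; rewrite pE qE !rmorphD.
Qed.

Lemma hpol_opp d h : hpol d h -> hpol d (fun x y z => - h x y z).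
Proof.
move=> [p pd pE]; exists (- p); first by rewrite rpredN.
by move=> x y z; rewrite pE !rmorphN.
Qed.

Lemma hpol_mul d e h h' : hpol d h -> hpol e h' ->
  hpol (d + e) (fun x y z => h x y z * h' x y z).
Proof.
move=> [p pd pE] [q qd qE]; exists (p * q); first exact: dhomogM.
by move=> x y z; rewrite pE qE !rmorphM.
Qed.

Lemma hpol_exp d h n : hpol d h -> hpol (d * n) (fun x y z => h x y z ^+ n).
Proof.
move=> [p pd pE]; exists (p ^+ n); first exact: dhomogMn.
by move=> x y z; rewrite pE !rmorphXn.
Qed.

Lemma hpol_eq d h h' : hpol d h -> (forall x y z, h x y z = h' x y z) -> hpol d h'.
Proof. by move=> [p pd pE] e; exists p => // x y z; rewrite -e. Qed.

Lemma hpol_monomials d h : hpol d h ->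
  exists l : seq (F * (nat * nat * nat)),
    (forall t, t \in l -> (t.2.1.1 + t.2.1.2 + t.2.2 = d)%N) /\
    forall x y z, h x y z =
      \sum_(t <- l) iota t.1 * (x ^+ t.2.1.1 * y ^+ t.2.1.2 * z ^+ t.2.2).
Proof.
move=> [p /dhomogP pd pE].
pose e (m : 'X_{1..3}) k := m (inord k : 'I_3).
exists [seq (p@_m, (e m 0, e m 1, e m 2)%N) | m <- msupp p]; split.
  move=> _ /mapP [m mp ->] /=; rewrite -(pd m mp) /= mdegE !big_ord_recl big_ord0 addn0 addnA.
  by rewrite /e; congr (m _ + m _ + m _)%N; apply: val_inj; rewrite /= inordK.
move=> x y z; rewrite pE big_map {1}[p]mpolyE (raddf_sum (map_mpoly iota)).
rewrite (raddf_sum (meval (vec3 x y z))); apply: eq_bigr => m _ /=.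
rewrite map_mpolyZ map_mpolyX mevalZ mevalX !big_ord_recl big_ord0 mulr1 mulrA /e.
congr (_ * (_ ^+ m _ * _ ^+ m _ * _ ^+ m _)) => //;
  by apply: val_inj; rewrite /= inordK.
Qed.

Lemma hpol_scale d h c x y z : hpol d h ->
  h (c * x) (c * y) (c * z) = c ^+ d * h x y z.
Proof.
move=> /hpol_monomials [l [ld lE]]; rewrite !lE big_distrr; apply: eq_big_seq => t /ld <- /=.
by rewrite !exprMn !exprD; ring.
Qed.

Lemma hpol_comp d e h g0 g1 g2 : hpol d h -> hpol e g0 -> hpol e g1 -> hpol e g2 ->
  hpol (d * e) (fun x y z => h (g0 x y z) (g1 x y z) (g2 x y z)).
Proof.
move=> /hpol_monomials [l [ld lE]] h0 h1 h2.
pose s (x y z : K) := \sum_(t <- l) iota t.1 *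
  (g0 x y z ^+ t.2.1.1 * g1 x y z ^+ t.2.1.2 * g2 x y z ^+ t.2.2).
apply: (@hpol_eq _ s); last by move=> x y z; rewrite lE.
rewrite {}/s; elim: l ld {lE} => [|t l IHl] ld.
  by apply: (hpol_eq (hpol_zero _)) => x y z; rewrite big_nil.
have IH : hpol (d * e) (fun x y z => \sum_(t <- l) iota t.1 *
  (g0 x y z ^+ t.2.1.1 * g1 x y z ^+ t.2.1.2 * g2 x y z ^+ t.2.2)).
  by apply: IHl => u ul; apply: ld; rewrite inE ul orbT.
have td : (0 + (e * t.2.1.1 + e * t.2.1.2 + e * t.2.2) = d * e)%N.
  by rewrite add0n -!mulnDr ld ?inE ?eqxx // mulnC.
have := hpol_add (hpol_conv (hpol_mul (hpol_const t.1)
  (hpol_mul (hpol_mul (hpol_exp t.2.1.1 h0) (hpol_exp t.2.1.2 h1)) (hpol_exp t.2.2 h2)))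
  td) IH erefl.
by move/hpol_eq; apply=> x y z; rewrite big_cons.
Qed.

End Homogeneous.

Lemma hpol_extend (F K : fieldType) (iota : {rmorphism F -> K}) d h :
  hpol iota d h -> hpol (idfun : {rmorphism K -> K}) d h.
Proof.
move=> /hpol_monomials [l [ld lE]].
pose s (x y z : K) := \sum_(t <- l) iota t.1 *
  (x ^+ t.2.1.1 * y ^+ t.2.1.2 * z ^+ t.2.2).
apply: (@hpol_eq _ _ _ _ s); last by move=> x y z; rewrite lE.
rewrite {}/s; elim: l ld {lE} => [|t l IHl] ld.
  by apply: (hpol_eq (hpol_zero _ _)) => x y z; rewrite big_nil.
have IH : hpol idfun d (fun x y z : K => \sum_(t <- l) iota t.1 *
  (x ^+ t.2.1.1 * y ^+ t.2.1.2 * z ^+ t.2.2)).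
  by apply: IHl => u ul; apply: ld; rewrite inE ul orbT.
have td : (0 + (1 * t.2.1.1 + 1 * t.2.1.2 + 1 * t.2.2) = d)%N.
  by rewrite add0n !mul1n ld ?inE ?eqxx.
have := hpol_add (hpol_conv (hpol_mul (hpol_const idfun (iota t.1))
  (hpol_mul (hpol_mul (hpol_exp t.2.1.1 (hpol_x _)) (hpol_exp t.2.1.2 (hpol_y _)))
   (hpol_exp t.2.2 (hpol_z _)))) td) IH erefl.
by move/hpol_eq; apply=> x y z; rewrite big_cons.
Qed.

Lemma hpol_cst (K : fieldType) (c : K) : hpol idfun 0 (fun _ _ _ => c).
Proof. exact: (hpol_const idfun c). Qed.

Ltac hpol_deg :=
  lazymatch goal with
  | |- hpol _ _ (fun x y z => x) => apply: hpol_x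
  | |- hpol _ _ (fun x y z => y) => apply: hpol_y
  | |- hpol _ _ (fun x y z => z) => apply: hpol_z
  | |- hpol _ _ (fun x y z => @GRing.add _ (@?a x y z) (@?b x y z)) =>
      refine (@hpol_add _ _ _ _ _ a b _ _ _);
      [hpol_deg | hpol_deg | first [reflexivity | lia]]
  | |- hpol _ _ (fun x y z => @GRing.opp _ (@?a x y z)) =>
      refine (@hpol_opp _ _ _ _ a _); hpol_deg
  | |- hpol _ _ (fun x y z => @GRing.mul _ (@?a x y z) (@?b x y z)) =>
      refine (@hpol_mul _ _ _ _ _ a b _ _); hpol_deg
  | |- hpol _ _ (fun x y z => @GRing.exp _ (@?a x y z) ?n) =>
      refine (@hpol_exp _ _ _ _ a n _); hpol_deg
  | |- _ => first [eassumption | apply: hpol_nat | apply: hpol_const | apply: hpol_cst]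
  end.
Ltac hpol_tac := refine (hpol_conv _ _); [hpol_deg | first [reflexivity | lia]].

(** * Pole orders at the origin and the identity principle *)

Section PoleOrder.
Variables (K : closedFieldType) (C : scurve K).
Implicit Types (A B : {poly K}) (g : K -> K -> K).
Let f := cubic C.

(* Functions whose pole at the origin has order at most n: x and y have
   poles of order 2 and 3. *)
Definition wfun n g := exists A B,
  [/\ (2 * size A <= n + 2)%N, (2 * size B <= n - 1)%N &
      forall x y, y ^+ 2 = f x -> g x y = A.[x] + y * B.[x]].

Lemma wfun_le n m g : (n <= m)%N -> wfun n g -> wfun m g.
Proof.
by move=> nm [A [B [sA sB e]]]; exists A, B; split=> //; [move: sA | move: sB]; lia.
Qed.

Lemma wfun_const c : wfun 0 (fun _ _ => c).
Proof.
exists c%:P, 0; split; last by move=> x y _; rewrite !hE; ring.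
- by have := size_polyC_leq1 c; lia.
- by rewrite size_poly0.
Qed.

Lemma wfun_x : wfun 2 (fun x _ => x).
Proof.
by exists 'X, 0; rewrite size_polyX size_poly0; split=> // x y _; rewrite !hE; ring.
Qed.

Lemma wfun_y : wfun 3 (fun _ y => y).
Proof.
by exists 0, 1; rewrite size_poly1 size_poly0; split=> // x y _; rewrite !hE; ring.
Qed.

Lemma wfun_add n g g' : wfun n g -> wfun n g' -> wfun n (fun x y => g x y + g' x y).
Proof.
move=> [A [B [sA sB e]]] [A' [B' [sA' sB' e']]]; exists (A + A'), (B + B'); split.
- by have := size_polyD A A'; lia.
- by have := size_polyD B B'; lia.
by move=> x y yx; rewrite e // e' // !hE; ring.
Qed.

Lemma wfun_mul n m g g' :
  wfun n g -> wfun m g' -> wfun (n + m) (fun x y => g x y * g' x y).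
Proof.
move=> [A [B [sA sB e]]] [A' [B' [sA' sB' e']]].
have sM (p q : {poly K}) : (size p = 0%N /\ size (p * q) = 0%N) \/
   (size q = 0%N /\ size (p * q) = 0%N) \/
   ((0 < size p)%N /\ (0 < size q)%N /\ size (p * q) = (size p + size q).-1).
  have [->|p0] := eqVneq p 0; first by rewrite mul0r size_poly0; left.
  have [->|q0] := eqVneq q 0; first by rewrite mulr0 size_poly0; right; left.
  by right; right; rewrite size_mul // !size_poly_gt0.
pose mulsize (a b c : nat) := (a = 0 /\ c = 0) \/ (b = 0 /\ c = 0) \/
  ((0 < a)%N /\ (0 < b)%N /\ c = (a + b).-1).
have arA (a a' b b' aa bb fb t : nat) : (2 * a <= n + 2)%N -> (2 * b <= n - 1)%N ->
    (2 * a' <= m + 2)%N -> (2 * b' <= m - 1)%N -> (t <= maxn aa fb)%N ->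
    mulsize a a' aa -> mulsize b b' bb -> mulsize 4%N bb fb -> (2 * t <= n + m + 2)%N.
  by rewrite /mulsize; lia.
have arB (a a' b b' ab ba t : nat) : (2 * a <= n + 2)%N -> (2 * b <= n - 1)%N ->
    (2 * a' <= m + 2)%N -> (2 * b' <= m - 1)%N -> (t <= maxn ab ba)%N ->
    mulsize a b' ab -> mulsize a' b ba -> (2 * t <= n + m - 1)%N.
  by rewrite /mulsize; lia.
exists (A * A' + cubicP C * (B * B')), (A * B' + A' * B); split.
- apply: (arA _ _ _ _ _ _ _ _ sA sB sA' sB' (size_polyD _ _) (sM _ _) (sM _ _)).
  by rewrite -(size_cubicP C); apply: sM.
- exact: (arB _ _ _ _ _ _ _ sA sB sA' sB' (size_polyD _ _) (sM _ _) (sM _ _)).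
by move=> x y yx; rewrite e // e' // !(cubicPE, hE) -/f -yx; ring.
Qed.

Lemma wfun_exp n g k : wfun n g -> wfun (n * k) (fun x y => g x y ^+ k).
Proof.
move=> hg; elim: k => [|k IHk]; first by rewrite muln0; apply: wfun_const.
rewrite mulnS; have [A [B [sA sB e]]] := wfun_mul hg IHk.
by exists A, B; split=> // x y yx; rewrite exprS; apply: e.
Qed.

Lemma wfun_eq n g g' :
  wfun n g -> (forall x y, y ^+ 2 = f x -> g x y = g' x y) -> wfun n g'.
Proof. by move=> [A [B [sA sB e]]] h; exists A, B; split=> // x y yx; rewrite -h ?e. Qed.

(** On z = 1 the monomial [x^i y^j z^k] has pole order at most 2 i + 3 j, which reaches 3 d only for
    [y^d]; the coefficient of [y^d] is the value of h at the origin. *)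
Lemma hpol_leading d h : hpol idfun d h ->
  wfun (3 * d - 1) (fun x y => h x y 1 - h 0 1 0 * y ^+ d).
Proof.
move=> /hpol_monomials [l [ld lE]].
pose g (t : K * (nat * nat * nat)) (x y z : K) :=
  t.1 * (x ^+ t.2.1.1 * y ^+ t.2.1.2 * z ^+ t.2.2).
have gw t : t \in l -> wfun (3 * d - 1) (fun x y => g t x y 1 - g t 0 1 0 * y ^+ d).
  move=> /ld; case: t => c [[i j] k] /= ijk; rewrite /g /=.
  have [ik|ik] := posnP (i + k).
    have [i0 k0] : i = 0%N /\ k = 0%N by lia.
    have jd : j = d by lia.
    apply: (wfun_le _ (wfun_eq (wfun_const 0) _)) => [|x y _]; first by lia.
    by rewrite i0 k0 jd !expr1n !expr0; ring.
  have c0 : c * (0 ^+ i * 1 ^+ j * 0 ^+ k) = 0.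
    rewrite !expr0n; case: i ik {ijk} => [|i] ik; rewrite ?(mul0r, mulr0) //.
    by case: k ik => // k _; rewrite !(mulr0).
  apply: wfun_le (wfun_eq (wfun_mul (wfun_const c)
    (wfun_mul (wfun_exp i wfun_x) (wfun_exp j wfun_y))) _); first by lia.
  by move=> x y _; rewrite c0 expr1n; ring.
have : wfun (3 * d - 1)
    (fun x y => \sum_(t <- l) (g t x y 1 - g t 0 1 0 * y ^+ d)).
  elim: l gw {ld lE} => [|t l IHl] gw.
    apply: wfun_le (wfun_eq (wfun_const 0) _); first by lia.
    by move=> x y _; rewrite big_nil.
  apply: (@wfun_eq _ (fun x y => (g t x y 1 - g t 0 1 0 * y ^+ d) +
     \sum_(t <- l) (g t x y 1 - g t 0 1 0 * y ^+ d))).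
    by apply: wfun_add; [apply/gw/mem_head | apply: IHl => u ul; apply: gw;
      rewrite inE ul orbT].
  by move=> x y _; rewrite big_cons.
move/wfun_eq; apply=> x y _; rewrite !lE mulr_suml -sumrB; apply: eq_bigr => t _.
by [].
Qed.

Lemma wfun_rfun n g : wfun n g -> rfun C g.
Proof. by move=> [A [B [_ _ e]]]; exists A, B. Qed.

Lemma hpol_rfun d h : hpol idfun d h -> rfun C (fun x y => h x y 1).
Proof.
move=> /hpol_leading /wfun_rfun hr.
have [A [B e]] := rfun_add hr (rfun_mul (rfun_const C (h 0 1 0)) (rfun_exp d (rfun_y C))).
by exists A, B => x y yx; rewrite -e // subrK.
Qed.

(** Vanishing on the affine part makes c [y^d], where c is the value at the origin and [y^d] has
    pole order 3 d, the opposite of a function of smaller pole order; so c = 0. Even and odd d are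
    separated because [y^d] is then [f^k] or [y f^k]. *)
Lemma hpol_zero_origin d h : hpol idfun d h ->
  (forall x y, y ^+ 2 = f x -> h x y 1 = 0) -> h 0 1 0 = 0.
Proof.
move=> hd h0; have [d0|d0] := posnP d.
  have [y yx] := curve_point_over C 0; set x := 0 in yx.
  have := hpol_scale 0 x y 1 hd; have := hpol_scale 0 0 1 0 hd.
  by rewrite d0 !mul0r !mul1r h0 // => ->.
have [A [B [sA sB e]]] := hpol_leading hd; set c := h 0 1 0 in e *.
have e' x y : y ^+ 2 = f x -> A.[x] + y * B.[x] + c * y ^+ d = 0.
  by move=> yx; rewrite -e // h0 // sub0r addNr.
apply/eqP; apply: contraT => c0; exfalso.
have sf k : (size (c%:P * cubicP C ^+ k)%R = 3 * k + 1)%N.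
  rewrite mul_polyC size_scale //; elim: k => [|k IHk]; first by rewrite expr0 size_poly1.
  rewrite exprS size_mul ?expf_neq0 ?cubicP_neq0 // size_cubicP IHk; lia.
have [k dk] : exists k, d = k.*2 \/ d = k.*2.+1.
  by exists d./2; have := odd_double_half d; case: (odd d) => e1; [right | left];
    rewrite -{1}e1.
case: dk => dk.
  have [e0 _] : A + c%:P * cubicP C ^+ k = 0 /\ B = 0.
    apply: (@affine_zero_coef _ C) => x y yx; rewrite -[RHS](e' _ _ yx) !(cubicPE, hE) dk.
    by rewrite -mul2n exprM yx; ring.
  have : size A = size (c%:P * cubicP C ^+ k).
    by rewrite -[A](addrK (c%:P * cubicP C ^+ k)) e0 sub0r size_polyN.
  by rewrite sf => sAk; move: sA; rewrite sAk; lia.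
have [_ e0] : A = 0 /\ B + c%:P * cubicP C ^+ k = 0.
  apply: (@affine_zero_coef _ C) => x y yx; rewrite -[RHS](e' _ _ yx) !(cubicPE, hE) dk.
  by rewrite exprS -mul2n exprM yx; ring.
have : size B = size (c%:P * cubicP C ^+ k).
  by rewrite -[B](addrK (c%:P * cubicP C ^+ k)) e0 sub0r size_polyN.
by rewrite sf => sBk; move: sB; rewrite sBk; lia.
Qed.

Definition ae (Q : point C -> Prop) :=
  exists s : seq K, forall x y (h : y ^+ 2 = f x), x \notin s -> Q (aff h).

Definition freq (Q : point C -> Prop) :=
  forall s : seq K, exists x y (h : y ^+ 2 = f x), x \notin s /\ Q (aff h).

Lemma ae_and Q R : ae Q -> ae R -> ae (fun P => Q P /\ R P).
Proof.
move=> [s hs] [t ht]; exists (s ++ t) => x y h; rewrite mem_cat negb_or.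
by case/andP => xs xt; split; [apply: hs | apply: ht].
Qed.

Lemma ae_impl Q R : (forall P, Q P -> R P) -> ae Q -> ae R.
Proof. by move=> QR [s hs]; exists s => x y h /hs -/(_ _ h)/QR. Qed.

Lemma ae_x (s : seq K) : ae (fun P => cx P \notin s).
Proof. by exists s. Qed.

Lemma ae_freq Q : ae Q -> freq Q.
Proof.
move=> [s hs] t; have [x] := closed_avoid (s ++ t).
rewrite mem_cat negb_or => /andP [xs xt]; have [y yx] := curve_point_over C x.
by exists x, y, yx; split=> //; apply: hs.
Qed.

Lemma freq_ae Q R : freq Q -> ae R -> freq (fun P => Q P /\ R P).
Proof.
move=> fQ [s hs] t; have [x [y [h [+ q]]]] := fQ (s ++ t).
by rewrite mem_cat negb_or => /andP [xs xt]; exists x, y, h; do !split=> //; apply: hs.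
Qed.

Lemma freq_impl (Q R : point C -> Prop) : (forall P, Q P -> R P) -> freq Q -> freq R.
Proof. by move=> QR fQ s; have [x [y [h [xs /QR]]]] := fQ s; exists x, y, h. Qed.

Lemma freq_exists Q : freq Q -> exists P, Q P.
Proof. by move/(_ [::]) => [x [y [h [_ q]]]]; exists (aff h). Qed.

Lemma ae_exists Q : ae Q -> exists P, Q P.
Proof. by move/ae_freq/freq_exists. Qed.

(** The affine part is decided by the norm, and the origin then follows by [hpol_zero_origin]. *)
Lemma hpol_dichotomy d h : hpol idfun d h ->
  (forall P : point C, hv h P = 0) \/ ae (fun P => hv h P != 0).
Proof.
move=> hd; have [h0|[s hs]] := rfun_dichotomy (hpol_rfun hd).
  left=> P; have [|x y yx] := pointP P; last exact: h0.
  exact: (hpol_zero_origin hd).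
by right; exists s => x y yx xs; apply: hs.
Qed.

Lemma hpol_freq0 d h : hpol idfun d h -> freq (fun P => hv h P = 0) ->
  forall P : point C, hv h P = 0.
Proof.
move=> hd h0; have [//|h1] := hpol_dichotomy hd.
by have [P [-> /eqP]] := freq_exists (freq_ae h0 h1).
Qed.

End PoleOrder.

(** * Proportional triples and projective points *)

Section Proportional.
Variable K : fieldType.
Implicit Types a b c k : K.

(** Vanishing of the 2 by 2 minors rather than equality of projective points: the zero triple is
    parallel to everything, so a formula can be asserted at every point, and parallelism of two
    formulas is itself the vanishing of forms. *)
Definition par a b c a' b' c' := [/\ a * b' = a' * b, a * c' = a' * c & b * c' = b' * c].
Definition nz3 a b c := ~~ [&& a == 0, b == 0 & c == 0].

Lemma par_scale a b c a' b' c' : nz3 a' b' c' -> par a b c a' b' c' ->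
  exists k, [/\ a = k * a', b = k * b' & c = k * c'].
Proof.
move=> nz [e1 e2 e3].
have [a0|a0] := eqVneq a' 0; last first.
  exists (a / a'); split; first by rewrite divfK.
  - by apply: (mulfI a0); rewrite -e1; field.
  - by apply: (mulfI a0); rewrite -e2; field.
have [b0|b0] := eqVneq b' 0; last first.
  exists (b / b'); split; last 1 first.
  - by apply: (mulfI b0); rewrite -e3; field.
  - by apply: (mulIf b0); rewrite e1; field.
  - by rewrite divfK.
have c0 : c' != 0 by move: nz; rewrite /nz3 a0 b0 eqxx.
exists (c / c'); split; last by rewrite divfK.
- by apply: (mulIf c0); rewrite e2; field.
- by apply: (mulIf c0); rewrite e3; field.
Qed.

Lemma par_sym a b c a' b' c' : par a b c a' b' c' -> par a' b' c' a b c.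
Proof. by case=> e1 e2 e3; split. Qed.

Lemma par_scaled k a b c : par (k * a) (k * b) (k * c) a b c.
Proof. by split; ring. Qed.

Lemma nz3_scale k a b c : nz3 (k * a) (k * b) (k * c) -> k != 0.
Proof. by apply: contraNneq => ->; rewrite /nz3 !mul0r eqxx. Qed.

Lemma par_trans a b c a' b' c' a'' b'' c'' : nz3 a' b' c' ->
  par a b c a' b' c' -> par a' b' c' a'' b'' c'' -> par a b c a'' b'' c''.
Proof.
move=> nz /(par_scale nz) [k [-> -> ->]] [e1 e2 e3].
by split; rewrite -mulrA ?(e1, e2, e3) mulrCA.
Qed.

Lemma nz3_1 a b c : a != 0 -> nz3 a b c.
Proof. by rewrite /nz3 => /negPf ->. Qed.
Lemma nz3_2 a b c : b != 0 -> nz3 a b c.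
Proof. by rewrite /nz3 => /negPf ->; rewrite andbF. Qed.
Lemma nz3_3 a b c : c != 0 -> nz3 a b c.
Proof. by rewrite /nz3 => /negPf ->; rewrite !andbF. Qed.

Section Representation.
Variable W : weierstrass K.
Implicit Types P Q : point W.

Definition rep P a b c := par a b c (cx P) (cy P) (cz P).

Lemma coord_nz P : nz3 (cx P) (cy P) (cz P).
Proof.
by rewrite /cx /cy /cz /hv; case: (val P) => [[x y]|];
  [apply: nz3_3 | apply: nz3_2]; apply: oner_neq0.
Qed.

Lemma repP P a b c : rep P a b c -> exists k, [/\ a = k * cx P, b = k * cy P & c = k * cz P].
Proof. exact/par_scale/coord_nz. Qed.

Lemma rep_scale P k : rep P (k * cx P) (k * cy P) (k * cz P).
Proof. exact: par_scaled. Qed.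

End Representation.

Variable C : scurve K.
Implicit Types P Q : point C.

Lemma rep_inj P Q a b c : nz3 a b c -> rep P a b c -> rep Q a b c -> P = Q.
Proof.
move=> nz rP rQ; have := par_trans nz (par_sym rP) rQ.
rewrite /cx /cy /cz /hv; case: (pointP P) => [|x y h] /=;
  case: (pointP Q) => [|x' y' h'] //= [e1 e2 e3].
- by move/eqP: e3; rewrite mulr1 mulr0 oner_eq0.
- by move/eqP: e3; rewrite mulr1 mulr0 eq_sym oner_eq0.
by apply: aff_eq; [have := e2 | have := e3]; rewrite !mulr1.
Qed.

Lemma rep_origin a b c : nz3 a b c -> rep (origin C) a b c -> a = 0 /\ c = 0.
Proof. by move=> nz /repP [k [-> _ ->]]; rewrite /cx /cz /hv /= !mulr0. Qed.

Lemma rep_aff x y (h : y ^+ 2 = cubic C x) a b c :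
  a = c * x -> b = c * y -> rep (aff h) a b c.
Proof. by move=> -> ->; rewrite /rep /cx /cy /cz /hv /=; split; ring. Qed.

Lemma rep_affE x y (h : y ^+ 2 = cubic C x) a b c :
  rep (aff h) a b c -> a = c * x /\ b = c * y.
Proof. by move/repP => [k]; rewrite /cx /cy /cz /hv /= => -[-> -> ->]; rewrite mulr1. Qed.

Lemma rep_O a b c : a = 0 -> c = 0 -> rep (origin C) a b c.
Proof. by move=> -> ->; rewrite /rep /cx /cy /cz /hv /=; split; ring. Qed.

Lemma rep_curve P a b c : rep P a b c ->
  b ^+ 2 * c = a ^+ 3 + a2 C * a ^+ 2 * c + a4 C * a * c ^+ 2 + a6 C * c ^+ 3.
Proof.
move/repP => [k [-> -> ->]]; have [|x y h] := pointP P; rewrite /cx /cy /cz /hv /=.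
  by ring.
by apply: (lin_comb (eqM (k ^+ 3) h)); rewrite /cubic; ring.
Qed.

End Proportional.

(** * Morphisms of projective curves *)

Section Morphisms.
Variables (F K : fieldType) (iota : {rmorphism F -> K}).

(** The triple chosen for P0 must be nonzero there, while [rep] is imposed at every point and says
    nothing where the triple vanishes. On base changes of curves over F this is [morphism_over], by
    [morphism_overE]. *)
Definition mor (C1 C2 : weierstrass K) (alpha : point C1 -> point C2) :=
  forall P0 : point C1, exists d g0 g1 g2,
    [/\ hpol iota d g0, hpol iota d g1, hpol iota d g2,
        nz3 (hv g0 P0) (hv g1 P0) (hv g2 P0) &
        forall P, rep (alpha P) (hv g0 P) (hv g1 P) (hv g2 P)].

Lemma mor_id (C : weierstrass K) : mor (fun P : point C => P).
Proof.
move=> P0; exists 1%N, (fun x _ _ => x), (fun _ y _ => y), (fun _ _ z => z).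
split; [exact: hpol_x | exact: hpol_y | exact: hpol_z | exact: coord_nz |].
by move=> P; split.
Qed.

Section Composition.
Variables (C1 C2 : weierstrass K) (beta : point C1 -> point C2).
Variables (e : nat) (h0 h1 h2 : K -> K -> K -> K).
Hypotheses (e0 : hpol iota e h0) (e1 : hpol iota e h1) (e2 : hpol iota e h2).

Lemma hpol_eval h Q k : hpol iota e h ->
  h (k * cx Q) (k * cy Q) (k * cz Q) = k ^+ e * hv h (Q : point C1).
Proof. by move=> he; rewrite hvE -(hpol_scale _ _ _ _ he). Qed.

Lemma rep_comp Q a b c :
  rep (beta Q) (hv h0 Q) (hv h1 Q) (hv h2 Q) -> rep Q a b c ->
  rep (beta Q) (h0 a b c) (h1 a b c) (h2 a b c).
Proof.
move=> rh /repP [k [-> -> ->]]; rewrite !hpol_eval //.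
by have [k' [-> -> ->]] := repP rh; rewrite !mulrA; apply: rep_scale.
Qed.

Lemma nz3_comp (Q : point C1) a b c : nz3 (hv h0 Q) (hv h1 Q) (hv h2 Q) -> nz3 a b c ->
  rep Q a b c -> nz3 (h0 a b c) (h1 a b c) (h2 a b c).
Proof.
move=> nzh nz /repP [k [aE bE cE]]; have kn : k != 0.
  by apply: (@nz3_scale _ k (cx Q) (cy Q) (cz Q)); rewrite -aE -bE -cE.
by rewrite aE bE cE !hpol_eval // /nz3 !mulf_eq0 expf_eq0 (negPf kn) andbF.
Qed.

End Composition.

Lemma mor_comp (C1 C2 C3 : weierstrass K) (alpha : point C1 -> point C2)
    (beta : point C2 -> point C3) :
  mor alpha -> mor beta -> mor (fun P => beta (alpha P)).
Proof.
move=> ma mb P0; have [d [g0 [g1 [g2 [d0 d1 d2 nzg rg]]]]] := ma P0.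
have [e [h0 [h1 [h2 [e0 e1 e2 nzh rh]]]]] := mb (alpha P0).
pose c h x y z := h (g0 x y z) (g1 x y z) (g2 x y z) : K.
have cE h P : hv (c h) P = h (hv g0 P) (hv g1 P) (hv g2 P) by rewrite !hvE.
exists (e * d)%N, (c h0), (c h1), (c h2); split; do ?exact: hpol_comp.
  by rewrite !cE; apply: (nz3_comp e0 e1 e2 nzh nzg (rg _)).
by move=> P; rewrite !cE; apply: (rep_comp e0 e1 e2 (rh _) (rg _)).
Qed.

End Morphisms.

Lemma mor_extend (F K : fieldType) (iota : {rmorphism F -> K}) (C1 C2 : weierstrass K)
  (alpha : point C1 -> point C2) : mor iota alpha -> mor idfun alpha.
Proof.
move=> ma P0; have [d [g0 [g1 [g2 [d0 d1 d2 nzg rg]]]]] := ma P0.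
by exists d, g0, g1, g2; split=> //; apply: hpol_extend; eassumption.
Qed.

Section ClosedMorphisms.
Variable K : closedFieldType.
Variables C1 C2 : scurve K.
Implicit Types alpha beta : point C1 -> point C2.

Lemma mor_const (T : point C2) : mor idfun (fun _ : point C1 => T).
Proof.
move=> P0; exists 0%N, (fun _ _ _ => cx T), (fun _ _ _ => cy T), (fun _ _ _ => cz T).
split; do ?exact: hpol_cst.
  by rewrite !hvE; apply: coord_nz.
by move=> P; rewrite !hvE; split.
Qed.

Lemma hpol_par d e (g0 g1 g2 h0 h1 h2 : K -> K -> K -> K) :
  hpol idfun d g0 -> hpol idfun d g1 -> hpol idfun d g2 ->
  hpol idfun e h0 -> hpol idfun e h1 -> hpol idfun e h2 ->
  freq (fun P : point C1 => par (hv g0 P) (hv g1 P) (hv g2 P) (hv h0 P) (hv h1 P) (hv h2 P)) ->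
  forall P : point C1, par (hv g0 P) (hv g1 P) (hv g2 P) (hv h0 P) (hv h1 P) (hv h2 P).
Proof.
move=> d0 d1 d2 e0 e1 e2 fr P.
have cross g h g' h' : hpol idfun d g -> hpol idfun e h -> hpol idfun d g' ->
    hpol idfun e h' -> freq (fun P : point C1 => hv g P * hv h' P = hv h P * hv g' P) ->
    hv g P * hv h' P = hv h P * hv g' P.
  move=> dg eh dg' eh' gh.
  have wd : hpol idfun (d + e) (fun x y z => g x y z * h' x y z - h x y z * g' x y z).
    apply: hpol_add; [exact: hpol_mul | apply/hpol_opp | reflexivity].
    by rewrite addnC; apply: hpol_mul.
  apply: subr0_eq; have := hpol_freq0 wd _ P; rewrite !hvE; apply.
  by apply: freq_impl gh => Q; rewrite !hvE => ->; rewrite subrr.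
by split; apply: cross => //; apply: freq_impl fr => Q [].
Qed.

(** A local triple has to be right only at its base point and almost everywhere. At another point P1
    it is compared with the triple chosen for P1: the two are parallel almost everywhere, hence
    everywhere, since the minors are forms. *)
Lemma mor_weak alpha :
  (forall P0, exists d g0 g1 g2,
    [/\ hpol idfun d g0, hpol idfun d g1, hpol idfun d g2,
        nz3 (hv g0 P0) (hv g1 P0) (hv g2 P0) /\
        rep (alpha P0) (hv g0 P0) (hv g1 P0) (hv g2 P0) &
        ae (fun P => rep (alpha P) (hv g0 P) (hv g1 P) (hv g2 P))]) ->
  mor idfun alpha.
Proof.
move=> w P0; have [d [g0 [g1 [g2 [d0 d1 d2 [nzg _] rg]]]]] := w P0.
exists d, g0, g1, g2; split=> // P1.
have [e [h0 [h1 [h2 [e0 e1 e2 [nzh rh1] rh]]]]] := w P1.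
apply: par_trans (nzh) _ (rh1); apply: (hpol_par d0 d1 d2 e0 e1 e2).
apply: ae_freq; apply: ae_impl (ae_and rg rh) => Q [r1 r2].
exact: par_trans (coord_nz _) r1 (par_sym r2).
Qed.

(** The local triples of alpha and beta at P are parallel over infinitely many abscissas, hence
    everywhere; both are nonzero at P itself. *)
Lemma mor_agree alpha beta : mor idfun alpha -> mor idfun beta ->
  freq (fun P => alpha P = beta P) -> forall P, alpha P = beta P.
Proof.
move=> ma mb fr P; have [d [g0 [g1 [g2 [d0 d1 d2 nzg rg]]]]] := ma P.
have [e [h0 [h1 [h2 [e0 e1 e2 nzh rh]]]]] := mb P.
apply: (rep_inj nzh _ (rh P)).
apply: par_trans (nzg) _ (rg P); apply/par_sym; move: (P).
apply: (hpol_par d0 d1 d2 e0 e1 e2); apply: freq_impl fr => Q eQ.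
by apply: par_trans (coord_nz _) (rg Q) (par_sym _); rewrite eQ; apply: rh.
Qed.

Lemma nz_ae d (g0 g1 g2 : K -> K -> K -> K) (P0 : point C1) :
  hpol idfun d g0 -> hpol idfun d g1 -> hpol idfun d g2 ->
  nz3 (hv g0 P0) (hv g1 P0) (hv g2 P0) ->
  ae (fun P : point C1 => nz3 (hv g0 P) (hv g1 P) (hv g2 P)).
Proof.
move=> d0 d1 d2 nz; have [z0|n0] := @hpol_dichotomy K C1 _ _ d0; last first.
  by apply: ae_impl n0 => P; apply: nz3_1.
have [z1|n1] := @hpol_dichotomy K C1 _ _ d1; last first.
  by apply: ae_impl n1 => P; apply: nz3_2.
have [z2|n2] := @hpol_dichotomy K C1 _ _ d2; last first.
  by apply: ae_impl n2 => P; apply: nz3_3.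
by move: nz; rewrite /nz3 z0 z1 z2 eqxx.
Qed.

Lemma mor_dichotomy alpha beta : mor idfun alpha -> mor idfun beta ->
  (forall P, alpha P = beta P) \/ ae (fun P => alpha P <> beta P).
Proof.
move=> ma mb; have [d [g0 [g1 [g2 [d0 d1 d2 nzg rg]]]]] := ma (origin C1).
have [e [h0 [h1 [h2 [e0 e1 e2 nzh rh]]]]] := mb (origin C1).
have cross g h g' h' : hpol idfun d g -> hpol idfun e h -> hpol idfun d g' ->
    hpol idfun e h' -> (forall P : point C1, hv g P * hv h' P = hv h P * hv g' P) \/
    ae (fun P : point C1 => hv g P * hv h' P <> hv h P * hv g' P).
  move=> dg eh dg' eh'.
  have wd : hpol idfun (d + e) (fun x y z => g x y z * h' x y z - h x y z * g' x y z).
    apply: hpol_add; [exact: hpol_mul | apply/hpol_opp | reflexivity].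
    by rewrite addnC; apply: hpol_mul.
  have [z|z] := @hpol_dichotomy K C1 _ _ wd.
    by left=> P; apply: subr0_eq; have := z P; rewrite !hvE.
  by right; apply: ae_impl z => P; rewrite !hvE => /eqP nz /eqP;
    rewrite -subr_eq0 => /eqP.
have notpar (Q : point C1) : ~ par (hv g0 Q) (hv g1 Q) (hv g2 Q) (hv h0 Q) (hv h1 Q) (hv h2 Q) ->
    alpha Q <> beta Q.
  move=> np eQ; apply: np; apply: par_trans (coord_nz _) (rg Q) (par_sym _).
  by rewrite eQ; apply: rh.
have [c1|c1] := cross _ _ _ _ d0 e0 d1 e1; last first.
  by right; apply: ae_impl c1 => Q n; apply: notpar => -[].
have [c2|c2] := cross _ _ _ _ d0 e0 d2 e2; last first.
  by right; apply: ae_impl c2 => Q n; apply: notpar => -[].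
have [c3|c3] := cross _ _ _ _ d1 e1 d2 e2; last first.
  by right; apply: ae_impl c3 => Q n; apply: notpar => -[].
left; apply: mor_agree => //.
apply: freq_impl (ae_freq (ae_and (nz_ae d0 d1 d2 nzg) (nz_ae e0 e1 e2 nzh))) => Q [ng nh].
apply: (rep_inj nh _ (rh Q)); apply: par_trans (ng) _ (rg Q).
by apply/par_sym; split.
Qed.

End ClosedMorphisms.

(** * The group law *)

(* With slopes a, b of the chords P1P2, P2P3 and k = (a - b) / (u1 - u3), the
   chords (P1+P2)P3 and P1(P2+P3) have slopes 1/k - a and 1/k - b. *)
Lemma chord_associativity (K : fieldType) (A x1 y1 x2 y x3 y3 a b : K) :
  x1 != x3 -> y = y1 + a * (x2 - x1) -> y3 = y + b * (x3 - x2) ->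
  (A + x1 + x2 + x3) * (x1 - x3) = a * (y1 + y) - b * (y + y3) ->
  let x4 := a ^+ 2 - A - x1 - x2 in let y4 := a * (x1 - x4) - y1 in
  let x5 := b ^+ 2 - A - x2 - x3 in let y5 := b * (x2 - x5) - y in
  x4 != x3 -> x1 != x5 ->
  let c := (y3 - y4) / (x3 - x4) in let d := (y5 - y1) / (x5 - x1) in
  c ^+ 2 - A - x4 - x3 = d ^+ 2 - A - x1 - x5 /\
  c * (x4 - (c ^+ 2 - A - x4 - x3)) - y4 = d * (x1 - (d ^+ 2 - A - x1 - x5)) - y1.
Proof.
have [u1 ->] : exists u1, x1 = x2 + u1 by exists (x1 - x2); ring.
have [u3 ->] : exists u3, x3 = x2 + u3 by exists (x3 - x2); ring.
move=> x13 yE ->; have -> : y1 = y + a * u1 by rewrite yE; ring.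
have -> : y + b * (x2 + u3 - x2) = y + b * u3 by ring.
have u13 : u1 != u3 by apply: contra x13 => /eqP ->.
move=> rel x4 y4 x5 y5 x43 x15 c d.
have du : u1 - u3 != 0 by rewrite subr_eq0.
have [k kE] : exists k, k = (a - b) / (u1 - u3) by exists ((a - b) / (u1 - u3)).
have AE : A = (a * (2 * y + a * u1) - b * (2 * y + b * u3)) / (u1 - u3) - (3 * x2 + u1 + u3).
  rewrite (_ : a * (2 * y + a * u1) - b * (2 * y + b * u3) =
    (A + 3 * x2 + u1 + u3) * (u1 - u3)); last first.
    by apply: (lin_comb (esym rel)); ring.
  by rewrite mulfK //; ring.
(* The denominators factor as [x4 - x3 = - k m] and [x5 - x1 = - k n], so that k, m and n are all
   nonzero. *)
pose m := (a + b) * u3 + 2 * y; pose n := (a + b) * u1 + 2 * y.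
have x4E : x4 - (x2 + u3) = - k * m by rewrite /x4 kE /m AE; field.
have x5E : x5 - (x2 + u1) = - k * n by rewrite /x5 kE /n AE; field.
have km : k * m != 0 by move: x43; rewrite -subr_eq0 x4E mulNr oppr_eq0.
have kn : k * n != 0 by move: x15; rewrite eq_sym -subr_eq0 x5E mulNr oppr_eq0.
move: (km) (kn); rewrite !mulf_eq0 !negb_or => /andP [k0 m0] /andP [_ n0].
have aE : a = b + k * (u1 - u3) by rewrite kE; field.
have cE : c = k^-1 - a.
  have -> : c = (2 * y + (a + b) * u3 - a * (k * m)) / (k * m).
    rewrite /c; congr (_ / _); last by apply: (lin_comb (eqM (-1) x4E)); ring.
    by apply: (lin_comb (eqM a x4E)); rewrite /y4; ring.
  by rewrite (_ : 2 * y + _ = m); [field; rewrite ?k0 ?m0 | rewrite /m; ring].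
have dE : d = k^-1 - b.
  have -> : d = (b * (k * n) - (2 * y + (a + b) * u1)) / (- (k * n)).
    rewrite /d; congr (_ / _); last by rewrite x5E mulNr.
    by apply: (lin_comb (eqM (- b) x5E)); rewrite /y5; ring.
  by rewrite (_ : 2 * y + _ = n); [field; rewrite k0 oppr_eq0 kn | rewrite /n; ring].
have AE' : A = 2 * y * k + k * (a + b) * u1 + b ^+ 2 - (3 * x2 + u1 + u3).
  by rewrite AE kE; field.
have x6E : c ^+ 2 - A - x4 - (x2 + u3) = d ^+ 2 - A - (x2 + u1) - x5.
  rewrite cE dE /x4 /x5 AE' aE; field; rewrite k0 //.
by split=> //; rewrite -x6E cE dE /y4 /x4 AE' aE; field; rewrite k0.
Qed.

Section GroupLaw.
Variables (K : fieldType) (C : scurve K).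
Let f := cubic C.

Definition slope (x1 y1 x2 y2 : K) :=
  if x1 == x2 then dcubic C x1 / (2 * y1) else (y2 - y1) / (x2 - x1).

Definition addo (P Q : option (K * K)) : option (K * K) :=
  match P, Q with
  | None, _ => Q
  | _, None => P
  | Some (x1, y1), Some (x2, y2) =>
      if (x1 == x2) && (y1 == - y2) then None else
      let l := slope x1 y1 x2 y2 in
      let x3 := l ^+ 2 - a2 C - x1 - x2 in
      Some (x3, l * (x1 - x3) - y1)
  end.

Definition third_point l x1 y1 x2 : K * K :=
  let x3 := l ^+ 2 - a2 C - x1 - x2 in (x3, l * (x1 - x3) - y1).

Lemma third_point_on_curve l x1 y1 x2 :
  y1 ^+ 2 = f x1 ->
  x1 ^+ 2 + x1 * x2 + x2 ^+ 2 + a2 C * (x1 + x2) + a4 C = l * (2 * y1 + l * (x2 - x1)) ->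
  (third_point l x1 y1 x2).2 ^+ 2 = f (third_point l x1 y1 x2).1.
Proof.
rewrite /third_point /= => h1 D; set x3 := l ^+ 2 - a2 C - x1 - x2.
apply: (lin_comb (eqD h1 (eqM (x1 - x3) D))); rewrite /f /cubic /x3; ring.
Qed.

(** The left side of the second equation is the divided difference of the cubic between x1 and x2.
    In this form chords and tangents obey the same two equations and need no further case
    distinction. *)
Lemma slope_spec x1 y1 x2 y2 : y1 ^+ 2 = f x1 -> y2 ^+ 2 = f x2 ->
  ~~ ((x1 == x2) && (y1 == - y2)) ->
  let l := slope x1 y1 x2 y2 in
  y2 = y1 + l * (x2 - x1) /\
  x1 ^+ 2 + x1 * x2 + x2 ^+ 2 + a2 C * (x1 + x2) + a4 C = l * (y1 + y2).
Proof.
move=> h1; rewrite /slope; have [<- h2|x12 h2] /= := eqVneq x1 x2.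
  move=> y12; have yE : y2 = y1.
    have : y2 ^+ 2 = y1 ^+ 2 by rewrite h1 h2.
    by move/eqP; rewrite eqf_sqr => /orP [/eqP //|/eqP y2E]; rewrite y2E opprK eqxx in y12.
  have y0 : y1 != 0 by apply: contra y12; rewrite yE => /eqP ->; rewrite oppr0.
  rewrite yE; split; first by ring.
  by rewrite /dcubic; field; rewrite y0 sc_char.
move=> _; have dx : x2 - x1 != 0 by rewrite subr_eq0 eq_sym.
split; first by field.
apply: (mulIf dx); have -> : (y2 - y1) / (x2 - x1) * (y1 + y2) * (x2 - x1) = y2 ^+ 2 - y1 ^+ 2.
  by field.
by rewrite h1 h2 /f /cubic; ring.
Qed.

Lemma addo_on_curve (P Q : point C) : on_curve C (addo (val P) (val Q)).
Proof.
case: (pointP P) => [|x1 y1 h1]; first exact: (valP Q).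
case: (pointP Q) => [|x2 y2 h2]; first exact: (valP (aff h1)).
rewrite [addo _ _]/=; case: ifPn => // opp; rewrite on_curveE.
have := slope_spec h1 h2 opp; cbv zeta; move: (slope _ _ _ _) => l [yE D]; apply/eqP.
apply: (third_point_on_curve h1); rewrite D [in LHS]yE; ring.
Qed.

Definition addp (P Q : point C) : point C := exist (on_curve C) _ (addo_on_curve P Q).

Definition oppo (P : option (K * K)) := if P is Some (x, y) then Some (x, - y) else None.

Lemma oppo_on_curve (P : point C) : on_curve C (oppo (val P)).
Proof.
case: (pointP P) => [|x y h] //.
by rewrite [oppo _]/= on_curveE sqrrN h.
Qed.

Definition oppp (P : point C) : point C := exist (on_curve C) _ (oppo_on_curve P).

Lemma addpC P Q : addp P Q = addp Q P.
Proof.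
apply: val_inj => /=; case: (pointP P) => [|x1 y1 h1] /=; first by case: Q => [[[? ?]|] ?].
case: (pointP Q) => [|x2 y2 h2] //=.
have os : (x2 == x1) && (y2 == - y1) = (x1 == x2) && (y1 == - y2).
  by rewrite (eq_sym x2) (eq_sym y2) eqr_oppLR.
rewrite os; case: ifPn => // opp.
have [yE1 D1] := slope_spec h1 h2 opp; rewrite -os in opp.
have [yE2 D2] := slope_spec h2 h1 opp.
have lE : slope x2 y2 x1 y1 = slope x1 y1 x2 y2.
  rewrite /slope eq_sym; case: eqP => [xE|/eqP n].
    by rewrite xE yE1 xE subrr mulr0 addr0.
  by have n' := n; rewrite -subr_eq0 in n'; field; rewrite n' -opprB oppr_eq0 n'.
rewrite lE; clear D1 D2 yE2 lE; move: (slope _ _ _ _) yE1 => l ->.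
by congr (Some (_, _)); ring.
Qed.

Lemma add0p P : addp (origin C) P = P.
Proof. exact: val_inj. Qed.

Lemma addNp P : addp (oppp P) P = origin C.
Proof. by apply: val_inj; case: (pointP P) => [|x y h] //=; rewrite !eqxx. Qed.

Lemma addp_chord x1 y1 (h1 : y1 ^+ 2 = f x1) x2 y2 (h2 : y2 ^+ 2 = f x2) :
  x1 != x2 -> val (addp (aff h1) (aff h2)) =
    Some (third_point ((y2 - y1) / (x2 - x1)) x1 y1 x2).
Proof. by move=> x12; rewrite /= (negPf x12) /= /slope (negPf x12). Qed.

Lemma addp_aff x1 y1 (h1 : y1 ^+ 2 = f x1) x2 y2 (h2 : y2 ^+ 2 = f x2) :
  x1 != x2 -> let l := (y2 - y1) / (x2 - x1) in exists h3,
  addp (aff h1) (aff h2) = @aff _ C (l ^+ 2 - a2 C - x1 - x2)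
    (l * (x1 - (l ^+ 2 - a2 C - x1 - x2)) - y1) h3.
Proof.
move=> x12; have := addp_chord h1 h2 x12.
case: (pointP (addp _ _)) => [|x3 y3 h3] //= [e1 e2].
by move: (h3); rewrite e1 e2 => h3'; exists h3'; apply: aff_eq.
Qed.

Lemma chord_slope x1 y1 x2 y2 : y1 ^+ 2 = f x1 -> y2 ^+ 2 = f x2 -> x1 != x2 ->
  y2 = y1 + (y2 - y1) / (x2 - x1) * (x2 - x1) /\
  x1 ^+ 2 + x1 * x2 + x2 ^+ 2 + a2 C * (x1 + x2) + a4 C =
    (y2 - y1) / (x2 - x1) * (y1 + y2).
Proof.
move=> h1 h2 x12; have := slope_spec h1 h2; rewrite /slope (negPf x12) /=.
by move/(_ isT).
Qed.

Lemma addp_double x y (h : y ^+ 2 = f x) : y != 0 ->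
  val (addp (aff h) (aff h)) = Some (third_point (dcubic C x / (2 * y)) x y x).
Proof.
move=> y0; rewrite /= eqxx /= ifN /slope ?eqxx //.
by rewrite -addr_eq0 -mulr2n -mulr_natl mulf_neq0 ?sc_char.
Qed.

End GroupLaw.

Lemma mor_opp (F K : fieldType) (iota : {rmorphism F -> K}) (C : scurve K) :
  mor iota (@oppp K C).
Proof.
move=> P0; exists 1%N, (fun x _ _ => x), (fun _ y _ => - y), (fun _ _ z => z).
split; [exact: hpol_x | exact/hpol_opp/hpol_y | exact: hpol_z | |].
  by rewrite /nz3 !hvE oppr_eq0; apply: coord_nz.
move=> P; rewrite /rep /oppp /cx /cy /cz /hv /=.
by case: (sval P) => [[x y]|] /=; split; ring.
Qed.

Lemma hv_aff (K : fieldType) (C : scurve K) h x y (e : y ^+ 2 = cubic C x) :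
  hv h (aff e) = h x y 1.
Proof. by []. Qed.

Lemma hv_origin (K : fieldType) (C : scurve K) h : hv h (origin C) = h 0 1 0.
Proof. by []. Qed.

(** * Translations are morphisms; associativity *)

Section Translations.
Variables (K : closedFieldType) (C : scurve K).
Let f := cubic C.

Section Formulas.
Variables (p r : K).
Hypothesis hT : r ^+ 2 = f p.
Let T := aff hT.
Let A2 := a2 C.
Let A4 := a4 C.
Let A6 := a6 C.

(* Three projective formulas for P |-> P + T, defined at every point other
   than T, at T, and at the origin respectively. *)
Let w (x y z : K) := y - r * z.
Let h (x y z : K) := x - p * z.
Let M1 (x y z : K) := w x y z ^+ 2 * z - (A2 * z + x + p * z) * h x y z ^+ 2.
Let X1 (x y z : K) := h x y z * M1 x y z.
Let Y1 (x y z : K) := w x y z * (p * h x y z ^+ 2 * z - M1 x y z) - r * h x y z ^+ 3 * z.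
Let Z1 (x y z : K) := h x y z ^+ 3 * z.

Let W (x y z : K) := x ^+ 2 + p * x * z + p ^+ 2 * z ^+ 2 + A2 * (x + p * z) * z + A4 * z ^+ 2.
Let H (x y z : K) := y + r * z.
Let M2 (x y z : K) := W x y z ^+ 2 - (A2 * z + x + p * z) * z * H x y z ^+ 2.
Let X2 (x y z : K) := H x y z * M2 x y z * z.
Let Y2 (x y z : K) := W x y z * (p * H x y z ^+ 2 * z ^+ 2 - M2 x y z) - r * H x y z ^+ 3 * z ^+ 3.
Let Z2 (x y z : K) := H x y z ^+ 3 * z ^+ 3.

Let U (x y z : K) := y ^+ 2 - A2 * x ^+ 2 - A4 * x * z - A6 * z ^+ 2.
Let Xh (x y z : K) := p * U x y z + (p ^+ 2 + 2 * A2 * p + A4) * x ^+ 2 +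
  (A4 * p + 2 * A6) * x * z - 2 * r * x * y.
Let Zh (x y z : K) := U x y z - 2 * p * x ^+ 2 + p ^+ 2 * x * z.
Let B (x y z : K) := (3 * p ^+ 2 + 2 * A2 * p + A4) * x + (A4 * p + 2 * A6 - p ^+ 3) * z - 2 * r * y.
Let X3 (x y z : K) := Xh x y z * H x y z.
Let Y3 (x y z : K) := - (r * Zh x y z * H x y z + B x y z * (w x y z * H x y z + p * W x y z)).
Let Z3 (x y z : K) := Zh x y z * H x y z.

Lemma translation_hpol :
  ([/\ hpol idfun 4 X1, hpol idfun 4 Y1 & hpol idfun 4 Z1] /\
  [/\ hpol idfun 6 X2, hpol idfun 6 Y2 & hpol idfun 6 Z2]) /\
  [/\ hpol idfun 3 X3, hpol idfun 3 Y3 & hpol idfun 3 Z3].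
Proof.
split; [split | ]; split;
rewrite /X1 /Y1 /Z1 /X2 /Y2 /Z2 /X3 /Y3 /Z3 /M1 /M2 /Xh /Zh /B /w /h /W /H /U; hpol_tac.
Qed.

Lemma translation_ae : ae (fun P => rep (addp P T) (hv X1 P) (hv Y1 P) (hv Z1 P) /\
  (rep (addp P T) (hv X2 P) (hv Y2 P) (hv Z2 P) /\
   rep (addp P T) (hv X3 P) (hv Y3 P) (hv Z3 P))).
Proof.
exists [:: p] => x y hP; rewrite inE => xp.
have [h3 ->] := addp_aff hP hT xp.
have dx : x - p != 0 by rewrite subr_eq0.
have dx' : p - x != 0 by rewrite subr_eq0 eq_sym.
(* W is the divided difference of the cubic, so W / H is the slope (y - r) / (x - p) in a form that
   makes sense at x = p, where it becomes the slope of the tangent. *)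
have WE : W x y 1 = (y - r) * (y + r) / (x - p).
  apply: (mulIf dx); rewrite divfK //.
  have -> : (y - r) * (y + r) = y ^+ 2 - r ^+ 2 by ring.
  by rewrite hP hT /f /cubic /W -/A2 -/A4; ring.
split; first by apply: rep_aff; rewrite !hv_aff /X1 /Y1 /Z1 /M1 /w /h -/A2; field; rewrite dx'.
split; first by apply: rep_aff; rewrite !hv_aff /X2 /Y2 /Z2 /M2 WE /H -/A2; field; rewrite dx dx'.
have lE : (r - y) / (p - x) = (y - r) / (x - p) by field; rewrite dx dx'.
rewrite lE in h3 *; set x3 := _ - a2 C - x - p in h3 *.
have x3E : x3 * (x - p) ^+ 2 = (y - r) ^+ 2 - (A2 + x + p) * (x - p) ^+ 2.
  by rewrite /x3 -/A2; field.
have y3E : (y - r) / (x - p) * (x - x3) - y = (y - r) / (x - p) * (p - x3) - r.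
  by field.
clearbody x3.
have hP' := hP; have hT' := hT; rewrite /f /cubic -/A2 -/A4 -/A6 in hP' hT'.
(* On the curve [U = x^3], whereas U takes the value 1 at the origin: replacing [x^3] by U is what
   keeps the third triple nonzero there. *)
have ZhE : Zh x y 1 = x * (x - p) ^+ 2.
  by apply: (lin_comb hP'); rewrite /Zh /U; ring.
have XhE : Xh x y 1 = Zh x y 1 * x3.
  rewrite ZhE -mulrA [_ * x3]mulrC x3E.
  by apply: (lin_comb (eqD (eqM (p - x) hP') (eqM (- x) hT'))); rewrite /Xh /U; ring.
have BE : - B x y 1 = (x - p) ^+ 2 * (p - x3).
  rewrite mulrBr [_ * x3]mulrC x3E.
  by apply: (lin_comb (eqD hP' hT')); rewrite /B; ring.
apply: rep_aff; first by rewrite !hv_aff /X3 XhE /Z3; ring.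
rewrite !hv_aff y3E /Y3 /Z3 WE ZhE /H /w.
rewrite -[B x y 1]opprK BE; field; exact: dx.
Qed.

Lemma mor_translation_aff : mor idfun (fun P => addp P T).
Proof.
have [[[e1 e2 e3] [e4 e5 e6]] [e7 e8 e9]] := translation_hpol.
have tae := translation_ae.
apply: mor_weak => P0; case: (pointP P0) => [|x y hP].
  exists 3%N, X3, Y3, Z3; split=> //; last by apply: ae_impl tae => P [_ []].
  have -> : addp (origin C) T = T by apply: val_inj.
  have e : hv Z3 (origin C) = 1.
    by rewrite hv_origin /Z3 /Zh /H /U; ring.
  split; first by apply: nz3_3; rewrite e oner_neq0.
  apply: rep_aff; rewrite e mul1r !hv_origin /X3 /Y3 /Xh /Zh /B /w /W /H /U; ring.
have n2 := sc_char C.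
have [xp|xp] := eqVneq x p; last first.
  exists 4%N, X1, Y1, Z1; split=> //; last by apply: ae_impl tae => P [].
  have dx : x - p != 0 by rewrite subr_eq0.
  have dx' : p - x != 0 by rewrite subr_eq0 eq_sym.
  have [h3 ->] := addp_aff hP hT xp.
  split; first by apply: nz3_3; rewrite !hv_aff /Z1 /h !mulr1 expf_neq0.
  by apply: rep_aff; rewrite !hv_aff /X1 /Y1 /Z1 /M1 /w /h -/A2; field; rewrite dx'.
have [yr|yr] := eqVneq y (- r).
  have -> : addp (aff hP) T = origin C.
    by apply: val_inj; rewrite /= xp yr !eqxx.
  have [r0|r0] := eqVneq r 0.
    exists 6%N, X2, Y2, Z2; split=> //; last by apply: ae_impl tae => P [_ []].
    have H0 : H x y 1 = 0 by rewrite /H yr r0; ring.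
    have W0 : W x y 1 != 0.
      have : dcubic C p != 0 by apply: dcubic_neq0; rewrite -/f -hT r0 expr0n.
      by rewrite /W xp /dcubic -/A2 -/A4; congr (_ != 0); ring.
    have Y2E : hv Y2 (aff hP) = - W x y 1 ^+ 3.
      by rewrite !hv_aff /Y2 /M2 H0; ring.
    split; first by apply: nz3_2; rewrite Y2E oppr_eq0 expf_neq0.
    by apply: rep_O; rewrite !hv_aff ?/Z2 ?/X2 H0; ring.
  exists 4%N, X1, Y1, Z1; split=> //; last by apply: ae_impl tae => P [].
  have h0 : h x y 1 = 0 by rewrite /h xp; ring.
  have w0 : w x y 1 = - 2 * r by rewrite /w yr; ring.
  have Y1E : hv Y1 (aff hP) = (2 * r) ^+ 3.
    by rewrite !hv_aff /Y1 /M1 h0 w0; ring.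
  split; first by apply: nz3_2; rewrite Y1E expf_neq0 // mulf_neq0.
  by apply: rep_O; rewrite !hv_aff ?/Z1 ?/X1 h0; ring.
have yE : y = r.
  have : y ^+ 2 = r ^+ 2 by rewrite hP hT xp.
  by move/eqP; rewrite eqf_sqr (negPf yr) orbF => /eqP.
have r0 : r != 0 by apply: contra yr => /eqP r0; rewrite yE r0 oppr0.
exists 6%N, X2, Y2, Z2; split=> //; last by apply: ae_impl tae => P [_ []].
have aE : aff hP = T by apply: aff_eq.
have HE : H p r 1 = 2 * r by rewrite /H; ring.
have WE : W p r 1 = dcubic C p by rewrite /W /dcubic -/A2 -/A4; ring.
rewrite aE; split.
  by apply: nz3_3; rewrite !hv_aff /Z2 HE expr1n mulr1 expf_neq0 // mulf_neq0.
have := addp_double hT r0; case: (pointP (addp T T)) => [|x3 y3 h3] //= [x3E y3E].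
apply: rep_aff; rewrite ?x3E ?y3E !hv_aff /X2 /Y2 /Z2 /M2 HE WE -/A2; field; rewrite ?r0 ?n2 //.
Qed.

End Formulas.

Lemma mor_translation (T : point C) : mor idfun (fun P => addp P T).
Proof.
case: (pointP T) => [|p r hT]; last exact: mor_translation_aff.
move=> P0; have [d [g0 [g1 [g2 [d0 d1 d2 nz r]]]]] := @mor_id K K idfun C P0.
by exists d, g0, g1, g2; split=> // P; rewrite addpC; apply: r.
Qed.

Lemma translation_ae_neq (T U : point C) : T <> origin C -> ae (fun P => addp P T <> U).
Proof.
move=> T0; have [e|//] := mor_dichotomy (mor_translation T) (@mor_const K C C U).
case: T0; have := e (origin C); have := e (oppp T).
by rewrite addNp add0p => -> ->.
Qed.

Lemma aff_eq_or_opp x y y' (h : y ^+ 2 = f x) (h' : y' ^+ 2 = f x) :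
  aff h = aff h' \/ aff h = oppp (aff h').
Proof.
have /eqP : y ^+ 2 = y' ^+ 2 by rewrite h h'.
rewrite eqf_sqr => /orP [/eqP e|/eqP e]; [left; apply: aff_eq | right] => //.
by apply: val_inj; rewrite /= e.
Qed.

(** For fixed Q and R both sides are morphisms in P, so it is enough to treat generic P, to which
    [chord_associativity] applies. *)
Lemma addpA_distinct x2 y2 (h2 : y2 ^+ 2 = f x2) x3 y3 (h3 : y3 ^+ 2 = f x3) :
  x2 != x3 -> forall P, addp (addp P (aff h2)) (aff h3) = addp P (addp (aff h2) (aff h3)).
Proof.
move=> x23; apply: mor_agree.
- exact: (mor_comp (mor_translation (aff h2)) (mor_translation (aff h3))).
- exact: mor_translation.
have n0 : aff h2 <> origin C by [].
have n3 := translation_ae_neq (aff h3) n0.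
have n3' := translation_ae_neq (oppp (aff h3)) n0.
have [h5 e5] := addp_aff h2 h3 x23.
set b := (y3 - y2) / (x3 - x2) in h5 e5.
(* Generic P: P + Q is neither R nor - R, and x1 differs from the abscissas of Q, R and Q + R. Every
   chord involved is then non-vertical, and x1 != x3 as [chord_associativity] requires. *)
have := ae_and (ae_and n3 n3') (ae_x C [:: x2; x3; b ^+ 2 - a2 C - x2 - x3]).
move/ae_freq => fr s; have [x1 [y1 [h1 [x1s [[m1 m2]]]]]] := fr s.
rewrite /cx hv_aff !inE !negb_or => /and3P [x12 x13 x15].
exists x1, y1, h1; split=> //.
have [h4 e4] := addp_aff h1 h2 x12; set a := (y2 - y1) / (x2 - x1) in h4 e4.
have x43 : a ^+ 2 - a2 C - x1 - x2 != x3.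
  apply/eqP => x43; move: (h4) e4; rewrite x43 => h4' e4.
  by have [e|e] := aff_eq_or_opp h4' h3; rewrite e in e4.
have [h6 e6] := addp_aff h4 h3 x43; have [h7 e7] := addp_aff h1 h5 x15.
rewrite e4 e5 e6 e7; apply: val_inj => /=.
have [y2E D1] := chord_slope h1 h2 x12; have [y3E D2] := chord_slope h2 h3 x23.
rewrite -/a in y2E D1; rewrite -/b in y3E D2.
have [|e1 e2] := @chord_associativity K (a2 C) x1 y1 x2 y2 x3 y3 a b x13 y2E y3E _ x43 x15.
  by apply: (lin_comb (eqD D1 (eqM (-1) D2))); ring.
by congr (Some (_, _)); [exact: e1 | exact: e2].
Qed.

(** A second density argument, now in R: both sides are morphisms in R, and they agree as soon as R
    and Q have distinct abscissas. *)
Lemma addpA (P Q R : point C) : addp (addp P Q) R = addp P (addp Q R).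
Proof.
case: (pointP P) => [|x1 y1 h1]; first by rewrite !add0p.
case: (pointP Q) => [|x2 y2 h2]; first by rewrite add0p [addp (aff h1) _]addpC add0p.
rewrite [LHS]addpC [RHS]addpC [addp (aff h2) R]addpC; move: R; apply: mor_agree.
- exact: mor_translation.
- exact: (mor_comp (mor_translation (aff h2)) (mor_translation (aff h1))).
apply: freq_impl (ae_freq (ae_x C [:: x2])) => R; rewrite inE.
case: (pointP R) => [|x3 y3 h3]; first by rewrite !add0p addpC.
rewrite /cx hv_aff eq_sym => x23.
by rewrite [LHS]addpC addpA_distinct // addpC [addp (aff h2) (aff h3)]addpC.
Qed.

End Translations.

Section PointGroup.
Variables (K : closedFieldType) (C : scurve K).

HB.instance Definition _ := Choice.copy (point C) {P : option (K * K) | on_curve C P}.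

HB.instance Definition _ := GRing.isZmodule.Build (point C)
  (fun P Q R => esym (@addpA K C P Q R)) (@addpC K C) (@add0p K C) (@addNp K C).

End PointGroup.

(** * Sums of morphisms *)

Section SumOfMorphisms.
Variables (K : closedFieldType) (C1 C2 : scurve K).
Implicit Types alpha beta : point C1 -> point C2.

Lemma point_avoid (s : seq (point C2)) : exists T, T \notin s.
Proof.
have [T h] := ae_exists (ae_x C2 [seq cx Q | Q <- s]).
by exists T; apply: contra h => /map_f; apply.
Qed.

Lemma mor_add_constr alpha T : mor idfun alpha -> mor idfun (fun P => alpha P + T).
Proof. by move=> ma; apply: (mor_comp ma (mor_translation T)). Qed.

Lemma mor_oppr alpha : mor idfun alpha -> mor idfun (fun P => - alpha P).
Proof. by move=> ma; apply: (mor_comp ma (@mor_opp K K idfun C2)). Qed.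

Section Chord.
Variables (d e : nat) (X Y Z X' Y' Z' : K -> K -> K -> K).
Hypotheses (dX : hpol idfun d X) (dY : hpol idfun d Y) (dZ : hpol idfun d Z).
Hypotheses (eX : hpol idfun e X') (eY : hpol idfun e Y') (eZ : hpol idfun e Z').

Let W x y z := Y' x y z * Z x y z - Y x y z * Z' x y z.
Let H x y z := X' x y z * Z x y z - X x y z * Z' x y z.
Let M x y z := W x y z ^+ 2 * (Z x y z * Z' x y z) -
  (a2 C2 * (Z x y z * Z' x y z) + X x y z * Z' x y z + X' x y z * Z x y z) * H x y z ^+ 2.
Let X3 x y z := H x y z * M x y z.
Let Y3 x y z := W x y z * (X x y z * Z' x y z * H x y z ^+ 2 - M x y z) -
   Y x y z * Z' x y z * H x y z ^+ 3.
Let Z3 x y z := H x y z ^+ 3 * (Z x y z * Z' x y z).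

Lemma chord_hpol : [/\ hpol idfun (4 * (d + e)) X3, hpol idfun (4 * (d + e)) Y3 &
  hpol idfun (4 * (d + e)) Z3].
Proof. by split; rewrite /X3 /Y3 /Z3 /M /W /H; hpol_tac. Qed.

Lemma chord_rep (P : point C1) (Q R : point C2) :
  rep Q (hv X P) (hv Y P) (hv Z P) -> rep R (hv X' P) (hv Y' P) (hv Z' P) ->
  Q <> 0 -> R <> 0 -> cx Q != cx R ->
  rep (Q + R) (hv X3 P) (hv Y3 P) (hv Z3 P) /\
  (nz3 (hv X P) (hv Y P) (hv Z P) -> nz3 (hv X' P) (hv Y' P) (hv Z' P) ->
   nz3 (hv X3 P) (hv Y3 P) (hv Z3 P)).
Proof.
case: (pointP Q) => [|x1 y1 h1] //; case: (pointP R) => [|x2 y2 h2] // rQ rR _ _.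
rewrite /cx !hv_aff => x12; have [h3 /= e3] := addp_aff h1 h2 x12.
have -> : aff h1 + aff h2 = addp (aff h1) (aff h2) by [].
have dx : x2 - x1 != 0 by rewrite subr_eq0 eq_sym.
have [XE YE] := rep_affE rQ; have [X'E Y'E] := rep_affE rR.
have HE : hv H P = hv Z P * hv Z' P * (x2 - x1).
  by rewrite hvE /H -!hvE XE X'E; ring.
have WE : hv W P = hv Z P * hv Z' P * (y2 - y1).
  by rewrite hvE /W -!hvE YE Y'E; ring.
have Z3E : hv Z3 P = hv H P ^+ 3 * (hv Z P * hv Z' P) by rewrite hvE /Z3 -!hvE.
have ME : hv M P = hv W P ^+ 2 * (hv Z P * hv Z' P) -
  (a2 C2 * (hv Z P * hv Z' P) + hv X P * hv Z' P + hv X' P * hv Z P) * hv H P ^+ 2.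
  by rewrite hvE /M -!hvE.
split.
  rewrite e3; apply: rep_aff.
    have -> : hv X3 P = hv H P * hv M P by rewrite hvE /X3 -!hvE.
    by rewrite Z3E ME HE WE XE X'E; field.
  have -> : hv Y3 P = hv W P * (hv X P * hv Z' P * hv H P ^+ 2 - hv M P) -
   hv Y P * hv Z' P * hv H P ^+ 3 by rewrite hvE /Y3 -!hvE.
  by rewrite Z3E ME HE WE XE X'E YE; field.
have nzZ x y (h : y ^+ 2 = cubic C2 x) a b c : rep (aff h) a b c -> nz3 a b c -> c != 0.
  by move=> /rep_affE [-> ->]; rewrite /nz3; apply: contraNneq => ->; rewrite !mul0r eqxx.
move=> nz nz'; apply: nz3_3; rewrite Z3E HE.
by rewrite !(mulf_neq0, expf_neq0) // ?(nzZ _ _ _ _ _ _ rQ nz) ?(nzZ _ _ _ _ _ _ rR nz').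
Qed.

End Chord.

Lemma cx_neq (Q R : point C2) : Q <> 0 -> R <> 0 -> Q <> R -> Q <> - R -> cx Q != cx R.
Proof.
case: (pointP Q) => [|x1 y1 h1] //; case: (pointP R) => [|x2 y2 h2] // _ _ n1 n2.
rewrite /cx !hv_aff; apply/eqP => e; subst x2.
by case: (aff_eq_or_opp h1 h2).
Qed.

Lemma mor_neq_ae alpha beta P0 : mor idfun alpha -> mor idfun beta ->
  alpha P0 <> beta P0 -> ae (fun P => alpha P <> beta P).
Proof. by move=> ma mb n; case: (mor_dichotomy ma mb) => // e; case: n. Qed.

(** The chord formula may degenerate at P0. It is applied to alpha + T and beta + S, with T and S
    chosen so that it is valid at P0, and the result is translated by - (T + S). *)
Lemma mor_add alpha beta : mor idfun alpha -> mor idfun beta ->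
  mor idfun (fun P => alpha P + beta P).
Proof.
move=> ma mb; apply: mor_weak => P0.
have [T] := point_avoid [:: - alpha P0]; rewrite inE => /eqP T1.
(* The three exclusions keep beta P0 + S away from 0 and from both signs of alpha P0 + T. *)
have [S] := point_avoid [:: - beta P0; alpha P0 + T - beta P0; - (alpha P0 + T) - beta P0].
rewrite !inE !negb_or => /and3P [/eqP S1 /eqP S2 /eqP S3].
have Q0 : alpha P0 + T <> 0 by move/eqP; rewrite addrC addr_eq0 => /eqP.
have R0 : beta P0 + S <> 0 by move/eqP; rewrite addrC addr_eq0 => /eqP.
have QR : alpha P0 + T <> beta P0 + S.
  by move=> e; apply: S2; rewrite e addrC addKr.
have QR' : alpha P0 + T <> - (beta P0 + S).
  by move=> e; apply: S3; rewrite e opprK addrC addKr.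
have [d [X [Y [Z [dX dY dZ nz rg]]]]] := mor_add_constr T ma P0.
have [d' [X' [Y' [Z' [dX' dY' dZ' nz' rg']]]]] := mor_add_constr S mb P0.
have [hX hY hZ] := chord_hpol dX dY dZ dX' dY' dZ'.
have [r3 nz3'] := chord_rep (rg P0) (rg' P0) Q0 R0 (cx_neq Q0 R0 QR QR').
have {}nz3' := nz3' nz nz'.
have [e [h0 [h1 [h2 [e0 e1 e2 nzh rh]]]]] :=
  mor_translation (- (T + S)) (alpha P0 + T + (beta P0 + S)).
have sE P : addp (alpha P + T + (beta P + S)) (- (T + S)) = alpha P + beta P.
  by transitivity (alpha P + T + (beta P + S) - (T + S)) => //; rewrite addrACA addrK.
have hc h u v w (P : point C1) : hv (fun x y z => h (u x y z) (v x y z) (w x y z)) P =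
    h (hv u P) (hv v P) (hv w P) :> K by rewrite !hvE.
eexists _, _, _, _; split; [exact: (hpol_comp e0 hX hY hZ) | exact: (hpol_comp e1 hX hY hZ)
  | exact: (hpol_comp e2 hX hY hZ) | |].
  rewrite !hc -sE; split; first exact: (nz3_comp e0 e1 e2 nzh nz3' r3).
  exact: (rep_comp (beta := fun P => addp P (- (T + S))) e0 e1 e2 (rh _) r3).
have ma' := mor_add_constr T ma; have mb' := mor_add_constr S mb.
have n1 := mor_neq_ae ma' (@mor_const K C1 C2 0) Q0.
have n2 := mor_neq_ae mb' (@mor_const K C1 C2 0) R0.
have n3 := mor_neq_ae ma' mb' QR.
have n4 := mor_neq_ae ma' (mor_oppr mb') QR'.
apply: ae_impl (ae_and (ae_and n1 n2) (ae_and n3 n4)) => P [[m1 m2] [m3 m4]].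
rewrite !hc -sE; apply: (rep_comp (beta := fun P => addp P (- (T + S))) e0 e1 e2) => //.
by have [] := chord_rep (rg P) (rg' P) m1 m2 (cx_neq m1 m2 m3 m4).
Qed.

Lemma mor_sub alpha beta : mor idfun alpha -> mor idfun beta ->
  mor idfun (fun P => alpha P - beta P).
Proof. by move=> ma mb; apply: mor_add ma (mor_oppr mb). Qed.

Lemma mor_muln alpha n : mor idfun alpha -> mor idfun (fun P => alpha P *+ n).
Proof.
move=> ma; elim: n => [|n IHn]; first exact: mor_const.
move=> P0; have [d [X [Y [Z [dX dY dZ nz rg]]]]] := mor_add ma IHn P0.
by exists d, X, Y, Z; split=> // P; rewrite mulrS; apply: rg.
Qed.

Lemma mor_mulz alpha n : mor idfun alpha -> mor idfun (fun P => alpha P *~ n).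
Proof.
move=> ma; case: n => n; first exact: mor_muln.
exact: mor_oppr (mor_muln _ ma).
Qed.

End SumOfMorphisms.

(** * Morphisms as group homomorphisms *)

Lemma poly_eq0_avoid (K : closedFieldType) (p : {poly K}) (s : seq K) :
  (forall x, x \notin s -> p.[x] = 0) -> p = 0.
Proof.
move=> h; apply/eqP; apply: contraT => p0.
have [r rE] := closed_field_poly_normal p; have [x] := closed_avoid (s ++ r).
rewrite mem_cat negb_or => /andP [/h/rootP + xr].
by rewrite rE rootZ ?lead_coef_eq0 // root_prod_XsubC (negPf xr).
Qed.

Section EvenMorphisms.
Variables (K : closedFieldType) (C1 C2 : scurve K).
Implicit Types alpha : point C1 -> point C2.
Let f := cubic C1.

(** The abscissa of alpha P then depends only on that of P. Homomorphisms and even maps are both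
    covered. *)
Definition xeven alpha := forall P, alpha (- P) = alpha P \/ alpha (- P) = - alpha P.

Lemma cxN (C : scurve K) (P : point C) : cx (- P) = cx P.
Proof. by case: (pointP P). Qed.

Lemma oppr_aff (C : scurve K) x y (h : y ^+ 2 = cubic C x) :
  exists h', - aff h = @aff _ C x (- y) h'.
Proof.
have h' : (- y) ^+ 2 = cubic C x by rewrite sqrrN.
by exists h'; apply: val_inj.
Qed.

Lemma cx_rep (Q : point C2) a b c : rep Q a b c -> nz3 a b c -> Q <> 0 ->
  [/\ c != 0, a = cx Q * c & b = cy Q * c].
Proof.
case: (pointP Q) => [|x y h] // rQ nz _; have [aE bE] := rep_affE rQ.
rewrite /cx /cy !hv_aff mulrC -aE mulrC -bE; split=> //.
by move: nz; apply: contraTneq => c0; rewrite /nz3 aE bE c0 !mul0r eqxx.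
Qed.

(* An even quotient (A + yB)/(A' + yB') equals the mean of its two values over
   x, a rational function of x. *)
Lemma even_quotient (A B A' B' : {poly K}) x y : y ^+ 2 = f x ->
  let N := A' ^+ 2 - cubicP C1 * B' ^+ 2 in N.[x] != 0 ->
  let z s := A'.[x] + s * y * B'.[x] in
  [/\ z 1 != 0, z (-1) != 0 &
  (A.[x] + 1 * y * B.[x]) / z 1 = (A.[x] + (-1) * y * B.[x]) / z (-1) ->
  (A.[x] + y * B.[x]) / (A'.[x] + y * B'.[x]) = (A * A' - cubicP C1 * B * B').[x] / N.[x]].
Proof.
move=> yx N; have NE : N.[x] = (A'.[x] + 1 * y * B'.[x]) * (A'.[x] + (-1) * y * B'.[x]).
  by rewrite /N !(cubicPE, hE) -/f -yx; ring.
rewrite NE mulf_eq0 negb_or => /andP [z1 z2] /=; split=> // e.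
rewrite !mul1r in z1 z2 e *; move/eqP: e; rewrite eqr_div // => /eqP e.
have ME : (A.[x] + y * B.[x]) * (A'.[x] + -1 * y * B'.[x]) =
    (A * A' - cubicP C1 * B * B').[x].
  apply: (mulfI (sc_char C1)); rewrite !(cubicPE, hE) -/f -yx.
  by apply: (lin_comb e); ring.
by rewrite -ME; field; rewrite z1 z2.
Qed.

Lemma xeven_rational alpha : mor idfun alpha -> xeven alpha -> (exists P, alpha P <> 0) ->
  exists c0 c1 c2 : {poly K}, [/\ c2 != 0,
    ae (fun P => [/\ c2.[cx P] != 0, alpha P <> 0 & cx (alpha P) = c0.[cx P] / c2.[cx P]]) &
    (forall P, alpha (- P) = alpha P) -> ae (fun P => cy (alpha P) = c1.[cx P] / c2.[cx P])].
Proof.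
move=> ma ev [P0 aP0]; have [d [X [Y [Z [dX dY dZ nz rg]]]]] := ma P0.
have [A [B XE]] := hpol_rfun C1 dX; have [A1 [B1 YE]] := hpol_rfun C1 dY.
have [A2 [B2 ZE]] := hpol_rfun C1 dZ.
(* Norm of the denominator Z = A2 + y B2; it is nonzero because Z does not vanish at P0. *)
pose N := A2 ^+ 2 - cubicP C1 * B2 ^+ 2.
have N0 : N != 0.
  apply: contraT; rewrite negbK subr_eq0 => /eqP /norm_neq0 [A20 B20].
  have [+ _ _] := cx_rep (rg P0) nz aP0; rewrite (hpol_freq0 dZ) ?eqxx // => s.
  have [x xs] := closed_avoid s; have [y yx] := curve_point_over C1 x.
  by exists x, y, yx; split=> //; rewrite hv_aff ZE // A20 B20 !hE; ring.
exists (A * A2 - cubicP C1 * B * B2), (A1 * A2 - cubicP C1 * B1 * B2), N.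
have [r rE] := closed_field_poly_normal N.
have Nr x : x \notin r -> N.[x] != 0.
  by apply: contraNneq => /rootP; rewrite rE rootZ ?lead_coef_eq0 // root_prod_XsubC.
have val1 x y (h : y ^+ 2 = cubic C1 x) : A2.[x] + y * B2.[x] != 0 ->
    [/\ alpha (aff h) <> 0,
    cx (alpha (aff h)) = (A.[x] + y * B.[x]) / (A2.[x] + y * B2.[x]) &
    cy (alpha (aff h)) = (A1.[x] + y * B1.[x]) / (A2.[x] + y * B2.[x])].
  have := rg (aff h); rewrite !hv_aff XE // YE // ZE // => rQ z0.
  have nz' := nz3_3 (A.[x] + y * B.[x]) (A1.[x] + y * B1.[x]) z0.
  have Q0 : alpha (aff h) <> 0.
    move=> Q0; rewrite Q0 in rQ; have [_ e] := rep_origin nz' rQ.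
    by rewrite e eqxx in z0.
  have [_ -> ->] := cx_rep rQ nz' Q0.
  by split=> //; rewrite mulfK.
have both x y (h : y ^+ 2 = cubic C1 x) : N.[x] != 0 ->
    [/\ alpha (aff h) <> 0, cx (alpha (aff h)) = (A * A2 - cubicP C1 * B * B2).[x] / N.[x] &
     (forall P, alpha (- P) = alpha P) ->
     cy (alpha (aff h)) = (A1 * A2 - cubicP C1 * B1 * B2).[x] / N.[x]].
  move=> Nx; have [n1 n2 ex] := even_quotient A B h Nx.
  have [_ _ ey] := even_quotient A1 B1 h Nx.
  have [h' hE] := oppr_aff h.
  have yE s : s * y = y * s by rewrite mulrC.
  rewrite !mul1r !mulN1r in n1 n2 ex ey.
  have [Q0 cxE cyE] := val1 _ _ h n1; have [Q0' cxE' cyE'] := val1 _ _ h' n2.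
  rewrite -hE in cxE' cyE'; split=> //; first rewrite cxE; last first.
    by move=> evn; rewrite cyE; apply: ey; rewrite -cyE -cyE' evn.
  by apply: ex; rewrite -cxE -cxE'; case: (ev (aff h)) => ->; rewrite ?cxN.
split=> //.
  by exists r => x y h /Nr Nx; have [? ? _] := both _ _ h Nx.
by move=> evn; exists r => x y h /Nr Nx; have [_ _ ->] := both _ _ h Nx.
Qed.

(* The coordinates of an even morphism are rational functions of x, so they
   parametrise a rational curve on C2. *)
Lemma even_mor_const alpha : mor idfun alpha -> (forall P, alpha (- P) = alpha P) ->
  forall P Q, alpha P = alpha Q.
Proof.
move=> ma ev; suff [T aT] : exists T, forall P, alpha P = T.
  by move=> P Q; rewrite !aT.
have [a0|[s hs]] := mor_dichotomy ma (@mor_const K C1 C2 0); first by exists 0.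
have ex0 : exists P, alpha P <> 0.
  by apply: ae_exists; exists s.
have xev : xeven alpha by move=> P; left.
have [c0 [c1 [c2 [n2 ax /(_ ev) ay]]]] := xeven_rational ma xev ex0.
have [e1 [e2 [e3 [e12 e13 e23 [a2E [a4E a6E]]]]]] := cubic_roots C2.
have fE x : cubic C2 x = (x - e1) * (x - e2) * (x - e3).
  by rewrite /cubic a2E a4E a6E; ring.
have cyE (Q : point C2) : Q <> 0 -> cy Q ^+ 2 = cubic C2 (cx Q).
  by case: (pointP Q).
have [t ht] := ae_and ax ay.
have pe : c1 ^+ 2 * c2 = (c0 - e1%:P * c2) * (c0 - e2%:P * c2) * (c0 - e3%:P * c2).
  apply: subr0_eq; apply: (@poly_eq0_avoid _ _ t) => x xt.
  have [y yx] := curve_point_over C1 x; have [[+ Q0 cxE] cyE'] := ht x y yx xt.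
  rewrite /cx hv_aff -/(cx _) in cxE cyE' * => n.
  have := cyE _ Q0; rewrite [cx (alpha _)]cxE cyE' fE => e.
  rewrite !hE; apply/eqP; rewrite subr_eq0; apply/eqP.
  have n3 := expf_neq0 3 n; apply: (mulIf (invr_neq0 n3)).
  transitivity ((c1.[x] / c2.[x]) ^+ 2); first by field.
  by rewrite e; field.
have [x0 x0E] := genus1_no_rational_curve (sc_char C2) e12 e13 e23 n2 pe.
have [y0 y0E] := curve_point_over C2 x0.
have : (c1 - y0%:P * c2) * (c1 + y0%:P * c2) = 0.
  apply: (mulIf n2); rewrite mul0r.
  have := pe; rewrite x0E => pe'.
  have y2E : (y0 ^+ 2)%:P = (x0%:P - e1%:P) * (x0%:P - e2%:P) * (x0%:P - e3%:P) :> {poly K}.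
    by rewrite y0E fE !(polyCM, polyCB).
  apply: (lin_comb (eqD pe' (eqM (- c2 ^+ 3) y2E))); rewrite polyC_exp; ring.
have fin y1 (h1 : y1 ^+ 2 = cubic C2 x0) : c1 = y1%:P * c2 ->
    exists T, forall P, alpha P = T.
  move=> c1E; exists (aff h1); apply: mor_agree => //; first exact: mor_const.
  apply: ae_freq; exists t => x y yx xt; have [[+ Q0 cxE] cyE'] := ht x y yx xt.
  rewrite /cx hv_aff -/(cx _) in cxE cyE' * => n.
  rewrite x0E c1E !hE !mulfK // in cxE cyE'.
  case: (pointP (alpha _)) Q0 cxE cyE' => // x' y' h' _.
  by rewrite /cx /cy !hv_aff => ex ey; apply: aff_eq.
move/eqP; rewrite mulf_eq0 => /orP [] /eqP.
  by move/subr0_eq; apply: fin.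
move/eqP; rewrite addr_eq0 => /eqP e.
have h1 : (- y0) ^+ 2 = cubic C2 x0 by rewrite sqrrN.
by apply: (fin _ h1); rewrite e polyCN mulNr.
Qed.

End EvenMorphisms.

(** * The map induced on abscissas *)

Section XCoordinateMap.
Variables (K : closedFieldType) (C1 C2 : scurve K).
Implicit Types alpha : point C1 -> point C2.
Let f := cubic C1.

(* x (alpha P) = [a : b] (x P) at every finite P; alpha P = 0 where b = 0. *)
Definition xrep alpha (a b : {poly K}) := nocroot a b /\
  forall P, P <> 0 -> (alpha P = 0 -> b.[cx P] = 0) /\
    (alpha P <> 0 -> b.[cx P] != 0 /\ a.[cx P] = cx (alpha P) * b.[cx P]).

Lemma rfun_freq0 (g : K -> K -> K) : rfun C1 g ->
  freq (fun P : point C1 => g (cx P) (cy P) = 0) ->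
  forall x y, y ^+ 2 = f x -> g x y = 0.
Proof.
move=> rg fr; have [//|[s hs]] := rfun_dichotomy rg.
have [x [y [h [xs]]]] := fr s; rewrite /cx /cy !hv_aff => g0.
by have := hs x y h xs; rewrite g0 eqxx.
Qed.

(** The abscissa is a fraction a / b at generic points; the content is that its reduced form is
    right at every finite P0. Where alpha P0 is not 0, the identity X b = Z a suffices. Where alpha
    P0 = 0 both X and Z vanish, and the abscissa has to be read in a chart around the origin of the
    target. *)
Lemma mor_xrep alpha : mor idfun alpha -> xeven alpha -> (exists P, alpha P <> 0) ->
  exists a b, xrep alpha a b.
Proof.
move=> ma ev ex0; have [c0 [_ [c2 [n2 [s hs] _]]]] := xeven_rational ma ev ex0.
have [g [a [b [g0 c0E c2E nc]]]] := coprime_fraction c0 n2.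
exists a, b; split=> // P0; case: (pointP P0) => [//|x0 y0 h0] _.
have [d [X [Y [Z [dX dY dZ nz rg]]]]] := ma (aff h0).
have rX := hpol_rfun C1 dX; have rY := hpol_rfun C1 dY; have rZ := hpol_rfun C1 dZ.
have XZ x y : y ^+ 2 = f x -> X x y 1 * b.[x] - Z x y 1 * a.[x] = 0.
  apply: (rfun_freq0 (g := fun x y => X x y 1 * b.[x] - Z x y 1 * a.[x])).
    apply: rfun_add; [apply: rfun_mul rX _ | apply/rfun_opp/rfun_mul => //];
      exact: rfun_poly.
  apply: ae_freq; exists s => {}x {}y h xs; rewrite /cx /cy !hv_aff.
  have [+ Q0 cxE] := hs x y h xs; rewrite /cx hv_aff -/(cx _) c2E c0E !hE mulf_eq0 negb_or in cxE *.
  move=> /andP [bx gx]; have := rg (aff h); case: (pointP (alpha (aff h))) cxE Q0 => [//|x' y' h'].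
  rewrite /cx !hv_aff => cxE _ /rep_affE [-> _].
  by rewrite cxE; field; rewrite bx gx.
have XZ0 := XZ _ _ h0.
rewrite {1 2 4}/cx !hv_aff.
have := rg (aff h0); rewrite !hv_aff in nz * => rQ.
have ab0 : ~~ ((a.[x0] == 0) && (b.[x0] == 0)).
  by apply/negP => /andP [/eqP /nc /negPf ->].
split; last first.
  move=> Q0; have [Zn XE _] := cx_rep rQ nz Q0.
  have aE : a.[x0] = cx (alpha (aff h0)) * b.[x0].
    by apply: (mulfI Zn); apply: (lin_comb (esym XZ0)); rewrite XE; ring.
  by split=> //; apply: contra ab0 => /eqP b0; rewrite aE b0 mulr0 eqxx.
move=> Q0; rewrite Q0 in rQ; have [X0 Z0] := rep_origin nz rQ.
(* The equation of C2 reads [Z U = X^3], so [X : Z] is also [U : X^2], and U is [Y^2] at P0, hence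
   nonzero. The resulting identity [b U = X^2 a] gives b = 0 at P0. *)
pose U x y := Y x y 1 ^+ 2 - a2 C2 * X x y 1 ^+ 2 - a4 C2 * X x y 1 * Z x y 1 -
  a6 C2 * Z x y 1 ^+ 2.
have ZU x y : y ^+ 2 = f x -> Z x y 1 * U x y = X x y 1 ^+ 3.
  move=> h; have := rep_curve (rg (aff h)); rewrite !hv_aff => e.
  by apply: (lin_comb e); rewrite /U; ring.
have U0 : U x0 y0 != 0.
  move: nz; rewrite /nz3 /U X0 Z0 eqxx andbT /= => Y0.
  by rewrite (_ : _ - _ = Y x0 y0 1 ^+ 2) ?expf_neq0 //; ring.
have rU : rfun C1 U.
  rewrite /U; do !apply: rfun_add; do ?apply: rfun_opp; do ?apply: rfun_mul;
  do ?apply: rfun_exp; do ?apply: rfun_const; by [].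
(* If X vanished on the whole curve, Z U = 0 would make Z vanish at generic points, where alpha is
   not 0. *)
have [X00|Xn] := rfun_dichotomy rX.
  have [U00|Un] := rfun_dichotomy rU; first by rewrite U00 ?eqxx in U0.
  have nzae := nz_ae (P0 := aff h0) dX dY dZ nz.
  have [t ht] := Un; have hsae : ae (fun P => alpha P <> 0).
    by exists s => x y h xs; have [] := hs x y h xs.
  have [x [y [yx [_ [nzP [Pt aP]]]]]] := ae_freq (ae_and nzae (ae_and (ae_x C1 t) hsae)) [::].
  have rP := rg (aff yx).
  have [+ _ _] := cx_rep rP nzP aP; rewrite /cx !hv_aff in Pt *.
  have := ZU _ _ yx; rewrite X00 // expr0n => /eqP.
  by rewrite mulf_eq0 (negPf (ht _ _ yx Pt)) orbF => ->.
have key x y : y ^+ 2 = f x -> b.[x] * U x y - X x y 1 ^+ 2 * a.[x] = 0.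
  apply: (rfun_freq0 (g := fun x y => b.[x] * U x y - X x y 1 ^+ 2 * a.[x])).
    apply: rfun_add; first by apply: rfun_mul (rfun_poly _ _) rU.
    by apply/rfun_opp/rfun_mul; [apply: rfun_exp | apply: rfun_poly].
  have [t ht] := Xn; apply: ae_freq; exists t => {}x {}y h xt.
  rewrite /cx /cy !hv_aff; apply: (mulfI (ht _ _ h xt)).
  apply: (lin_comb (eqD (eqM (U x y) (XZ _ _ h)) (eqM (a.[x]) (ZU _ _ h)))); ring.
have := key _ _ h0; rewrite X0 expr0n mul0r subr0 => /eqP.
by rewrite mulf_eq0 (negPf U0) orbF => /eqP.
Qed.

End XCoordinateMap.

(** * Surjectivity of nonzero homomorphisms *)

Section Homomorphisms.
Variable K : closedFieldType.

Lemma points_over (C : scurve K) (s : seq K) :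
  exists l : seq (point C), size l = (2 * size s)%N /\
    forall P, P <> 0 -> cx P \in s -> P \in l.
Proof.
elim: s => [|x s [l [sl hl]]]; first by exists [::].
have [y yx] := curve_point_over C x; exists [:: aff yx, - aff yx & l].
split=> [|P P0]; first by rewrite /= sl mulnS.
rewrite inE => /orP [/eqP|/hl]; last by rewrite !inE => -> //; rewrite !orbT.
case: (pointP P) P0 => // x' y' h _; rewrite /cx hv_aff => e; subst x'.
have [->|->] := aff_eq_or_opp h yx; first exact: mem_head.
by rewrite !inE -[oppp _]/(- aff yx) eqxx orbT.
Qed.

Variables (C1 C2 : scurve K) (alpha : point C1 -> point C2).
Hypotheses (ma : mor idfun alpha) (nz : exists P, alpha P <> 0).

Lemma mor_fiber_finite : exists l : seq (point C1), forall P, alpha P = 0 -> P \in l.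
Proof.
have [a0|[s hs]] := mor_dichotomy ma (@mor_const K C1 C2 0).
  by have [P] := nz; rewrite a0.
have [l [_ hl]] := points_over C1 s; exists (0 :: l) => P aP; rewrite inE.
have [//|/eqP P0] := eqVneq P 0; rewrite hl //.
case: (pointP P) P0 aP => // x y h _ aP; rewrite /cx hv_aff.
by apply: contraT => /hs -/(_ _ h).
Qed.

Hypothesis hom : forall P Q, alpha (P + Q) = alpha P + alpha Q.

Lemma mor_hom0 : alpha 0 = 0.
Proof. by apply: (addrI (alpha 0)); rewrite -hom !addr0. Qed.

Lemma mor_homN P : alpha (- P) = - alpha P.
Proof. by apply/eqP; rewrite -addr_eq0 -hom addNr mor_hom0. Qed.

(** The fraction a / b is nonconstant, so all but finitely many abscissas are attained, and with
    each of them both points above it, since alpha is odd. An arbitrary T is the difference of U + T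
    and U for generic U. *)
Lemma mor_surjective T : exists P, alpha P = T.
Proof.
have ev : xeven alpha by move=> P; right; apply: mor_homN.
have [a [b [nc ab]]] := mor_xrep ma ev nz.
have cxeq (P Q : point C2) : P <> 0 -> Q <> 0 -> cx P = cx Q -> P = Q \/ P = - Q.
  case: (pointP P) => // x y h; case: (pointP Q) => // x' y' h' _ _.
  by rewrite /cx !hv_aff => e; subst x'; have [->|->] := aff_eq_or_opp h h'; [left | right].
have hit x1 : size (a - x1%:P * b) != 1%N -> forall Q, Q <> 0 -> cx Q = x1 ->
    exists P, alpha P = Q.
  move=> /closed_rootP [x /rootP]; rewrite !hE => /subr0_eq e Q Q0 Qx.
  have [y yx] := curve_point_over C1 x; have [b0 b1] := ab (aff yx) (@aff_neq_origin _ _ _ _ yx).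
  have cxx : cx (aff yx) = x by []; rewrite cxx in b0 b1.
  have bn : b.[x] != 0.
    apply/eqP => b00; have := nocroot_sym nc b00; rewrite e b00 mulr0 eqxx //.
  have aP : alpha (aff yx) <> 0 by move=> /b0 /eqP; rewrite (negPf bn).
  have [_] := b1 aP; rewrite e => /(mulIf bn) xe.
  have [qe|qe] := cxeq Q (alpha (aff yx)) Q0 aP (etrans Qx xe).
    by exists (aff yx).
  by exists (- aff yx); rewrite mor_homN.
(* x1 is a value of a / b unless a - x1 b is a nonzero constant, which happens for at most one x1
   when a and b are not both constant. *)
have [bad hbad] : exists bad : seq K, forall x1, x1 \notin bad -> size (a - x1%:P * b) != 1%N.
  have [sb|sb] := leqP (size b) 1; last first.
    exists [:: a`_(size b).-1 / lead_coef b] => x1; rewrite inE; apply: contra => s1.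
    have lb : lead_coef b != 0 by rewrite lead_coef_eq0 -size_poly_gt0 (ltn_trans _ sb).
    apply/eqP/(mulIf lb); rewrite divfK //.
    have : (a - x1%:P * b)`_(size b).-1 = 0.
      by apply: nth_default; rewrite (eqP s1) -ltnS prednK // (ltn_trans _ sb).
    by rewrite coefB coefCM -/(lead_coef b) => /subr0_eq ->.
  have [sa|sa] := leqP (size a) 1; last first.
    exists [::] => x1 _; rewrite size_polyDl ?gtn_eqF // size_polyN.
    by apply: leq_ltn_trans sa; rewrite mul_polyC (leq_trans (size_scale_leq _ _)).
  (* With a and b constant, alpha would vanish at no nonzero point while alpha P = alpha Q or alpha
     P = - alpha Q for all nonzero P and Q; so alpha would vanish at P - Q or P + Q. *)
  exfalso; have bE := size1_polyC sb; have aE := size1_polyC sa.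
  have bn P : P <> 0 -> alpha P <> 0 /\ cx (alpha P) = a`_0 / b`_0.
    move=> P0; have [P1 aP1] := nz.
    have P10 : P1 <> 0 by move=> e; apply: aP1; rewrite e mor_hom0.
    have b0 : b`_0 != 0.
      by have [_ /(_ aP1) [+ _]] := ab P1 P10; rewrite {1}bE hornerC.
    have [a0 a1] := ab P P0; have aP : alpha P <> 0.
      by move/a0/eqP; rewrite bE hornerC (negPf b0).
    have [_] := a1 aP; rewrite aE bE !hornerC !coefC /= => ->; split=> //.
    by rewrite mulfK.
  have [Q] := point_avoid [:: 0 : point C1]; rewrite inE => /eqP Q0.
  have [P] := point_avoid [:: 0; Q; - Q]; rewrite !inE !negb_or => /and3P [/eqP P0 /eqP n1 /eqP n2].
  have [aQ xQ] := bn Q Q0; have [aP xP] := bn P P0.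
  have [e|e] := cxeq _ _ aP aQ (etrans xP (esym xQ)).
    have PQ : P - Q <> 0 by move/subr0_eq.
    by have [+ _] := bn _ PQ; rewrite hom mor_homN e subrr.
  have PQ : P + Q <> 0 by move/eqP; rewrite addr_eq0 => /eqP.
  by have [+ _] := bn _ PQ; rewrite hom e addNr.
have [l [_ hl]] := points_over C2 bad.
have [U] := point_avoid ([:: 0; - T] ++ l ++ [seq V - T | V <- l]).
rewrite !mem_cat !inE !negb_or => /and3P [/andP [/eqP U0 /eqP UT] Ul UTl].
have UT0 : U + T <> 0 by move/eqP; rewrite addr_eq0 => /eqP.
have [|P1 P1E] := hit _ (hbad (cx U) _) U U0 erefl.
  by apply: contra Ul; apply: hl.
have [|P2 P2E] := hit _ (hbad (cx (U + T)) _) _ UT0 erefl.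
  apply: contra UTl => h; apply/mapP; exists (U + T); first exact: hl.
  by rewrite addrK.
by exists (P2 - P1); rewrite hom mor_homN P1E P2E addrC addKr.
Qed.

End Homomorphisms.

(** * Isogenies are homomorphisms *)

Section Isogenies.
Variable K : closedFieldType.

Lemma nontrivial_double (C : scurve K) : exists P : point C, P + P <> 0.
Proof.
have [e1 [e2 [e3 [_ _ _ [a2E [a4E a6E]]]]]] := cubic_roots C.
have [x] := closed_avoid [:: e1; e2; e3]; rewrite !inE !negb_or => /and3P [n1 n2 n3].
have [y yx] := curve_point_over C x; exists (aff yx) => e.
have y0 : y != 0.
  rewrite -sqrf_eq0 yx (_ : cubic C x = (x - e1) * (x - e2) * (x - e3)).
    by rewrite !mulf_neq0 ?subr_eq0.
  by rewrite /cubic a2E a4E a6E; ring.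
by have := addp_double yx y0; rewrite -[addp _ _]/(aff yx + aff yx) e.
Qed.

Lemma halving (C : scurve K) (S : point C) : exists H, H + H = S.
Proof.
have m2 : mor idfun (fun P : point C => P + P) by apply: mor_add; apply: mor_id.
apply: (mor_surjective m2 (nontrivial_double C)) => P Q; exact: addrACA.
Qed.

(** With 2 H = P + Q, the map taking R to phi (H + R) + phi (H - R) is an even morphism, hence
    constant. Its values at R = P - H and R = H are phi P + phi Q and phi (P + Q) + phi 0. *)
Lemma mor_is_hom (C1 C2 : scurve K) (phi : point C1 -> point C2) :
  mor idfun phi -> phi 0 = 0 -> forall P Q, phi (P + Q) = phi P + phi Q.
Proof.
move=> mp p0 P Q; have [H HE] := halving (P + Q).
pose psi R := phi (H + R) + phi (H - R).
have mpsi : mor idfun psi.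
  have mt : mor idfun (fun R : point C1 => R + H) by apply: mor_translation.
  have mt' : mor idfun (fun R : point C1 => - R + H).
    exact: (mor_comp (@mor_opp K K idfun C1) mt).
  have m1 := mor_comp mt mp; have m2 := mor_comp mt' mp.
  move=> R; have [d [X [Y [Z [dX dY dZ nz rg]]]]] := mor_add m1 m2 R.
  by exists d, X, Y, Z; split=> // S; rewrite /psi addrC ![H + _]addrC addrC; apply: rg.
have ev R : psi (- R) = psi R by rewrite /psi opprK addrC.
have := even_mor_const mpsi ev (P - H) H.
have -> : psi H = phi (P + Q) by rewrite /psi HE subrr p0 addr0.
have e1 : H + (P - H) = P by rewrite addrC subrK.
have e2 : H - (P - H) = Q by rewrite opprB addrA HE addrAC subrr add0r.
by rewrite /psi e1 e2.
Qed.

End Isogenies.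

(** * Frobenius and the number of points *)

Section HomCounting.
Variables (U V : zmodType) (h : U -> V).
Hypothesis hom : forall u v, h (u + v) = h u + h v.
Hypothesis surj : forall v, exists u, h u = v.
Variable k : seq U.
Hypotheses (k_uniq : uniq k) (kE : forall u, (u \in k) = (h u == 0)).

Lemma preimage_list (l : seq V) : uniq l ->
  exists l' : seq U, [/\ uniq l', size l' = (size l * size k)%N &
    forall u, (u \in l') = (h u \in l)].
Proof.
have homB u v : h (u - v) = h u - h v.
  by apply: (addIr (h v)); rewrite -hom !subrK.
elim: l => [|v l IHl] /=; first by exists [::].
case/andP => vl /IHl [l' [ul' sl' l'E]]; have [u0 u0E] := surj v.
exists ([seq u0 + z | z <- k] ++ l'); split.
- rewrite cat_uniq ul' map_inj_uniq ?k_uniq; last exact: addrI.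
  rewrite andbT; apply/hasPn => u; rewrite l'E => hu; apply/mapP => -[z].
  rewrite kE => /eqP hz uE; move: vl; rewrite -u0E.
  by rewrite uE hom hz addr0 in hu; rewrite hu.
- by rewrite size_cat size_map sl' mulSn.
move=> u; rewrite mem_cat l'E inE; congr (_ || _); apply/mapP/eqP.
  by case=> z; rewrite kE => /eqP hz ->; rewrite hom hz addr0.
by move=> hu; exists (u - u0); [rewrite kE homB hu u0E subrr | rewrite addrC subrK].
Qed.

End HomCounting.

Section FiniteFieldCurves.
Variables (p n : nat) (F : finFieldType) (K : closedFieldType) (iota : {rmorphism F -> K}).
Hypotheses (p_prime : prime p) (card_F : #|F| = (p ^ n)%N).

Local Notation q := #|F|.

Lemma char_nat_card : [pchar K].-nat q.
Proof.
have pF := card_finPcharP card_F p_prime.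
by rewrite card_F pnatX pnatE // (rmorph_pchar iota pF).
Qed.

Lemma card_gt0 : (0 < q)%N.
Proof. by apply/card_gt0P; exists 0. Qed.

Lemma frobD (x y : K) : (x + y) ^+ q = x ^+ q + y ^+ q.
Proof. exact: exprDn_pchar char_nat_card. Qed.

Lemma frob_iota (c : F) : iota c ^+ q = iota c.
Proof. by rewrite -rmorphXn expf_card. Qed.

Lemma frob_fixed (x : K) : reflect (exists c, x = iota c) (x ^+ q == x).
Proof.
apply: (iffP eqP) => [xq|[c ->]]; last exact: frob_iota.
have := congr1 (fun P : {poly F} => (map_poly iota P).[x]) (finField_genPoly F).
rewrite rmorphB rmorphXn /= map_polyX !hE xq subrr rmorph_prod horner_prod => /esym/eqP.
case/prodf_eq0 => c _; rewrite rmorphB /= map_polyX map_polyC !hE subr_eq0 => /eqP ->.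
by exists c.
Qed.

(** The q-th power is additive and fixes the coefficients, which lie in F; this is how rationality
    over F enters [mor_frob_comm]. *)
Lemma hpol_frob d h x y z : hpol iota d h ->
  h (x ^+ q) (y ^+ q) (z ^+ q) = h x y z ^+ q.
Proof.
move=> /hpol_monomials [l [_ lE]]; rewrite !lE.
elim: l {lE} => [|t l IHl]; first by rewrite !big_nil expr0n gtn_eqF // card_gt0.
rewrite !big_cons frobD IHl; congr (_ + _).
by rewrite !exprMn frob_iota -!exprM ![(_ * q)%N]mulnC.
Qed.

Lemma elliptic_base_change (D : scurve F) : elliptic (base_change iota D).
Proof.
have -> : elliptic (base_change iota D) = elliptic D; last exact: sc_elliptic.
rewrite /elliptic -(fmorph_eq0 iota); congr (_ != 0).
by rewrite /disc /b2 /b4 /b6 /b8 /= !(rmorph_nat, rmorphXn, rmorphB, rmorphD, rmorphN, rmorphM).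
Qed.

Lemma iota_char2 (D : scurve F) : (2 : K) != 0.
Proof. by rewrite -(rmorph_nat iota) fmorph_eq0 sc_char. Qed.

Definition bc (D : scurve F) : scurve K :=
  @SCurve K (base_change iota D)
    (etrans (congr1 iota (sc_a1 D)) (rmorph0 iota))
    (etrans (congr1 iota (sc_a3 D)) (rmorph0 iota))
    (elliptic_base_change D) (iota_char2 D).

Section OneCurve.
Variable D : scurve F.
Let C := bc D.

Lemma cubic_frob x : cubic C x ^+ q = cubic C (x ^+ q).
Proof.
by rewrite /cubic /= !frobD !exprMn !frob_iota; congr (_ + _ * _ + _ + _); rewrite exprAC.
Qed.

Lemma cubic_iota x : cubic C (iota x) = iota (cubic D x).
Proof. by rewrite /cubic /= !(rmorphXn, rmorphD, rmorphM). Qed.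

Definition frobo (P : option (K * K)) : option (K * K) :=
  if P is Some (x, y) then Some (x ^+ q, y ^+ q) else None.

Lemma frobo_on_curve (P : point C) : on_curve C (frobo (val P)).
Proof.
case: (pointP P) => [|x y h] //.
by rewrite [frobo _]/= on_curveE -exprM mulnC exprM h cubic_frob.
Qed.

Definition frob (P : point C) : point C := exist (on_curve C) _ (frobo_on_curve P).

Lemma cx_frob P : P <> 0 -> cx (frob P) = cx P ^+ q.
Proof. by case: (pointP P). Qed.

Lemma coord_frob P :
  [/\ cx (frob P) = cx P ^+ q, cy (frob P) = cy P ^+ q & cz (frob P) = cz P ^+ q].
Proof.
case: (pointP P) => [|x y h]; rewrite /cx /cy /cz ?hv_aff ?hv_origin.
  by rewrite expr0n gtn_eqF ?card_gt0 // !expr1n.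
by rewrite !expr1n.
Qed.

Lemma mor_frob : mor idfun frob.
Proof.
move=> P0; exists q, (fun x _ _ => x ^+ q), (fun _ y _ => y ^+ q), (fun _ _ z => z ^+ q).
split.
- by rewrite -[X in hpol _ X]mul1n; apply/hpol_exp/hpol_x.
- by rewrite -[X in hpol _ X]mul1n; apply/hpol_exp/hpol_y.
- by rewrite -[X in hpol _ X]mul1n; apply/hpol_exp/hpol_z.
- have [e1 e2 e3] := coord_frob P0; rewrite !hvE -e1 -e2 -e3; exact: coord_nz.
move=> P; have [e1 e2 e3] := coord_frob P; rewrite !hvE -e1 -e2 -e3.
by split.
Qed.

Lemma frobD_point P Q : frob (P + Q) = frob P + frob Q.
Proof. by apply: (mor_is_hom mor_frob); apply: val_inj. Qed.

Lemma fixed_points : exists l : seq (point C),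
  [/\ uniq l, size l = card_points D & forall P, (P \in l) = (frob P == P)].
Proof.
pose im (P : option (F * F)) : option (K * K) :=
  if P is Some (x, y) then Some (iota x, iota y) else None.
have imI : injective im.
  by move=> [[x y]|] [[x' y']|] //= [] /fmorph_inj -> /fmorph_inj ->.
have imE P : on_curve C (im P) = on_curve D P.
  case: P => [[x y]|] //; rewrite [im _]/= !on_curveE cubic_iota -rmorphXn.
  by rewrite (inj_eq (fmorph_inj iota)).
pose s := [seq im P | P <- enum [pred P | on_curve D P]].
have us : uniq s by rewrite map_inj_uniq ?enum_uniq.
have ss : size s = card_points D by rewrite size_map -cardE.
have alls : all (on_curve C) s.
  by apply/allP => _ /mapP [P + ->]; rewrite mem_enum inE -imE.
exists (pmap (insub : option (K * K) -> option {P | on_curve C P}) s); split.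
- by rewrite (pmap_uniq (insubK _)).
- by rewrite size_pmap_sub -ss; apply/eqP; rewrite -all_count.
move=> P; rewrite mem_pmap_sub; apply/mapP/eqP.
  move=> [Q _ PE]; apply: val_inj => /=; rewrite [sval P]PE.
  by case: Q {PE} => [[x y]|] //=; rewrite !frob_iota.
move=> fP; have := congr1 val fP; case: (pointP P) => [|x y h] /=.
  by move=> _; exists None; rewrite // mem_enum.
case=> /eqP/frob_fixed [a aE] /eqP/frob_fixed [b bE].
exists (Some (a, b)); last by rewrite aE bE.
by rewrite mem_enum inE -imE [im _]/= -aE -bE on_curveE h.
Qed.

Lemma frob_nontrivial : exists P : point C, P - frob P <> 0.
Proof.
have [l [_ _ lE]] := fixed_points; have [P] := point_avoid l.
by rewrite lE => /eqP Pn; exists P => /subr0_eq/esym.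
Qed.

Lemma one_sub_frob_hom P Q : (P + Q) - frob (P + Q) = (P - frob P) + (Q - frob Q).
Proof. by rewrite frobD_point opprD addrACA. Qed.

Lemma mor_one_sub_frob : mor idfun (fun P => P - frob P).
Proof. exact: mor_sub (@mor_id _ _ _ C) mor_frob. Qed.

Lemma one_sub_frob_surj T : exists P : point C, P - frob P = T.
Proof. exact: (mor_surjective mor_one_sub_frob frob_nontrivial one_sub_frob_hom). Qed.

End OneCurve.

Lemma mor_frob_comm (D1 D2 : scurve F) (phi : point (bc D1) -> point (bc D2)) P :
  mor iota phi -> phi (frob P) = frob (phi P).
Proof.
move=> mp; have [d [X [Y [Z [dX dY dZ nz rg]]]]] := mp P.
have [e1 e2 e3] := coord_frob P.
have fE h : hpol iota d h -> hv h (frob P) = hv h P ^+ q.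
  by move=> hd; rewrite !hvE e1 e2 e3 (hpol_frob _ _ _ hd).
apply: (rep_inj _ (rg (frob P))); rewrite ?(fE X) ?(fE Y) ?(fE Z) //.
  by move: nz; rewrite /nz3 !expf_eq0 card_gt0.
have [k [-> -> ->]] := repP (rg P); rewrite !exprMn.
by have [<- <- <-] := coord_frob (phi P); apply: rep_scale.
Qed.

(* Count the kernel of phi o (1 - frob) = (1 - frob) o phi in two ways. *)
Lemma isogenous_card (D1 D2 : scurve F) (phi : point (bc D1) -> point (bc D2)) :
  mor iota phi -> phi 0 = 0 -> (exists P, phi P <> 0) -> card_points D1 = card_points D2.
Proof.
move=> mp p0 nz; have mp' := mor_extend mp; have hom := mor_is_hom mp' p0.
have [l lE] := mor_fiber_finite mp' nz.
pose k := undup [seq P <- l | phi P == 0].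
have kE P : (P \in k) = (phi P == 0).
  by rewrite mem_undup mem_filter; case: eqP => // /lE.
have uk : uniq k by apply: undup_uniq.
have [l1 [u1 s1 l1E]] := fixed_points D1; have [l2 [u2 s2 l2E]] := fixed_points D2.
have k1E P : (P \in l1) = (P - frob P == 0) by rewrite l1E subr_eq0 eq_sym.
have [m1 [um1 sm1 m1E]] := preimage_list (@one_sub_frob_hom D1) (@one_sub_frob_surj D1) u1 k1E uk.
have [m2 [um2 sm2 m2E]] := preimage_list hom (mor_surjective mp' nz hom) uk kE u2.
have : size m1 = size m2.
  apply/eqP; rewrite eqn_leq !uniq_leq_size // => P; rewrite m1E m2E kE l2E;
  by rewrite hom (mor_homN hom) (mor_frob_comm _ mp) subr_eq0 eq_sym.
rewrite sm1 sm2 -s1 -s2 mulnC => /eqP; rewrite eqn_pmul2r ?size_gt0; first by move/eqP.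
by case: (k) (kE 0) => //; rewrite p0 eqxx.
Qed.

End FiniteFieldCurves.

(** * The degree of m - Frobenius *)

Lemma point_affE (K : closedFieldType) (C : scurve K) (Q : point C) : Q <> 0 ->
  exists x y (h : y ^+ 2 = cubic C x), Q = aff h.
Proof. by case: (pointP Q) => // x y h _; exists x, y, h. Qed.

(** * The abscissas of Q + R and Q - R *)

Section Kummer.
Variables (K : closedFieldType) (C : scurve K).
Implicit Types Q R : point C.

(* [u : v] is the x-coordinate of Q, with [1 : 0] for the origin. *)
Definition xpt Q (u v : K) :=
  [/\ (u != 0) || (v != 0), Q = 0 -> v = 0 & Q <> 0 -> u = cx Q * v].

Lemma xpt0 u v : xpt 0 u v -> u != 0 /\ v = 0.
Proof. by case=> nz /(_ erefl) v0 _; move: nz; rewrite v0 eqxx orbF. Qed.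

Lemma xpt_neq0 Q u v : Q <> 0 -> xpt Q u v -> v != 0 /\ u = cx Q * v.
Proof.
move=> Q0 [nz _ /(_ Q0) uE]; split=> //; move: nz; rewrite uE.
by have [->|//] := eqVneq v 0; rewrite mulr0 eqxx.
Qed.

Lemma xpt_uniq Q u v u' v' : xpt Q u v -> xpt Q u' v' -> exists2 k, k != 0 &
  u = k * u' /\ v = k * v'.
Proof.
have [->|/eqP Q0] := eqVneq Q 0.
  move=> /xpt0 [u0 ->] /xpt0 [u'0 ->]; exists (u / u'); last by rewrite divfK // mulr0.
  by rewrite mulf_neq0 ?invr_eq0.
move=> /(xpt_neq0 Q0) [v0 ->] /(xpt_neq0 Q0) [v'0 ->]; exists (v / v').
  by rewrite mulf_neq0 ?invr_eq0.
by split; field.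
Qed.

(** Biquadratic forms of the Kummer line: the abscissas of Q + R and Q - R are the two roots of
    [kum2 X^2 - kum1 X + kum0], counted in the projective line. *)
Definition kum2 (u v u' v' : K) := (u * v' - u' * v) ^+ 2.
Definition kum1 (u v u' v' : K) :=
  2 * ((u * u' + a4 C * v * v') * (u * v' + u' * v) + 2 * a2 C * u * u' * v * v' +
       2 * a6 C * v ^+ 2 * v' ^+ 2).
Definition kum0 (u v u' v' : K) :=
  (u * u' - a4 C * v * v') ^+ 2 - 4 * a6 C * v * v' * (u * v' + u' * v + a2 C * v * v').

Definition kum_rel u v u' v' s t s' t' := exists2 k, k != 0 &
  [/\ kum2 u v u' v' = k * (t * t'), kum1 u v u' v' = k * (s * t' + s' * t) &
      kum0 u v u' v' = k * (s * s')].

Let x1 Q := if Q == 0 then 1 else cx Q.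
Let x2 Q : K := if Q == 0 then 0 else 1.

Lemma xpt_normal Q : xpt Q (x1 Q) (x2 Q).
Proof.
rewrite /xpt /x1 /x2; case: (eqVneq Q 0) => [->|/eqP Q0].
  by rewrite oner_neq0.
by rewrite oner_neq0 orbT mulr1.
Qed.

Lemma kum_double x y (h : y ^+ 2 = cubic C x) :
  kum_rel x 1 x 1 (x1 (aff h + aff h)) (x2 (aff h + aff h)) 1 0.
Proof.
have n2 := sc_char C; have n4 := four_neq0 n2.
have e2 : kum2 x 1 x 1 = 0 by rewrite /kum2; ring.
have e1 : kum1 x 1 x 1 = 4 * y ^+ 2 by rewrite h /kum1 /cubic; ring.
have e0 : kum0 x 1 x 1 = dcubic C x ^+ 2 - (a2 C + 2 * x) * (4 * y ^+ 2).
  by rewrite h /kum0 /cubic /dcubic; ring.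
have [y0|y0] := eqVneq y 0.
  have d0 : aff h + aff h = 0.
    by apply: val_inj; rewrite /= y0 !eqxx oppr0 eqxx.
  have dn : dcubic C x != 0 by apply: dcubic_neq0; rewrite -h y0 expr0n.
  exists (dcubic C x ^+ 2); first by rewrite expf_neq0.
  rewrite e2 e1 e0 d0 /x1 /x2 eqxx y0; split; ring.
have := addp_double h y0; rewrite -[addp _ _]/(aff h + aff h).
rewrite /x1 /x2; case: (pointP (aff h + aff h)) => [|x3 y3 h3] // [x3E _].
have -> : (aff h3 == 0) = false by apply/eqP.
rewrite /cx hv_aff x3E; exists (4 * y ^+ 2); first by rewrite mulf_neq0 ?expf_neq0.
rewrite e2 e1 e0; split; [ring | ring |].
by field; rewrite y0 n2.
Qed.

Lemma kum_rel_sym u v u' v' s t s' t' :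
  kum_rel u v u' v' s t s' t' -> kum_rel u v u' v' s' t' s t.
Proof. by case=> k k0 [e2 e1 e0]; exists k; rewrite // e2 e1 e0; split; ring. Qed.

Lemma kum_normal Q R : kum_rel (x1 Q) (x2 Q) (x1 R) (x2 R)
  (x1 (Q + R)) (x2 (Q + R)) (x1 (Q - R)) (x2 (Q - R)).
Proof.
have x1N S : x1 (- S) = x1 S by rewrite /x1 oppr_eq0 cxN.
have x2N S : x2 (- S) = x2 S by rewrite /x2 oppr_eq0.
have x10 : x1 0 = 1 by rewrite /x1 eqxx.
have x20 : x2 0 = 0 by rewrite /x2 eqxx.
have [->|/eqP Q0] := eqVneq Q 0.
  rewrite !add0r x1N x2N x10 x20; exists 1; first exact: oner_neq0.
  by rewrite /kum2 /kum1 /kum0; split; ring.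
have [->|/eqP R0] := eqVneq R 0.
  rewrite subr0 !addr0 x10 x20; exists 1; first exact: oner_neq0.
  by rewrite /kum2 /kum1 /kum0; split; ring.
have x1n S : S <> 0 -> x1 S = cx S by rewrite /x1; case: eqP.
have x2n S : S <> 0 -> x2 S = 1 by rewrite /x2; case: eqP.
have [->|/eqP QR] := eqVneq Q R.
  rewrite subrr x10 x20 x1n // x2n //; case: (pointP R) R0 => // x y h _.
  exact: kum_double.
have [->|/eqP QR'] := eqVneq Q (- R).
  rewrite x1N x2N addNr x10 x20 -opprD x1N x2N x1n // x2n //.
  by case: (pointP R) R0 => // x y h _; apply/kum_rel_sym/kum_double.
have xx := cx_neq Q0 R0 QR QR'.
have S0 : Q + R <> 0 by move/eqP; rewrite addr_eq0 => /eqP.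
have S0' : Q - R <> 0 by move/subr0_eq.
rewrite !x1n // !x2n //.
have [x [y [h QE]]] := point_affE Q0; have [x' [y' [h' RE]]] := point_affE R0.
move: xx; rewrite QE RE.
rewrite {1 2}/cx !hv_aff => xx.
have [h3 e3] := addp_aff h h' xx; have [h'' hE] := oppr_aff h'.
have [h4 e4] := addp_aff h h'' xx.
rewrite -[aff h + aff h']/(addp _ _) hE -[aff h + aff h'']/(addp _ _) e3 e4 /cx !hv_aff.
have dx : x' - x != 0 by rewrite subr_eq0 eq_sym.
exists ((x' - x) ^+ 2); first by rewrite expf_neq0.
have hh := h; have hh' := h'; rewrite /cubic in hh hh'.
split; first by rewrite /kum2; ring.
  transitivity (2 * (y ^+ 2 + y' ^+ 2) - 2 * (a2 C + x + x') * (x' - x) ^+ 2).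
    by rewrite h h' /kum1 /cubic; ring.
  by field.
apply: (mulfI (expf_neq0 2 dx)).
(* Over the denominator [(x' - x)^2] the two abscissas have numerators S - 2 y y' and S + 2 y y',
   where S is the quantity squared here. *)
transitivity ((y ^+ 2 + y' ^+ 2 - (a2 C + x + x') * (x' - x) ^+ 2) ^+ 2 - 4 * y ^+ 2 * y' ^+ 2).
  by rewrite h h' /kum0 /cubic; ring.
by field.
Qed.

Lemma kummer Q R u v u' v' s t s' t' : xpt Q u v -> xpt R u' v' ->
  xpt (Q + R) s t -> xpt (Q - R) s' t' -> kum_rel u v u' v' s t s' t'.
Proof.
move=> /xpt_uniq/(_ (xpt_normal Q)) [k k0 [-> ->]].
move=> /xpt_uniq/(_ (xpt_normal R)) [l l0 [-> ->]].
move=> /xpt_uniq/(_ (xpt_normal (Q + R))) [m m0 [-> ->]].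
move=> /xpt_uniq/(_ (xpt_normal (Q - R))) [o o0 [-> ->]].
have [w w0 [e2 e1 e0]] := kum_normal Q R.
exists (k ^+ 2 * l ^+ 2 * w / (m * o)).
  by rewrite !mulf_neq0 ?invr_eq0 ?mulf_neq0 ?expf_neq0.
split.
- transitivity (k ^+ 2 * l ^+ 2 * kum2 (x1 Q) (x2 Q) (x1 R) (x2 R)); first by rewrite /kum2; ring.
  by rewrite e2; field; rewrite m0 o0.
- transitivity (k ^+ 2 * l ^+ 2 * kum1 (x1 Q) (x2 Q) (x1 R) (x2 R)); first by rewrite /kum1; ring.
  by rewrite e1; field; rewrite m0 o0.
transitivity (k ^+ 2 * l ^+ 2 * kum0 (x1 Q) (x2 Q) (x1 R) (x2 R)); first by rewrite /kum0; ring.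
by rewrite e0; field; rewrite m0 o0.
Qed.

End Kummer.

(** Up to sign these are the coefficients of the product of the nonzero linear forms v X - u and v'
    X - u'. *)
Lemma pair_product_neq0 (K : fieldType) (u v u' v' : K) :
  (u != 0) || (v != 0) -> (u' != 0) || (v' != 0) ->
  ~~ [&& v * v' == 0, u * v' + u' * v == 0 & u * u' == 0].
Proof.
move=> nz nz'; apply/negP => /and3P []; rewrite !mulf_eq0.
case: (eqVneq v 0) nz => [->|v0]; last first.
  move=> _ /= /eqP v'0; rewrite v'0 eqxx orbF in nz' *.
  by rewrite mulr0 add0r mulf_eq0 (negPf nz') (negPf v0).
rewrite orbF mulr0 addr0 mulf_eq0 => u0 _; rewrite (negPf u0) /= => v'0 u'0.
by rewrite u'0 v'0 in nz'.
Qed.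

(** * Formal degrees and proportional triples of polynomials *)

Section PolyTriples.
Variable K : closedFieldType.
Implicit Types (F G p q : {poly K}).

(** A formal degree with its leading coefficient c, which may be 0: formal degrees add under
    products without any nonvanishing condition, and c is the value at infinity of p seen as a form
    of degree m. *)
Definition ptop m p (c : K) := (size p <= m.+1)%N /\ p`_m = c.

Lemma ptop_size m p c : ptop m p c -> c != 0 -> size p = m.+1.
Proof.
move=> [s pc] c0; apply/eqP; rewrite eqn_leq s /= ltnNge.
by apply: contra c0 => sp; rewrite -pc nth_default.
Qed.

Lemma ptop_add m p q c d : ptop m p c -> ptop m q d -> ptop m (p + q) (c + d).
Proof.
move=> [sp pc] [sq qd]; split; last by rewrite coefD pc qd.
by rewrite (leq_trans (size_polyD _ _)) // geq_max sp.
Qed.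

Lemma ptop_opp m p c : ptop m p c -> ptop m (- p) (- c).
Proof. by move=> [sp pc]; split; rewrite ?size_polyN // coefN pc. Qed.

Lemma ptop_mul m k p q c d : ptop m p c -> ptop k q d -> ptop (m + k) (p * q) (c * d).
Proof.
move=> [sp pc] [sq qd]; split.
  by rewrite (leq_trans (size_polyMleq _ _)) //; move: sp sq; lia.
have mk : (m < (m + k).+1)%N by lia.
rewrite coefM (bigD1 (Ordinal mk)) //= addKn pc qd big1 ?addr0 // => i im.
have [im'|im'] := ltnP m i; first by rewrite nth_default ?mul0r // (leq_trans sp).
rewrite mulrC nth_default ?mul0r // (leq_trans sq) //.
have : (i != m :> nat) by apply: contra im => /eqP e; apply/eqP/val_inj.
by move: im'; case: (i) => /= i' _; lia.
Qed.

Lemma ptop_lower m k p c : ptop m p c -> (m < k)%N -> ptop k p 0.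
Proof.
by move=> [sp _] mk; split; [rewrite (leq_trans sp) // ltnS ltnW | rewrite nth_default // (leq_trans sp)].
Qed.

Lemma ptop_const c : ptop 0 c%:P c.
Proof. by split; [rewrite size_polyC_leq1 | rewrite coefC]. Qed.

Lemma ptop_Xn m : ptop m 'X^m 1.
Proof. by split; rewrite ?size_polyXn // coefXn eqxx. Qed.

Lemma ptop_X : ptop 1 'X 1.
Proof. by split; rewrite ?size_polyX // coefX. Qed.

Lemma ptop_exp m p c k : ptop m p c -> ptop (m * k) (p ^+ k) (c ^+ k).
Proof.
move=> h; elim: k => [|k IHk]; first by rewrite muln0 !expr0; apply: ptop_const.
by rewrite mulnS !exprS; apply: ptop_mul.
Qed.

Definition pdeg2 (p q : {poly K}) := (maxn (size p) (size q)).-1.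

Lemma ptop_conv m k p c d : ptop m p c -> m = k -> c = d -> ptop k p d.
Proof. by move=> h <- <-. Qed.

Lemma ptop_max m F0 F1 F2 c0 c1 c2 : ptop m F0 c0 -> ptop m F1 c1 -> ptop m F2 c2 ->
  ~~ [&& c0 == 0, c1 == 0 & c2 == 0] ->
  maxn (size F0) (maxn (size F1) (size F2)) = m.+1.
Proof.
move=> t0 t1 t2 nz; apply/eqP; rewrite eqn_leq !geq_max t0.1 t1.1 t2.1 /= !leq_max.
move: nz; rewrite !negb_and => /or3P [] n.
- by rewrite (ptop_size t0 n) leqnn.
- by rewrite (ptop_size t1 n) leqnn !orbT.
by rewrite (ptop_size t2 n) leqnn !orbT.
Qed.

Lemma ptop_pdeg2 p q : nocroot p q ->
  exists c d, [/\ (c != 0) || (d != 0), ptop (pdeg2 p q) p c & ptop (pdeg2 p q) q d].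
Proof.
move=> nc; have m0 : (0 < maxn (size p) (size q))%N.
  rewrite leq_max !size_poly_gt0; apply: contraT; rewrite negb_or !negbK.
  by move=> /andP [/eqP p0 /eqP q0]; have := nc 0; rewrite p0 q0 !horner0 eqxx => /(_ erefl).
exists p`_(pdeg2 p q), q`_(pdeg2 p q); split; last 2 first.
- by split=> //; rewrite prednK // leq_maxl.
- by split=> //; rewrite prednK // leq_maxr.
rewrite -negb_and; apply/negP => /andP [/eqP p0 /eqP q0].
move: m0 p0 q0; rewrite /pdeg2; have [pq|qp] := ltnP (size p) (size q).
  move=> m0 _ q0.
  by have /eqP := q0 : lead_coef q = 0; rewrite lead_coef_eq0 -size_poly_eq0 gtn_eqF.
move=> m0 p0 _.
by have /eqP := p0 : lead_coef p = 0; rewrite lead_coef_eq0 -size_poly_eq0 gtn_eqF.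
Qed.

(** G0 divides F0 G1 and F0 G2 and is coprime to the gcd of G1 and G2, so Gauss's lemma applies. *)
Lemma triple_dvdp F0 F1 F2 G0 G1 G2 :
  (forall x, ~~ [&& G0.[x] == 0, G1.[x] == 0 & G2.[x] == 0]) ->
  F0 * G1 = F1 * G0 -> F0 * G2 = F2 * G0 -> G0 %| F0.
Proof.
move=> nz e1 e2; have cop : coprimep G0 (gcdp G1 G2).
  apply/Pdiv.ClosedField.coprimepP => x /rootP g0; apply/negP => /eqP/rootP.
  rewrite root_gcd => /andP [/rootP g1 /rootP g2].
  by have := nz x; rewrite g0 g1 g2 eqxx.
rewrite -(Gauss_dvdpl _ cop) (eqp_dvdr _ (mulp_gcdr _ _ _)) dvdp_gcd.
by rewrite e1 e2 !dvdp_mull.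
Qed.

Lemma triple_eqp F0 F1 F2 G0 G1 G2 :
  (forall x, ~~ [&& G0.[x] == 0, G1.[x] == 0 & G2.[x] == 0]) ->
  (forall x, exists2 k, k != 0 & [/\ F0.[x] = k * G0.[x], F1.[x] = k * G1.[x] &
     F2.[x] = k * G2.[x]]) ->
  [/\ F0 %= G0, F1 %= G1 & F2 %= G2].
Proof.
move=> nzG FG.
have nzF x : ~~ [&& F0.[x] == 0, F1.[x] == 0 & F2.[x] == 0].
  have [k k0 [-> -> ->]] := FG x.
  by rewrite !mulf_eq0 (negPf k0) /= nzG.
have cr p q p' q' : (forall x, p.[x] * q'.[x] = p'.[x] * q.[x]) -> p * q' = p' * q.
  move=> e; apply: subr0_eq; apply: (@poly_eq0_avoid _ _ [::]) => x _.
  by rewrite !hE e subrr.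
have e01 : F0 * G1 = F1 * G0 by apply: cr => x; have [k _ [-> -> _]] := FG x; ring.
have e02 : F0 * G2 = F2 * G0 by apply: cr => x; have [k _ [-> _ ->]] := FG x; ring.
have e12 : F1 * G2 = F2 * G1 by apply: cr => x; have [k _ [_ -> ->]] := FG x; ring.
have rot1 A B C (h : forall x : K, ~~ [&& A.[x] == 0, B.[x] == 0 & C.[x] == 0]) x :
    ~~ [&& B.[x] == 0, A.[x] == 0 & C.[x] == 0] by rewrite andbCA h.
have rot2 A B C (h : forall x : K, ~~ [&& A.[x] == 0, B.[x] == 0 & C.[x] == 0]) x :
    ~~ [&& C.[x] == 0, A.[x] == 0 & B.[x] == 0] by rewrite andbC -andbA h.
have sy p q p' q' : p * q' = p' * q -> q * p' = q' * p.
  by move=> e; rewrite mulrC -e mulrC.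
split; apply/andP; split.
- exact: triple_dvdp nzF (sy _ _ _ _ e01) (sy _ _ _ _ e02).
- exact: triple_dvdp nzG e01 e02.
- exact: triple_dvdp (rot1 _ _ _ nzF) (esym (sy _ _ _ _ e01)) (sy _ _ _ _ e12).
- exact: triple_dvdp (rot1 _ _ _ nzG) (esym e01) e12.
- exact: triple_dvdp (rot2 _ _ _ nzF) (esym (sy _ _ _ _ e02)) (esym (sy _ _ _ _ e12)).
exact: triple_dvdp (rot2 _ _ _ nzG) (esym e02) (esym e12).
Qed.

End PolyTriples.

(** * The parallelogram law for degrees *)

Section Parallelogram.
Variables (K : closedFieldType) (C : scurve K) (alpha : point C -> point C).
Variables a b s t s' t' : {poly K}.
Hypotheses (ra : xrep alpha a b) (rp : xrep (fun P => alpha P + P) s t)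
  (rm : xrep (fun P => alpha P - P) s' t').

Lemma xrep_xpt (beta : point C -> point C) u v P : xrep beta u v -> P <> 0 ->
  xpt (beta P) u.[cx P] v.[cx P].
Proof.
move=> [nc h] P0; have [h0 h1] := h P P0; split=> // [|/h1 [] //].
by rewrite -negb_and; apply/negP => /andP [/eqP /nc /negPf ->].
Qed.

Let G2 := t * t'.
Let G1 := s * t' + s' * t.
Let G0 := s * s'.
Let F2 := (a - 'X * b) ^+ 2.
Let F1 := 2%:P * ((a * 'X + (a4 C)%:P * b) * (a + 'X * b) + (2 * a2 C)%:P * (a * 'X * b) +
  (2 * a6 C)%:P * b ^+ 2).
Let F0 := (a * 'X - (a4 C)%:P * b) ^+ 2 - (4 * a6 C)%:P * b * (a + 'X * b + (a2 C)%:P * b).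

Lemma kummer_poly : [/\ F2 %= G2, F1 %= G1 & F0 %= G0].
Proof.
have over x : exists2 P : point C, P <> 0 & cx P = x.
  have [y yx] := curve_point_over C x; exists (aff yx) => //.
have e (k x y : K) : x != 0 -> y != 0 -> (x * y == 0) = false.
  by move=> x0 y0; rewrite mulf_eq0 (negPf x0) (negPf y0).
apply: triple_eqp => x; have [P P0 <-] := over x.
  have [nz _ _] := xrep_xpt rp P0; have [nz' _ _] := xrep_xpt rm P0.
  rewrite /G2 /G1 /G0 !hE.
  exact: pair_product_neq0.
have xP : xpt P (cx P) 1.
  by split=> [|//|_]; rewrite ?oner_neq0 ?orbT // mulr1.
have [k k0 [e2 e1 e0]] :=
  kummer (xrep_xpt ra P0) xP (xrep_xpt rp P0) (xrep_xpt rm P0).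
exists k => //; rewrite /G2 /G1 /G0 !hE -e2 -e1 -e0 /F2 /F1 /F0 ?hE /kum2 /kum1 /kum0.
by split; ring.
Qed.

(** The two triples of [kummer_poly] have the same maximal size. On each side the formal leading
    coefficients come from a product of two nonzero linear forms, so they are not all 0 and the
    formal degree is attained. *)
Lemma parallelogram : (pdeg2 s t + pdeg2 s' t' = 2 * pdeg2 a b + 2)%N.
Proof.
have [E2 E1 E0] := kummer_poly.
have [al [be [nab ta tb]]] := ptop_pdeg2 ra.1.
have [c [d [ncd ts tt]]] := ptop_pdeg2 rp.1.
have [c' [d' [ncd' ts' tt']]] := ptop_pdeg2 rm.1.
set m := pdeg2 a b in ta tb *.
have tXb := ptop_mul (ptop_X K) tb; have taX := ptop_mul ta (ptop_X K).
have a0 := ptop_lower ta (ltnSn m); have b0 := ptop_lower tb (ltnSn m).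
have b0c c0 := ptop_lower (ptop_mul (ptop_const c0) tb) (ltnSn m).
have tX : ptop m.+1 (a * 'X) al by apply: ptop_conv taX _ _; rewrite ?addn1 ?mulr1.
have tX' : ptop m.+1 ('X * b) be by apply: ptop_conv tXb _ _; rewrite ?add1n ?mul1r.
have m2 : (m.+1 * 2 = 2 * m + 2)%N by lia.
have m2' : (m.+1 + m.+1 = 2 * m + 2)%N by lia.
have T2 : ptop (2 * m + 2) F2 (be ^+ 2).
  by apply: ptop_conv (ptop_exp 2 (ptop_add a0 (ptop_opp tX'))) m2 _; rewrite add0r sqrrN.
have T1 : ptop (2 * m + 2) F1 (2 * (al * be)).
  have l1 : (m.+1 + m < 2 * m + 2)%N by lia.
  have l2 : (m * 2 < 2 * m + 2)%N by lia.
  have u1 := ptop_conv (ptop_mul (ptop_add tX (b0c (a4 C))) (ptop_add a0 tX')) m2' erefl.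
  have u2 := ptop_mul (ptop_const (2 * a2 C)) (ptop_lower (ptop_mul tX tb) l1).
  have u3 := ptop_mul (ptop_const (2 * a6 C)) (ptop_lower (ptop_exp 2 tb) l2).
  apply: ptop_conv (ptop_mul (ptop_const 2) (ptop_add (ptop_add u1 u2) u3)) (add0n _) _.
  by ring.
have T0 : ptop (2 * m + 2) F0 (al ^+ 2).
  have l1 : (m + m.+1 < 2 * m + 2)%N by lia.
  have u1 := ptop_conv (ptop_exp 2 (ptop_add tX (ptop_opp (b0c (a4 C))))) m2 erefl.
  have u2 := ptop_add (ptop_add a0 tX') (b0c (a2 C)).
  have u3 := ptop_lower (ptop_mul (ptop_mul (ptop_const (4 * a6 C)) tb) u2) l1.
  by apply: ptop_conv (ptop_add u1 (ptop_opp u3)) erefl _; ring.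
have nF : ~~ [&& be ^+ 2 == 0, 2 * (al * be) == 0 & al ^+ 2 == 0].
  rewrite !expf_eq0 /=; apply/negP => /and3P [be0 _ al0].
  by move: nab; rewrite al0 be0.
have maxF := ptop_max T2 T1 T0 nF.
set k := pdeg2 s t in ts tt *; set k' := pdeg2 s' t' in ts' tt' *.
have S1 : ptop (k + k') G1 (c * d' + c' * d).
  apply: ptop_add; first exact: ptop_mul.
  by apply: ptop_conv (ptop_mul ts' tt) (addnC _ _) erefl.
have nG : ~~ [&& d * d' == 0, c * d' + c' * d == 0 & c * c' == 0].
  exact: pair_product_neq0.
have maxG := ptop_max (ptop_mul tt tt') S1 (ptop_mul ts ts') nG.
move: maxF; rewrite (eqp_size E2) (eqp_size E1) (eqp_size E0) maxG.
by case.
Qed.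

End Parallelogram.

Section XrepDegree.
Variables (K : closedFieldType) (C : scurve K).
Implicit Types alpha : point C -> point C.

Lemma xrep_ext alpha beta a b : (forall P, alpha P = beta P) -> xrep alpha a b -> xrep beta a b.
Proof. by move=> e [nc h]; split=> // P /h; rewrite e. Qed.

Lemma xrep_pdeg2 alpha a b a' b' : xrep alpha a b -> xrep alpha a' b' ->
  pdeg2 a b = pdeg2 a' b'.
Proof.
move=> r r'; have over x : exists2 P : point C, P <> 0 & cx P = x.
  by have [y yx] := curve_point_over C x; exists (aff yx).
have [||E1 E2 _] := @triple_eqp K a b b a' b' b'.
- move=> x; have [P P0 <-] := over x; have [nz _ _] := xrep_xpt r' P0.
  by apply: contraL nz => /and3P [/eqP -> /eqP -> _]; rewrite eqxx.
- move=> x; have [P P0 <-] := over x.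
  have [k k0 [-> ->]] := xpt_uniq (xrep_xpt r P0) (xrep_xpt r' P0).
  by exists k.
by rewrite /pdeg2 (eqp_size E1) (eqp_size E2).
Qed.

Lemma hom_xrep alpha : mor idfun alpha -> (forall P Q, alpha (P + Q) = alpha P + alpha Q) ->
  exists a b, xrep alpha a b.
Proof.
move=> ma hom; have [a0|ae0] := mor_dichotomy ma (@mor_const K C C 0).
  (* The zero map has abscissa [1 : 0] everywhere and is thereby given degree 0. *)
  exists 1, 0; split; first by move=> z /eqP; rewrite hornerC oner_eq0.
  by move=> P _; rewrite a0 horner0; split.
by apply: mor_xrep => //; [move=> P; right; apply: mor_homN hom P | apply: ae_exists ae0].
Qed.

End XrepDegree.

Lemma prod_XsubC_exp_dvdp (K : closedFieldType) (I : finType) (u : I -> K) (e : I -> nat)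
  (t : {poly K}) : injective u -> (forall i, ('X - (u i)%:P) ^+ e i %| t) ->
  \prod_i ('X - (u i)%:P) ^+ e i %| t.
Proof.
move=> iu h; elim: (index_enum I) (index_enum_uniq I) => [|i s IHs] /=.
  by rewrite big_nil dvd1p.
move=> /andP [is_ us]; rewrite big_cons Gauss_dvdp ?h ?IHs //.
case: (e i) => [|k]; first by rewrite expr0 coprime1p.
apply/Pdiv.ClosedField.coprimepP => x; rewrite root_exp_XsubC => /eqP ->.
rewrite horner_prod prodf_seq_neq0; apply/allP => j js /=.
rewrite !hE expf_neq0 // subr_eq0 (inj_eq iu); apply: contra is_ => /eqP ->; exact: js.
Qed.

Lemma card_pointsE (F : finFieldType) (D : scurve F) :
  card_points D = (1 + \sum_(c : F) #|[pred y : F | y ^+ 2 == cubic D c]|)%N.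
Proof.
rewrite /card_points cardE /enum_mem size_filter.
have -> : Finite.enum (option (F * F)) = None :: [seq Some xy | xy <- Finite.enum (F * F)%type].
  by rewrite {1}Finite.enum.unlock.
rewrite /= count_map; congr (_ + _)%N.
rewrite -size_filter -/(enum_mem _).
transitivity #|[pred xy : F * F | xy.2 ^+ 2 == cubic D xy.1]|.
  rewrite cardE /enum_mem !size_filter; apply: eq_count => -[x y] /=.
  by rewrite -topredE /= inE -(on_curveE D).
rewrite -sum1_card (eq_bigl (fun xy => xpredT xy.1 && (xy.2 ^+ 2 == cubic D xy.1))) //.
rewrite -(pair_big_dep xpredT (fun x y => y ^+ 2 == cubic D x) (fun _ _ => 1%N)) /=.
by apply: eq_bigr => x _; rewrite sum1_card; apply: eq_card => y; rewrite inE.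
Qed.

(** * The degree as a quadratic polynomial in m *)

Section FrobeniusDegree.
Variables (p n : nat) (F : finFieldType) (K : closedFieldType) (iota : {rmorphism F -> K}).
Hypotheses (p_prime : prime p) (card_F : #|F| = (p ^ n)%N).
Variable D : scurve F.

Local Notation q := #|F|.
Local Notation N := (card_points D).
Let C := bc iota D.
Local Notation fr := (@frob p n F K iota p_prime card_F D).

Definition mult_sub_frob (m : int) (P : point C) : point C := P *~ m - fr P.

Lemma mor_mult_sub_frob m : mor idfun (mult_sub_frob m).
Proof.
have h1 := mor_mulz m (@mor_id K K idfun C).
exact: (mor_sub h1 (mor_frob p_prime card_F (iota := iota) (D := D))).
Qed.

Lemma mult_sub_frobD m P Q :
  mult_sub_frob m (P + Q) = mult_sub_frob m P + mult_sub_frob m Q.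
Proof. by rewrite /mult_sub_frob frobD_point mulrzDl opprD addrACA. Qed.

Lemma mult_sub_frob_xrep m : exists a b, xrep (mult_sub_frob m) a b.
Proof. exact: hom_xrep (mor_mult_sub_frob m) (mult_sub_frobD m). Qed.

Lemma mult_sub_frobS m P : mult_sub_frob m P + P = mult_sub_frob (m + 1) P.
Proof. by rewrite /mult_sub_frob mulrzDr mulr1z addrAC. Qed.

Lemma mult_sub_frobP m P : mult_sub_frob m P - P = mult_sub_frob (m - 1) P.
Proof. by rewrite /mult_sub_frob mulrzBr mulr1z addrAC. Qed.

Lemma mult_sub_frob0_xrep : xrep (mult_sub_frob 0) 'X^q 1.
Proof.
split; first by move=> z _; rewrite hornerC oner_neq0.
move=> P P0; have n0 : mult_sub_frob 0 P <> 0.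
  rewrite /mult_sub_frob mulr0z sub0r => /eqP; rewrite oppr_eq0 => /eqP.
  by case: (pointP P) P0.
split=> // _; rewrite hornerC oner_neq0 mulr1; split=> //.
by rewrite /mult_sub_frob mulr0z sub0r cxN cx_frob // hornerXn.
Qed.

Definition fiber (c : F) := #|[pred y : F | y ^+ 2 == cubic D c]|.

Lemma fiber_cases c : [\/ cubic D c = 0 /\ fiber c = 1%N,
  (exists2 y, y != 0 & y ^+ 2 = cubic D c) /\ fiber c = 2 |
  (forall y, y ^+ 2 <> cubic D c) /\ fiber c = 0%N].
Proof.
rewrite /fiber; have [c0|c0] := eqVneq (cubic D c) 0.
  constructor 1; split=> //; rewrite c0; transitivity #|pred1 (0 : F)|; last exact: card1.
  by apply: eq_card => y; rewrite !inE sqrf_eq0.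
case: (pickP [pred y | y ^+ 2 == cubic D c]) => [y /= /eqP yE|none]; last first.
  constructor 3; split; last by apply: eq_card0 => y; have := none y.
  by move=> y /eqP; have := none y => /= ->.
have y0 : y != 0 by rewrite -sqrf_eq0 yE.
constructor 2; split; first by exists y.
have -> : #|[pred z | z ^+ 2 == cubic D c]| = #|[:: y; - y]|.
  by apply: eq_card => z; rewrite !inE -yE eqf_sqr.
apply/eqP; rewrite (card_uniqP _) //= inE andbT -subr_eq0 opprK -mulr2n -mulr_natl.
by rewrite mulf_neq0 ?sc_char.
Qed.

(* The denominators t, t' of x (P - Frob P) and x (P + Frob P) multiply to
   (X^q - X)^2, and X - c has multiplicity [fiber c] in t: both follow by
   comparing the degree 2 q with the divisibilities at each c in F_q. *)
Lemma degree_one_sub_frob s t s' t' :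
  xrep (mult_sub_frob 1) s t -> xrep (mult_sub_frob (-1)) s' t' -> pdeg2 s t = N.
Proof.
move=> rs rs'; have q1 : (1 < q)%N by apply: finNzRing_gt1.
have rp : xrep (fun P => mult_sub_frob 0 P + P) s t.
  by apply: xrep_ext rs => P; rewrite mult_sub_frobS.
have rm : xrep (fun P => mult_sub_frob 0 P - P) s' t'.
  by apply: xrep_ext rs' => P; rewrite mult_sub_frobP.
have par := parallelogram mult_sub_frob0_xrep rp rm.
have [E2 E1 E0] := kummer_poly mult_sub_frob0_xrep rp rm.
have pd0 : pdeg2 ('X^q : {poly K}) 1 = q.
  by rewrite /pdeg2 size_polyXn size_poly1 /maxn; case: ltnP.
rewrite pd0 in par.
rewrite mulr1 in E2 *.
pose r (c : F) : {poly K} := 'X - (iota c)%:P.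
have genE : 'X^q - 'X = \prod_c r c.
  have := congr1 (map_poly iota) (finField_genPoly F).
  rewrite rmorphB /= map_polyXn map_polyX rmorph_prod => ->.
  by apply: eq_bigr => c _; rewrite rmorphB /= map_polyX map_polyC.
have X2 : size (('X^q - 'X : {poly K}) ^+ 2) = (2 * q).+1.
  have T : ptop q ('X^q - 'X : {poly K}) 1.
    have := ptop_add (ptop_Xn K q) (ptop_opp (ptop_lower (ptop_X K) q1)).
    by rewrite oppr0 addr0.
  rewrite (ptop_size (ptop_exp 2 T)) ?expf_neq0 ?oner_neq0 //; lia.
have tt'0 : t * t' != 0.
  by rewrite -size_poly_gt0 -(eqp_size E2) X2.
move: (tt'0); rewrite mulf_eq0 negb_or => /andP [t0 t'0].
have st : (size t + size t' = (2 * q).+2)%N.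
  have := size_mul t0 t'0; rewrite -(eqp_size E2) X2.
  by move: t0; rewrite -size_poly_gt0; case: (size t) => //= k _ ->.
have cx0 P : P <> 0 :> point C -> (t.[cx P] == 0) = (fr P == P) /\
    (t'.[cx P] == 0) = (fr P == - P).
  move=> P0; have [_ /(_ P P0) [a0 a1]] := rs; have [_ /(_ P P0) [a0' a1']] := rs'.
  have e1 : (mult_sub_frob 1 P == 0) = (fr P == P).
    by rewrite /mult_sub_frob mulr1z subr_eq0 eq_sym.
  have e2 : (mult_sub_frob (-1) P == 0) = (fr P == - P).
    by rewrite /mult_sub_frob mulrN1z subr_eq0 eq_sym.
  rewrite -e1 -e2; split; apply/eqP/eqP.
  - by move=> t0'; apply/eqP; apply: contraT => /eqP /a1 [/eqP].
  - by move/a0.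
  - by move=> t0'; apply/eqP; apply: contraT => /eqP /a1' [/eqP].
  - by move/a0'.
have rdvd (u : {poly K}) c : u.[iota c] = 0 -> r c %| u.
  by move=> u0; rewrite dvdp_XsubCl; apply/rootP.
have rcop (u : {poly K}) c k : u.[iota c] != 0 -> coprimep (r c ^+ k) u.
  move=> u0; apply: coprimep_expl; apply/Pdiv.ClosedField.coprimepP => x.
  by rewrite root_XsubC => /eqP ->.
have r2 c : r c ^+ 2 %| t * t'.
  rewrite -(eqp_dvdr _ E2) genE dvdp_exp2r //.
  by rewrite (bigD1 c) //= dvdp_mulIl.
have dvd c : r c ^+ fiber c %| t /\ r c ^+ (2 - fiber c) %| t'.
  (* Frobenius on a point over c: at a root of the cubic it fixes a point equal to its opposite, and
     t and t' both vanish. Over a nonzero square it fixes the point without negating it, so t' does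
     not vanish and t takes the whole double factor. Over a nonsquare the roles of t and t' are
     exchanged. *)
  have [[c0 ->]|[[y y0 yE] ->]|[nsq ->]] := fiber_cases c.
  - have h : 0 ^+ 2 = cubic C (iota c) by rewrite cubic_iota c0 rmorph0 expr0n.
    have [e1 e2] := cx0 (aff h) (@aff_neq_origin _ _ _ _ h).
    have fh : fr (aff h) = aff h.
      by apply: val_inj; rewrite /= frob_iota expr0n gtn_eqF ?card_gt0.
    have Nh : - aff h = aff h by apply: val_inj; rewrite /= oppr0.
    rewrite /cx !hv_aff fh Nh eqxx in e1 e2.
    by rewrite !expr1; split; apply: rdvd; apply/eqP.
  - have h : iota y ^+ 2 = cubic C (iota c) by rewrite cubic_iota -rmorphXn yE.
    have [e1 e2] := cx0 (aff h) (@aff_neq_origin _ _ _ _ h).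
    have fh : fr (aff h) = aff h by apply: val_inj; rewrite /= !frob_iota.
    rewrite /cx !hv_aff fh in e1 e2; rewrite subnn expr0 dvd1p; split=> //.
    rewrite -(Gauss_dvdpl _ (rcop t' c 2 _)) ?r2 // e2.
    apply/eqP => /(congr1 val) /= [] /eqP.
    by rewrite -addr_eq0 -mulr2n -mulr_natl mulf_eq0 (negPf (sc_char C)) fmorph_eq0 (negPf y0).
  have [y h] := curve_point_over C (iota c).
  have [e1 e2] := cx0 (aff h) (@aff_neq_origin _ _ _ _ h).
  have yq : y ^+ q != y.
    apply/negP => /(frob_fixed iota) [y' y'E]; apply: (nsq y').
    by apply: (fmorph_inj iota); rewrite rmorphXn -y'E h cubic_iota.
  have yqN : y ^+ q = - y.
    have : (y ^+ q) ^+ 2 = y ^+ 2.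
      by rewrite exprAC h cubic_iota frob_iota.
    by move/eqP; rewrite eqf_sqr (negPf yq) => /eqP.
  have fh : fr (aff h) = - aff h by apply: val_inj; rewrite /= frob_iota yqN.
  rewrite /cx !hv_aff in e1 e2; rewrite expr0 dvd1p subn0; split=> //.
  rewrite -(Gauss_dvdpr _ (rcop t c 2 _)) ?r2 // e1.
  by apply/eqP => /(congr1 val) /= [_ /eqP]; rewrite (negPf yq).
have iI := fmorph_inj iota.
have d1 := prod_XsubC_exp_dvdp iI (fun c => (dvd c).1).
have d2 := prod_XsubC_exp_dvdp iI (fun c => (dvd c).2).
have sizeprod (e : F -> nat) : (size (\prod_c r c ^+ e c)%R = (\sum_c e c).+1)%N.
  rewrite size_prod => [|c _]; last by rewrite expf_neq0 // polyXsubC_eq0.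
  rewrite (eq_bigr (fun c => (1 + e c)%N)) => [|c _]; last by rewrite size_exp_XsubC.
  by rewrite big_split /= sum1_card -addnS addKn.
have s1 := dvdp_leq t0 d1; have s2 := dvdp_leq t'0 d2; rewrite !sizeprod in s1 s2.
have fle c : (fiber c <= 2)%N by case: (fiber_cases c) => -[_ ->].
have sums : (\sum_c fiber c + \sum_c (2 - fiber c) = 2 * q)%N.
  rewrite -big_split /= (eq_bigr (fun _ => 2%N)) => [|c _]; last by rewrite subnKC.
  by rewrite sum_nat_const mulnC.
have sizet : size t = N.
  have ar (x y u v : nat) : (u.+1 <= x)%N -> (v.+1 <= y)%N -> (u + v = 2 * q)%N ->
    (x + y = (2 * q).+2)%N -> x = (1 + u)%N by lia.
  by rewrite (ar _ _ _ _ s1 s2 sums st) card_pointsE.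
(* It remains to see that s has size N + 1. The sizes of s s' and s t' + s' t, together with the
   parallelogram law, force size s = size t + 1. *)
have s0E : (size (s * s')%R = (2 * q).+3)%N.
  have l1 : (q < q.+1 * 2)%N by lia.
  have u1 := ptop_conv (ptop_mul (ptop_Xn K q) (ptop_X K)) (addn1 _) erefl.
  have u2 := ptop_lower (ptop_const (a4 C)) (ltn0Sn q).
  have u3 := ptop_exp 2 (ptop_add u1 (ptop_opp u2)).
  have u4 := ptop_add (ptop_Xn K q) (ptop_lower (ptop_X K) q1).
  have u5 := ptop_add u4 (ptop_lower (ptop_const (a2 C)) (card_gt0 F)).
  have u6 := ptop_lower (ptop_mul (ptop_const (4 * a6 C)) u5) l1.
  move: E0; rewrite !mulr1 => /eqp_size <-.
  rewrite (ptop_size (ptop_add u3 (ptop_opp u6))); first by lia.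
  by rewrite !(mulr1, oppr0, addr0) expr1n oner_neq0.
have s1E : (size (s * t' + s' * t)%R = (2 * q).+2)%N.
  have l1 : (q.+1 < q.+1 + q)%N by lia.
  have l2 : (0 < q.+1 + q)%N by lia.
  have u1 := ptop_conv (ptop_mul (ptop_Xn K q) (ptop_X K)) (addn1 _) erefl.
  have u2 := ptop_add u1 (ptop_lower (ptop_const (a4 C)) (ltn0Sn q)).
  have u4 := ptop_add (ptop_Xn K q) (ptop_lower (ptop_X K) q1).
  have u5 := ptop_mul (ptop_const (2 * a2 C)) (ptop_lower u1 l1).
  have u6 := ptop_lower (ptop_const (2 * a6 C)) l2.
  move: E1; rewrite expr1n !mulr1 => /eqp_size <-.
  rewrite (ptop_size (ptop_mul (ptop_const 2) (ptop_add (ptop_add (ptop_mul u2 u4) u5) u6))).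
    by lia.
  by rewrite !(mulr1, mulr0, addr0) (sc_char C).
have ss'0 : s * s' != 0 by rewrite -size_poly_gt0 s0E.
move: (ss'0); rewrite mulf_eq0 negb_or => /andP [s00 s'0].
have ss : (size s + size s' = (2 * q).+4)%N.
  have := size_mul s00 s'0; rewrite s0E.
  by move: s00; rewrite -size_poly_gt0; case: (size s) => //= k _ ->.
have szm (u v : {poly K}) : u != 0 -> v != 0 -> (size (u * v)%R).+1 = (size u + size v)%N.
  by move=> u0 v0; rewrite size_mul // prednK // addn_gt0 size_poly_gt0 u0.
have m1 := szm _ _ s00 t'0; have m2 := szm _ _ s'0 t0.
have sD := size_polyDl (p := s * t') (q := s' * t).
have sD' := size_polyDl (p := s' * t) (q := s * t').
rewrite (addrC (s' * t)) in sD'.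
have sgt : (0 < size s)%N by rewrite size_poly_gt0.
have s'gt : (0 < size s')%N by rewrite size_poly_gt0.
rewrite /pdeg2 in par *; move: par sD sD' s1E m1 m2 ss st sizet sgt s'gt.
move: (size (s * t' + s' * t)) (size (s * t')) (size (s' * t)) (size s) (size s')
  (size t) (size t') => x1 x2 x3 x4 x5 x6 x7.
by clear; lia.
Qed.

(** The degree and the quadratic polynomial satisfy the same recurrence d (m + 1) + d (m - 1) = 2 d
    m + 2 and agree at 0 and 1; the induction runs in both directions. *)
Lemma degree_mult_sub_frob (m : int) a b : xrep (mult_sub_frob m) a b ->
  (pdeg2 a b)%:Z = m ^+ 2 - (q.+1%:Z - N%:Z) * m + q%:Z.
Proof.
pose d (m : int) : int := m ^+ 2 - (q.+1%:Z - N%:Z) * m + q%:Z.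
pose P m := forall a b, xrep (mult_sub_frob m) a b -> (pdeg2 a b)%:Z = d m.
have step m0 u v s t s' t' : xrep (mult_sub_frob m0) u v ->
    xrep (mult_sub_frob (m0 + 1)) s t -> xrep (mult_sub_frob (m0 - 1)) s' t' ->
    (pdeg2 s t)%:Z + (pdeg2 s' t')%:Z = 2 * (pdeg2 u v)%:Z + 2.
  move=> r rs rs'; rewrite -PoszD (parallelogram r (s := s) (t := t) (s' := s') (t' := t')) //.
  - by apply: xrep_ext rs => Q; rewrite mult_sub_frobS.
  - by apply: xrep_ext rs' => Q; rewrite mult_sub_frobP.
have dS m0 : d (m0 + 1) + d (m0 - 1) = 2 * d m0 + 2 by rewrite /d; ring.
have up m0 : P m0 -> P (m0 - 1) -> P (m0 + 1).
  move=> h h' s t rs; have [a0 [b0 r]] := mult_sub_frob_xrep m0.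
  have [s' [t' rs']] := mult_sub_frob_xrep (m0 - 1).
  apply: (addIr (pdeg2 s' t')%:Z); rewrite (step _ _ _ _ _ _ _ r rs rs').
  by rewrite (h _ _ r) (h' _ _ rs') dS.
have down m0 : P m0 -> P (m0 + 1) -> P (m0 - 1).
  move=> h h' s' t' rs'; have [a0 [b0 r]] := mult_sub_frob_xrep m0.
  have [s [t rs]] := mult_sub_frob_xrep (m0 + 1).
  apply: (addrI (pdeg2 s t)%:Z); rewrite (step _ _ _ _ _ _ _ r rs rs').
  by rewrite (h _ _ r) (h' _ _ rs) dS.
have P0 : P 0.
  move=> s t r; rewrite (xrep_pdeg2 r mult_sub_frob0_xrep) /pdeg2 size_polyXn size_poly1.
  have := card_gt0 F; rewrite /d; lia.
have P1 : P 1.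
  move=> s t r; have [s' [t' r']] := mult_sub_frob_xrep (-1).
  by rewrite (degree_one_sub_frob r r') /d; lia.
suff : P m by apply.
have pos (k : nat) : P k%:Z /\ P (k%:Z + 1).
  elim: k => [|k [h h']]; first by rewrite add0r.
  have -> : k.+1%:Z = k%:Z + 1 by lia.
  by split=> //; apply: up => //; rewrite addrK.
have neg (k : nat) : P (- k%:Z) /\ P (- k%:Z + 1).
  elim: k => [|k [h h']]; first by rewrite oppr0 add0r.
  have -> : - k.+1%:Z = - k%:Z - 1 by lia.
  by rewrite subrK; split=> //; apply: down.
case: m => k; first by have [] := pos k.
by rewrite NegzE; have [] := neg k.+1.
Qed.

End FrobeniusDegree.

(** * Short models and Legendre curves *)

Section MorphismOver.
Variables (F K : fieldType) (iota : {rmorphism F -> K}) (W1 W2 : weierstrass F).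
Local Notation E1 := (base_change iota W1).
Local Notation E2 := (base_change iota W2).

Lemma proj_coordE (W : weierstrass K) (P : point W) :
  proj_coord P =1 vec3 (cx P) (cy P) (cz P).
Proof. by rewrite /proj_coord /cx /cy /cz /hv => i; case: (val P) => [[x y]|]. Qed.

Lemma eval_tripleE (f : 'I_3 -> {mpoly F[3]}) (P : point E1) i :
  eval_triple f P i = hv (fun x y z => (map_mpoly iota (f i)).@[vec3 x y z]) P.
Proof. by rewrite hvE /eval_triple; apply: meval_eq; apply: proj_coordE. Qed.

Lemma morphism_overE (phi : point E1 -> point E2) : morphism_over phi <-> mor iota phi.
Proof.
have ord3 (i : 'I_3) : [\/ i = inord 0, i = inord 1 | i = inord 2].
  by case: i => [[|[|[|//]]] h]; [constructor 1 | constructor 2 | constructor 3];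
    apply: val_inj; rewrite /= inordK.
have pE (P : point E2) : [/\ proj_coord P (inord 0) = cx P, proj_coord P (inord 1) = cy P &
   proj_coord P (inord 2) = cz P].
  by rewrite !proj_coordE /vec3 !inordK.
split=> m P0; have := m P0.
  case=> d [f [fd [i0 fi0] rf]].
  pose g k x y z := (map_mpoly iota (f (inord k))).@[vec3 x y z].
  have hg k : hpol iota d (g k) by exists (f (inord k)).
  have gE k (P : point E1) : hv (g k) P = eval_triple f P (inord k) by rewrite eval_tripleE.
  exists d, (g 0%N), (g 1%N), (g 2); split=> //.
    rewrite !gE; apply: contraNN fi0 => /and3P [/eqP e0 /eqP e1 /eqP e2].
    by have [->|->|->] := ord3 i0; rewrite ?(e0, e1, e2).
  move=> P; rewrite !gE.
  have [/and3P [/eqP -> /eqP -> /eqP ->]|nz] := boolP [&& eval_triple f P (inord 0) == 0,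
     eval_triple f P (inord 1) == 0 & eval_triple f P (inord 2) == 0].
    by rewrite /rep /par !mul0r !mulr0.
  have [|c c0 cE] := rf P.
    by move: nz; rewrite !negb_and => /or3P [] n;
      [exists (inord 0) | exists (inord 1) | exists (inord 2)].
  rewrite !cE; have [-> -> ->] := pE (phi P); exact: rep_scale.
move=> [d [g0 [g1 [g2 [[p0 d0 e0] [p1 d1 e1] [p2 d2 e2] nz rg]]]]].
pose f (i : 'I_3) := nth 0 [:: p0; p1; p2] i.
have fE (P : point E1) : [/\ eval_triple f P (inord 0) = hv g0 P, eval_triple f P (inord 1) = hv g1 P &
   eval_triple f P (inord 2) = hv g2 P].
  by rewrite !eval_tripleE !hvE /f !inordK //= e0 e1 e2.
exists d, f; split.
- by move=> i; rewrite /f; have [->|->|->] := ord3 i; rewrite inordK.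
- have [h0 h1 h2] := fE P0; move: nz; rewrite /nz3 -h0 -h1 -h2 !negb_and => /or3P [] n;
    [by exists (inord 0) | by exists (inord 1) | by exists (inord 2)].
move=> P [i fi]; have [h0 h1 h2] := fE P; have [k [k0 k1 k2]] := repP (rg P).
have [q0 q1 q2] := pE (phi P).
have kn : k != 0.
  apply: contraNneq fi => k00; have [->|->|->] := ord3 i;
  by rewrite ?(h0, h1, h2) ?(k0, k1, k2) k00 mul0r.
exists k => // j; have [->|->|->] := ord3 j;
  by rewrite ?(h0, h1, h2) ?(k0, k1, k2) ?(q0, q1, q2).
Qed.

End MorphismOver.

(** * Completing the square *)

Section ShortModel.
Variables (F : finFieldType) (E : weierstrass F).
Hypotheses (E_elliptic : elliptic E) (char2 : (2 : F) != 0).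

Definition short_model : weierstrass F :=
  Weierstrass 0 (a2 E + a1 E ^+ 2 / 4) 0 (a4 E + a1 E * a3 E / 2) (a6 E + a3 E ^+ 2 / 4).

Lemma elliptic_short_model : elliptic short_model.
Proof.
have n4 := four_neq0 char2; rewrite /elliptic (_ : disc _ = disc E) //.
by rewrite /disc /b2 /b4 /b6 /b8 /=; field; rewrite ?n4 ?char2.
Qed.

Definition short_curve : scurve F := SCurve (erefl : a1 short_model = 0)
  (erefl : a3 short_model = 0) elliptic_short_model char2.

Section Shift.
Variables (L : fieldType).
Definition shifto (c d : L) (P : option (L * L)) :=
  if P is Some (x, y) then Some (x, y + c * x + d) else None.

Lemma shiftoK c d : cancel (shifto c d) (shifto (- c) (- d)).
Proof. by move=> [[x y]|] //=; congr (Some (_, _)); ring. Qed.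
End Shift.

Variables (K : fieldType) (iota : {rmorphism F -> K}).

Lemma on_curve_short_model (P : option (K * K)) :
  on_curve (base_change iota short_model) (shifto (iota (a1 E / 2)) (iota (a3 E / 2)) P) =
  on_curve (base_change iota E) P.
Proof.
have n2 : (2 : K) != 0 by rewrite -(rmorph_nat iota) fmorph_eq0.
have n4 := four_neq0 n2; case: P => [[x y]|] //=.
rewrite !(rmorphD, rmorph0) !fmorph_div !rmorphXn rmorphM !rmorph_nat.
rewrite -subr_eq0 -[RHS]subr_eq0; congr (_ == 0); field; rewrite ?n2 ?n4 //.
Qed.

Local Notation EK := (base_change iota E).
Local Notation SK := (base_change iota short_model).

Definition to_short (P : point EK) : point SK :=
  exist (on_curve SK) _ (etrans (on_curve_short_model (val P)) (valP P)).

Lemma of_short_on_curve (P : point SK) :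
  on_curve EK (shifto (- iota (a1 E / 2)) (- iota (a3 E / 2)) (val P)).
Proof.
rewrite -on_curve_short_model (_ : shifto _ _ _ = val P); first exact: valP.
rewrite -{2}[iota (a1 E / 2)]opprK -{2}[iota (a3 E / 2)]opprK.
by have := shiftoK (- iota (a1 E / 2)) (- iota (a3 E / 2)) (val P); rewrite !opprK.
Qed.

Definition of_short (P : point SK) : point EK :=
  exist (on_curve EK) _ (of_short_on_curve P).

Lemma to_shortK : cancel to_short of_short.
Proof. by move=> P; apply: val_inj; apply: shiftoK. Qed.

Lemma of_shortK : cancel of_short to_short.
Proof.
move=> P; apply: val_inj => /=.
by have := shiftoK (- iota (a1 E / 2)) (- iota (a3 E / 2)) (val P); rewrite !opprK.
Qed.

Lemma mor_shift (W1 W2 : weierstrass F) (c d : F)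
    (u : point (base_change iota W1) -> point (base_change iota W2)) :
  (forall P, val (u P) = shifto (iota c) (iota d) (val P)) -> mor iota u.
Proof.
move=> uE P0.
have cE P : [/\ cx (u P) = cx P, cy (u P) = cy P + iota c * cx P + iota d * cz P &
    cz (u P) = cz P].
  by rewrite /cx /cy /cz /hv uE; case: (val P) => [[x y]|] /=; split=> //; ring.
exists 1%N, (fun x _ _ => x), (fun x y z => y + iota c * x + iota d * z), (fun _ _ z => z).
have [e1 e2 e3] := cE P0.
split; [exact: hpol_x | hpol_tac | exact: hpol_z | |].
  by rewrite !hvE -e2 -e1 -e3; apply: coord_nz.
by move=> P; have [f1 f2 f3] := cE P; rewrite !hvE -f2 -f1 -f3; split.
Qed.

Lemma mor_to_short : mor iota to_short.
Proof. exact: mor_shift. Qed.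

Lemma mor_of_short : mor iota of_short.
Proof.
apply: (@mor_shift _ _ (- (a1 E / 2)) (- (a3 E / 2))) => P.
by rewrite !rmorphN.
Qed.

End ShortModel.

Lemma card_short_model (F : finFieldType) (E : weierstrass F) :
  (2 : F) != 0 -> card_points (short_model E) = card_points E.
Proof.
move=> n2; rewrite /card_points -!sum1_card.
have shK c d : cancel (shifto (- c) (- d)) (@shifto F c d).
  by move=> P; have := shiftoK (- c) (- d) P; rewrite !opprK.
rewrite (reindex (@shifto F (a1 E / 2) (a3 E / 2))).
  by apply: eq_bigl => P; rewrite !inE; exact (on_curve_short_model E n2 (idfun : {rmorphism F -> F}) P).
by exists (shifto (- (a1 E / 2)) (- (a3 E / 2))) => P _; [apply: shiftoK | apply: shK].
Qed.

Section Isogenous.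
Variables (F K : fieldType) (iota : {rmorphism F -> K}).

Definition isog (W1 W2 : weierstrass F) :=
  exists phi : point (base_change iota W1) -> point (base_change iota W2),
    [/\ mor iota phi, phi (origin _) = origin _ & exists P, phi P <> origin _].

Lemma isog_isogeny_over W1 W2 : isog W1 W2 <->
  exists phi : point (base_change iota W1) -> point (base_change iota W2), isogeny_over phi.
Proof.
split=> -[phi [m p0 nz]]; exists phi; split=> //; exact/morphism_overE.
Qed.

End Isogenous.

Lemma isog_short_model (F : finFieldType) (K : fieldType) (iota : {rmorphism F -> K})
    (E W : weierstrass F) : (2 : F) != 0 -> isog iota E W <-> isog iota (short_model E) W.
Proof.
move=> n2; split=> -[phi [m p0 [P nz]]].
  exists (fun Q => phi (of_short n2 Q)); split.
  - exact: mor_comp (@mor_of_short F E n2 K iota) m.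
  - by rewrite -p0; congr phi; apply: val_inj.
  by exists (to_short n2 P); rewrite to_shortK.
exists (fun Q => phi (to_short n2 Q)); split.
- exact: mor_comp (@mor_to_short F E n2 K iota) m.
- by rewrite -p0; congr phi; apply: val_inj.
by exists (of_short n2 P); rewrite of_shortK.
Qed.

Lemma odd_card_fixed (T : finType) (S : {set T}) (g : T -> T) :
  {in S, forall x, g x \in S} -> {in S, forall x, g (g x) = x} ->
  odd #|S| = odd #|[set x in S | g x == x]|.
Proof.
have [m] := ubnP #|S|; elim: m S => // m IHm S sS gS gK.
have [x /andP [xS gx]|fix_all] := pickP [pred x in S | g x != x]; last first.
  congr (odd _); apply: eq_card => x; rewrite inE; case: (boolP (x \in S)) => //= xS.
  by have := fix_all x; rewrite /= xS => /negbFE ->.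
have gxS : g x \in S :\ x by rewrite !inE gx gS.
pose S' := S :\ x :\ g x.
have cS : #|S| = (#|S'|.+2)%N by rewrite (cardsD1 x) xS (cardsD1 (g x)) gxS.
have inS' y : (y \in S') = [&& y != g x, y != x & y \in S] by rewrite !inE.
have gS' : {in S', forall y, g y \in S'}.
  move=> y; rewrite !inS' => /and3P [n1 n2 yS]; rewrite gS // andbT; apply/andP; split.
    by apply: contra n2 => /eqP e; rewrite -(gK y yS) e gK.
  by apply: contra n1 => /eqP e; rewrite -(gK y yS) e.
rewrite cS /= negbK (IHm S') //; last 2 first.
- by rewrite cS in sS; lia.
- by move=> y; rewrite inS' => /and3P [_ _ /gK].
congr (odd _); apply: eq_card => y; rewrite !inE.
have [->|n1] := eqVneq y (g x); first by rewrite gK // [x == _]eq_sym (negPf gx) !andbF.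
by have [->|n2] := eqVneq y x; rewrite //= (negPf gx) !andbF.
Qed.

(** * Point counts modulo 4 *)

Section Counting.
Variables (F : finFieldType) (D : scurve F).

Definition square_fiber := [set c : F | (cubic D c != 0) && [exists y : F, y ^+ 2 == cubic D c]].

Lemma card_points_squares :
  card_points D = (1 + #|[set c | cubic D c == 0%R]| + 2 * #|square_fiber|)%N.
Proof.
rewrite card_pointsE -addnA; congr (_ + _)%N.
rewrite -!sum1_card !(big_mkcond (fun c => c \in _)) big_distrr -big_split /=.
apply: eq_bigr => c _; rewrite !inE.
have [[c0 e]|[[y y0 yE] e]|[nsq e]] := fiber_cases D c; rewrite /fiber in e; rewrite e.
- by rewrite c0 eqxx.
- rewrite -yE sqrf_eq0 (negPf y0) /=.
  by have -> : [exists z, z ^+ 2 == y ^+ 2] by apply/existsP; exists y.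
case: eqP => [c0|_]; first by case: (nsq 0); rewrite expr0n c0.
by case: existsP => // -[y /eqP yE]; case: (nsq y).
Qed.

Hypothesis a6_0 : a6 D = 0.
Let b := a4 D.

Lemma a4_neq0 : b != 0.
Proof.
apply: contra (sc_elliptic D) => /eqP; rewrite /b => b0.
by rewrite /disc /b2 /b4 /b6 /b8 sc_a1 sc_a3 a6_0 b0; apply/eqP; ring.
Qed.

Lemma cubicE x : cubic D x = x * (x ^+ 2 + a2 D * x + b).
Proof. by rewrite /cubic a6_0 /b; ring. Qed.

(* x |-> b / x is translation by (0, 0) on x-coordinates. *)
Lemma odd_square_fiber :
  odd #|square_fiber| = odd #|[set c in square_fiber | c ^+ 2 == b]|.
Proof.
have x0 x : x \in square_fiber -> x != 0.
  rewrite inE => /andP [+ _]; apply: contra => /eqP ->.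
  by rewrite cubicE mul0r.
have fE x : x != 0 -> cubic D (b / x) = cubic D x * (b / x ^+ 2) ^+ 2.
  by move=> xn; rewrite !cubicE; field.
rewrite (@odd_card_fixed _ square_fiber (fun x => b / x)).
- congr (odd _); apply: eq_card => x; rewrite [LHS]in_set [RHS]in_set.
  case: (boolP (x \in square_fiber)) => //= xS; have xn := x0 x xS.
  by rewrite -[RHS](inj_eq (mulIf (invr_neq0 xn))) expr2 mulfK // eq_sym.
- move=> x xS; have xn := x0 x xS; move: xS; rewrite !inE fE // => /andP [fn /existsP [y /eqP yE]].
  rewrite mulf_neq0 ?expf_neq0 ?mulf_neq0 ?invr_eq0 ?expf_neq0 ?a4_neq0 //=.
  by apply/existsP; exists (y * (b / x ^+ 2)); rewrite exprMn yE.
by move=> x xS; have xn := x0 x xS; field; rewrite xn a4_neq0.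
Qed.

End Counting.

Section Legendre.
Variables (F : finFieldType) (lam : F).
Hypotheses (char2 : (2 : F) != 0) (lam0 : lam != 0) (lam1 : lam != 1).

Lemma legendre_elliptic : elliptic (legendre lam).
Proof. by rewrite elliptic_legendre // lam0. Qed.

Definition legendre_curve : scurve F := SCurve (erefl : a1 (legendre lam) = 0)
  (erefl : a3 (legendre lam) = 0) legendre_elliptic char2.

Lemma cubic_legendre x : cubic legendre_curve x = x * (x - 1) * (x - lam).
Proof. by rewrite /cubic /=; ring. Qed.

(** N is 4 + 2 S, where S counts the abscissas with two rational points, so S has to be even. The
    involution sending x to lam / x reduces its parity to the solutions of x^2 = lam, and on these x
    to - x is an involution without fixed point. *)
Lemma dvdn4_card_legendre : (4 %| card_points legendre_curve)%N.
Proof.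
rewrite card_points_squares.
have -> : #|[set c | cubic legendre_curve c == 0%R]| = 3%N.
  transitivity #|[:: 0; 1; lam]|.
    apply: eq_card => x; rewrite !inE cubic_legendre !mulf_eq0 !subr_eq0 orbA //.
  by apply/card_uniqP; rewrite /= !inE !negb_or eq_sym oner_eq0 eq_sym lam0 eq_sym lam1.
have : ~~ odd #|square_fiber legendre_curve|.
  rewrite odd_square_fiber //= (@odd_card_fixed _ _ (fun x => - x)).
  - rewrite (_ : [set _ in _ | _] = set0) ?cards0 //; apply/setP => x; rewrite !inE.
    apply/negP => /andP [/andP [_ /eqP x2]].
    rewrite -subr_eq0 -opprD oppr_eq0 -mulr2n -mulr_natl mulf_eq0 (negPf char2) /= => /eqP x0.
    by move: lam0; rewrite -x2 x0 expr0n eqxx.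
  - move=> x; rewrite !inE sqrrN !cubic_legendre => /andP [/andP [f0 /existsP [y /eqP yE]] /eqP x2].
    rewrite x2 eqxx andbT; move: f0 yE; rewrite -x2 => f0 yE.
    have xn : x - 1 != 0 by apply: contra f0 => /eqP ->; rewrite mulr0 mul0r.
    have xn' : - x - 1 != 0.
      apply: contra lam1 => /eqP e; rewrite -x2 (_ : x = -1) ?sqrrN ?expr1n //.
      by apply: (lin_comb (eqM (-1) e)); ring.
    have x0 : x != 0 by apply: contra f0 => /eqP ->; rewrite !mul0r.
    apply/andP; split.
      rewrite (_ : - x * (- x - 1) * (- x - x ^+ 2) = - (x ^+ 2 * (- x - 1) ^+ 2)); last by ring.
      by rewrite oppr_eq0 mulf_neq0 ?expf_neq0.
    (* With lam = x^2 the cubic is [- x^2 (x - 1)^2] at x and [- x^2 (x + 1)^2] at - x. *)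
    apply/existsP; exists (y * (- x - 1) / (x - 1)).
    rewrite !exprMn exprVn yE; apply/eqP; field; exact: xn.
  by move=> x _; rewrite opprK.
by rewrite -dvdn2 => /dvdnP [k ->]; rewrite (_ : _ + _ = (k.+1) * 4)%N ?dvdn_mull //; lia.
Qed.

End Legendre.

(** * Small degree forces scalar Frobenius *)

Section ScalarFrobenius.
Variables (p n : nat) (F : finFieldType) (K : closedFieldType) (iota : {rmorphism F -> K}).
Hypotheses (p_prime : prime p) (card_F : #|F| = (p ^ n)%N).
Variable D : scurve F.

Local Notation q := #|F|.
Local Notation N := (card_points D).
Let C := bc iota D.
Local Notation fr := (@frob p n F K iota p_prime card_F D).

Lemma degree_zero_scalar (m : int) (P0 : point C) :
  m ^+ 2 - (q.+1%:Z - N%:Z) * m + q%:Z = 0 -> P0 <> 0 -> fr P0 = P0 *~ m ->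
  forall P, fr P = P *~ m.
Proof.
move=> dm P00 fP0; have [a [b r]] := @mult_sub_frob_xrep p n F K iota p_prime card_F D m.
have := degree_mult_sub_frob r; rewrite dm => d0.
have [sa sb] : (size a <= 1)%N /\ (size b <= 1)%N by rewrite /pdeg2 in d0; lia.
have [nc h] := r; have [h0 _] := h P0 P00.
have bE := size1_polyC sb.
have b0 : b = 0.
  have : b.[cx P0] = 0 by apply: h0; rewrite /mult_sub_frob fP0 subrr.
  by rewrite bE hornerC => ->; rewrite polyC0.
move=> P; have [->|/eqP P_0] := eqVneq P 0; first by rewrite mul0rz; apply: val_inj.
have [_ h1] := h P P_0; apply/esym/subr0_eq/eqP; apply: contraT => /eqP /h1 [].
by rewrite b0 horner0 eqxx.
Qed.

(* A nonzero multiplication-minus-Frobenius map of degree d has at most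
   2 d + 1 points in its kernel. *)
Lemma torsion_scalar_degree (m : int) (l : seq (point C)) : uniq l ->
  (forall P, P \in l -> fr P = P *~ m) ->
  (2 * (m ^+ 2 - (q.+1%:Z - N%:Z) * m + q%:Z) + 1 < (size l)%:Z) ->
  m ^+ 2 - (q.+1%:Z - N%:Z) * m + q%:Z = 0.
Proof.
move=> ul lE szl; have [a [b r]] := @mult_sub_frob_xrep p n F K iota p_prime card_F D m.
have dE := degree_mult_sub_frob r; rewrite -dE in szl *.
have [nc h] := r.
have [b0|bn] := eqVneq b 0.
  have sa : size a = 1%N.
    apply/eqP; apply: contraT => /closed_rootP [z /rootP /nc].
    by rewrite b0 horner0 eqxx.
  by rewrite /pdeg2 b0 sa size_poly0.
exfalso; have [rt rtE] := closed_field_poly_normal b.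
have srt : size rt = (size b).-1.
  by rewrite {1}rtE size_scale ?lead_coef_eq0 // size_prod_XsubC.
have [l' [sl' hl']] := points_over C rt.
have : (size l <= size (0%R :: l'))%N.
  apply: uniq_leq_size ul _ => P /lE fP; rewrite inE.
  have [//|/eqP P0] := eqVneq P 0; rewrite hl' //.
  have [/(_ _)/rootP bP _] := h P P0.
  rewrite rtE rootZ ?lead_coef_eq0 // root_prod_XsubC in bP.
  by apply: bP; rewrite /mult_sub_frob fP subrr.
rewrite /= sl' srt => szle.
have : (size b <= maxn (size a) (size b))%N by rewrite leq_maxr.
by move: szl szle; rewrite /pdeg2; move: (size a) (size b) (size l) => x y z; lia.
Qed.

End ScalarFrobenius.

Section LegendreForward.
Variables (p n : nat) (F : finFieldType) (K : closedFieldType) (iota : {rmorphism F -> K}).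
Hypotheses (p_prime : prime p) (card_F : #|F| = (p ^ n)%N).
Variables (lam : F) (char2 : (2 : F) != 0) (lam0 : lam != 0) (lam1 : lam != 1).
Let D := legendre_curve char2 lam0 lam1.

(* If N = (m + 1)^2 then frob = -m; as 4 divides m - 1, it maps the point
   Q = (1 + s, s (1 + s)) of order 4, s^2 = 1 - lam, to -Q. *)
Lemma card_legendre_neq (m : int) : (#|F|)%:Z = m ^+ 2 -> (m = 1 %[mod 4])%Z ->
  (card_points D)%:Z <> (m + 1) ^+ 2.
Proof.
move=> qm m1 Nm; pose C := bc iota D.
have dm : (- m) ^+ 2 - ((#|F|).+1%:Z - (card_points D)%:Z) * (- m) + (#|F|)%:Z = 0.
  by rewrite (_ : (#|F|).+1%:Z = (#|F|)%:Z + 1) ?qm ?Nm; [ring | lia].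
have [k mk] : exists k, m = 1 + 4 * k.
  by exists (m %/ 4)%Z; rewrite {1}(divz_eq m 4) m1 mulrC addrC.
have fE x : cubic C x = x * (x - 1) * (x - iota lam).
  by rewrite /cubic /= !(rmorphN, rmorphD, rmorph1, rmorph0); ring.
(* The rational point (0, 0) has order 2 and m is odd, so it is in the kernel of - m - Frob and can
   serve as the point required by [degree_zero_scalar]. *)
have hT : 0 ^+ 2 = cubic C 0 by rewrite fE expr0n /= !mul0r.
have T2 : aff hT *+ 2 = 0 by apply: val_inj; rewrite /= oppr0 !eqxx.
have mult P (j : int) : P *+ 4 = 0 :> point C -> P *~ (4 * j) = 0.
  by move=> P4; rewrite mulrzA -pmulrn P4 mul0rz.
have T4 : aff hT *+ 4 = 0 by rewrite (mulrnA _ 2 2) T2 mul0rn.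
have key P : P *+ 4 = 0 :> point C -> P *~ (- m) = - P.
  by move=> P4; rewrite mulrNz mk mulrzDr mulr1z mult // addr0.
have NT : - aff hT = aff hT by apply/esym/eqP; rewrite -addr_eq0 -mulr2n T2.
have fT : @frob _ _ _ _ iota p_prime card_F D (aff hT) = aff hT *~ (- m).
  by rewrite key // NT; apply: val_inj; rewrite /= expr0n gtn_eqF ?card_gt0.
have scal := degree_zero_scalar dm (@aff_neq_origin _ _ _ _ hT) fT.
have n2 : (2 : K) != 0 by rewrite -(rmorph_nat iota) fmorph_eq0.
have [s sE] := closed_sqrt (1 - iota lam).
have lE : iota lam = 1 - s ^+ 2 by rewrite sE; ring.
have s0 : s != 0.
  apply: contra lam1 => /eqP s0; rewrite -(inj_eq (fmorph_inj iota)) lE s0 rmorph1 expr0n.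
  by rewrite subr0.
have s1 : 1 + s != 0.
  apply: contra lam0 => /eqP e; rewrite -(inj_eq (fmorph_inj iota)) lE rmorph0.
  by apply/eqP; apply: (lin_comb (eqM (1 - s) e)); ring.
have hQ : (s * (1 + s)) ^+ 2 = cubic C (1 + s) by rewrite fE lE; ring.
have y0 : s * (1 + s) != 0 by rewrite mulf_neq0.
(* The tangent at Q has slope 1 + s and meets the x-axis at (1, 0), which is 2 Q. *)
have Q2 : (aff hQ + aff hQ) + (aff hQ + aff hQ) = 0.
  have a2E : a2 C = - (2 - s ^+ 2) by rewrite /= rmorphN rmorphD rmorph1 lE; ring.
  have a4E : a4 C = 1 - s ^+ 2 by rewrite /= lE.
  have := addp_double hQ y0; rewrite -[addp _ _]/(aff hQ + aff hQ) /third_point.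
  have -> : dcubic C (1 + s) / (2 * (s * (1 + s))) = 1 + s.
    by rewrite /dcubic a2E a4E; field; rewrite s0 s1 n2.
  rewrite a2E; case: (pointP (aff hQ + aff hQ)) => // x3 y3 h3 [x3E y3E].
  have y30 : y3 = 0 by rewrite y3E; ring.
  by apply: val_inj; rewrite /= y30 oppr0 !eqxx.
have fQ := scal (aff hQ).
rewrite key in fQ; last by rewrite (mulrnA _ 2 2) !mulr2n.
have [xq yq] : (1 + s) ^+ #|F| = 1 + s /\ (s * (1 + s)) ^+ #|F| = - (s * (1 + s)).
  by have := congr1 val fQ => /= -[].
have sq : s ^+ #|F| = s.
  by apply: (addrI 1); rewrite -[RHS]xq (frobD iota p_prime card_F) expr1n.
move: yq; rewrite exprMn sq xq => /eqP.
by rewrite -addr_eq0 -mulr2n -mulr_natl mulf_eq0 (negPf n2) (negPf y0).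
Qed.

End LegendreForward.

(** * Explicit isogenies *)

Section IsogTransitive.
Variables (F : finFieldType) (K : closedFieldType) (iota : {rmorphism F -> K}).

Lemma isog_trans (D1 D2 D3 : scurve F) : isog iota D1 D2 -> isog iota D2 D3 -> isog iota D1 D3.
Proof.
move=> [phi [m p0 nz]] [psi [m' p0' [T nz']]]; exists (psi \o phi); split.
- exact: mor_comp m m'.
- by rewrite /= p0.
have me := @mor_extend _ _ _ (bc iota D1) (bc iota D2) phi m.
have [P PT] := mor_surjective me nz (mor_is_hom me p0) T.
by exists P; rewrite /= PT.
Qed.

End IsogTransitive.

(** * Rational changes of variables *)

Section AffineIsomorphism.
Variables (F : finFieldType) (K : closedFieldType) (iota : {rmorphism F -> K}).
Variables (D1 D2 : scurve F) (v e : F).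
Hypotheses (v0 : v != 0) (a2E : v ^+ 2 * a2 D1 = 3 * e + a2 D2)
  (a4E : v ^+ 4 * a4 D1 = dcubic D2 e) (a6E : v ^+ 6 * a6 D1 = cubic D2 e).

Let C1 := bc iota D1.
Let C2 := bc iota D2.

Definition scaleo (P : option (K * K)) :=
  if P is Some (x, y) then Some (iota v ^+ 2 * x + iota e, iota v ^+ 3 * y) else None.

Lemma cubic_scale x : cubic C2 (iota v ^+ 2 * x + iota e) = iota v ^+ 6 * cubic C1 x.
Proof.
have h2 := congr1 iota a2E; have h4 := congr1 iota a4E; have h6 := congr1 iota a6E.
move: h2 h4 h6; rewrite /dcubic /cubic /=.
rewrite !(rmorph_nat, rmorphXn, rmorphB, rmorphD, rmorphN, rmorphM) => h2 h4 h6.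
by apply: (lin_comb (eqD (eqD (eqM (- iota v ^+ 4 * x ^+ 2) h2) (eqM (- iota v ^+ 2 * x) h4))
  (eqM (-1) h6))); ring.
Qed.

Lemma scaleo_on_curve (P : point C1) : on_curve C2 (scaleo (val P)).
Proof.
case: (pointP P) => [|x y h] //; rewrite [scaleo _]/= on_curveE cubic_scale -h.
by apply/eqP; ring.
Qed.

Definition scale (P : point C1) : point C2 := exist (on_curve C2) _ (scaleo_on_curve P).

Lemma mor_scale : mor iota scale.
Proof.
move=> P0; have v30 : iota v ^+ 3 != 0 by rewrite expf_neq0 ?fmorph_eq0.
exists 1%N, (fun x _ z => iota v ^+ 2 * x + iota e * z), (fun _ y _ => iota v ^+ 3 * y),
  (fun _ _ z => z).
split; [hpol_tac | hpol_tac | exact: hpol_z | |].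
  case: (pointP P0) => [|x y h]; first by apply: nz3_2; rewrite hv_origin mulr1.
  by apply: nz3_3; rewrite hv_aff oner_neq0.
move=> P; case: (pointP P) => [|x y h]; last first.
  by rewrite /rep /cx /cy /cz /hv /= mulr1; split; ring.
have -> : scale (origin C1) = origin C2 by apply: val_inj.
by apply: rep_O; rewrite hv_origin; ring.
Qed.

Lemma scale_eq0 P : scale P = origin C2 -> P = origin C1.
Proof. by case: (pointP P) => // x y h []. Qed.

Lemma isog_scale : isog iota D1 D2.
Proof.
exists scale; split; [exact: mor_scale | exact: val_inj |].
by have [P h] := nontrivial_double C1; exists P => /scale_eq0 e0; apply: h; rewrite (e0 : P = 0) addr0.
Qed.

End AffineIsomorphism.

(** * The quotient by a rational point of order 2 *)

Section TwoIsogeny.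
Variables (F : finFieldType) (K : closedFieldType) (iota : {rmorphism F -> K}).
Variables (D1 D2 : scurve F).
Hypotheses (D1a6 : a6 D1 = 0) (D2a6 : a6 D2 = 0).
Hypotheses (D2a2 : a2 D2 = - 2 * a2 D1) (D2a4 : a4 D2 = a2 D1 ^+ 2 - 4 * a4 D1).

Let C1 := bc iota D1.
Let C2 := bc iota D2.
Let A := iota (a2 D1).
Let B := iota (a4 D1).

Lemma cubic_two1 x : cubic C1 x = x * (x ^+ 2 + A * x + B).
Proof. by rewrite /cubic /= D1a6 rmorph0 /A /B; ring. Qed.

Lemma cubic_two2 x : cubic C2 x = x * ((x - A) ^+ 2 - 4 * B).
Proof.
rewrite /cubic /= D2a6 D2a2 D2a4 rmorph0 /A /B.
by rewrite !(rmorph_nat, rmorphXn, rmorphB, rmorphD, rmorphN, rmorphM); ring.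
Qed.

(** The classical isogeny with kernel generated by (0, 0), onto
    [y^2 = x (x^2 - 2 A x + A^2 - 4 B)]. *)
Definition two_isogo (P : option (K * K)) :=
  if P is Some (x, y) then
    if x == 0 then None else Some (y ^+ 2 / x ^+ 2, y * (B - x ^+ 2) / x ^+ 2)
  else None.

Lemma two_isogo_on_curve (P : point C1) : on_curve C2 (two_isogo (val P)).
Proof.
case: (pointP P) => [|x y h] //; rewrite [two_isogo _]/=.
case: eqVneq => [//|x0]; rewrite on_curveE cubic_two2 h cubic_two1 !exprMn h cubic_two1.
by apply/eqP; field.
Qed.

Definition two_isog (P : point C1) : point C2 := exist (on_curve C2) _ (two_isogo_on_curve P).

Lemma two_isog_eq0 x y (h : y ^+ 2 = cubic C1 x) : (two_isog (aff h) == origin C2) = (x == 0).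
Proof. by apply/eqP/idP => [|x0]; [case; case: eqP | apply: val_inj; rewrite /= x0]. Qed.

Lemma two_isogP x y (h : y ^+ 2 = cubic C1 x) : x != 0 ->
  [/\ cx (two_isog (aff h)) = y ^+ 2 / x ^+ 2,
    cy (two_isog (aff h)) = y * (B - x ^+ 2) / x ^+ 2 & cz (two_isog (aff h)) = 1].
Proof. by rewrite /cx /cy /cz /hv /= => /negPf ->. Qed.

Let Q (x y z : K) := x ^+ 2 + A * x * z + B * z ^+ 2.
Let U (x y z : K) := y ^+ 2 - A * x ^+ 2 - B * x * z.

(** The first triple clears denominators and serves where x is not 0. The second comes from
    multiplying by x y and replacing [y^2 / x] by Q, and serves at (0, 0). The third replaces [x^3]
    by U and serves at the origin. *)
Lemma mor_two_isog : mor iota two_isog.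
Proof.
have B0 : B != 0 by rewrite fmorph_eq0 a4_neq0.
have rO (P : point C2) u v w : u = 0 -> v = 0 -> w = 0 -> rep P u v w.
  by move=> -> -> ->; split; rewrite !(mul0r, mulr0).
have rep1 P : rep (two_isog P) (hv (fun x y z => y ^+ 2 * z) P)
   (hv (fun x y z => y * (B * z ^+ 2 - x ^+ 2)) P) (hv (fun x y z => x ^+ 2 * z) P).
  case: (pointP P) => [|x y h]; rewrite ?hv_origin ?hv_aff.
    have -> : two_isog (origin C1) = origin C2 by apply: val_inj.
    by apply: rep_O; ring.
  have [x0|x0] := eqVneq x 0.
    have y0 : y = 0 by apply/eqP; rewrite -sqrf_eq0 h cubic_two1 x0 mul0r.
    by apply: rO; rewrite ?x0 ?y0; ring.
  rewrite /rep; have [-> -> ->] := two_isogP h x0; split; field; exact: x0.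
have rep2 P : rep (two_isog P) (hv (fun x y z => y * Q x y z * z) P)
   (hv (fun x y z => Q x y z * (B * z ^+ 2 - x ^+ 2)) P) (hv (fun x y z => x * y * z ^+ 2) P).
  case: (pointP P) => [|x y h]; rewrite ?hv_origin ?hv_aff /Q.
    have -> : two_isog (origin C1) = origin C2 by apply: val_inj.
    by apply: rep_O; ring.
  have [x0|x0] := eqVneq x 0.
    have y0 : y = 0 by apply/eqP; rewrite -sqrf_eq0 h cubic_two1 x0 mul0r.
    have -> : two_isog (aff h) = origin C2 by apply/eqP; rewrite two_isog_eq0 x0.
    by apply: rep_O; rewrite x0 y0; ring.
  have QE : x ^+ 2 + A * x * 1 + B * 1 ^+ 2 = y ^+ 2 / x by rewrite h cubic_two1; field.
  rewrite QE /rep; have [-> -> ->] := two_isogP h x0; split; field; exact: x0.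
have rep3 P : rep (two_isog P) (hv (fun x y z => x * y ^+ 2) P)
   (hv (fun x y z => y * (B * x * z - U x y z)) P) (hv (fun x y z => x ^+ 3) P).
  case: (pointP P) => [|x y h]; rewrite ?hv_origin ?hv_aff /U.
    have -> : two_isog (origin C1) = origin C2 by apply: val_inj.
    by apply: rep_O; ring.
  have UE : y ^+ 2 - A * x ^+ 2 - B * x * 1 = x ^+ 3 by rewrite h cubic_two1; ring.
  rewrite UE; have [x0|x0] := eqVneq x 0.
    have y0 : y = 0 by apply/eqP; rewrite -sqrf_eq0 h cubic_two1 x0 mul0r.
    by apply: rO; rewrite ?x0 ?y0; ring.
  rewrite /rep; have [-> -> ->] := two_isogP h x0; split; field; exact: x0.
move=> P0; case: (pointP P0) => [|x y h].
  exists 3, (fun x y z => x * y ^+ 2), (fun x y z => y * (B * x * z - U x y z)),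
    (fun x y z => x ^+ 3); split=> //; rewrite /U /A /B; try hpol_tac.
  by apply: nz3_2; rewrite hv_origin; rewrite (_ : _ * _ = -1) ?oppr_eq0 ?oner_eq0 //; ring.
have [x0|x0] := eqVneq x 0.
  exists 4%N, (fun x y z => y * Q x y z * z), (fun x y z => Q x y z * (B * z ^+ 2 - x ^+ 2)),
    (fun x y z => x * y * z ^+ 2); split=> //; rewrite /Q /A /B; try hpol_tac.
  by apply: nz3_2; rewrite hv_aff x0 (_ : _ * _ = B ^+ 2) ?expf_neq0 //; ring.
exists 3%N, (fun x y z => y ^+ 2 * z), (fun x y z => y * (B * z ^+ 2 - x ^+ 2)),
  (fun x y z => x ^+ 2 * z); split=> //; rewrite /A /B; try hpol_tac.
by apply: nz3_3; rewrite hv_aff mulr1 expf_neq0.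
Qed.

Lemma isog_two : isog iota D1 D2.
Proof.
exists two_isog; split; [exact: mor_two_isog | exact: val_inj |].
have [x] := closed_avoid [:: 0 : K]; rewrite inE => x0.
by have [y yx] := curve_point_over C1 x; exists (aff yx); apply/eqP; rewrite two_isog_eq0.
Qed.

End TwoIsogeny.

Section SplitCubic.
Variables (F : fieldType) (D : scurve F).

Definition split_cubic (e1 e2 e3 : F) :=
  [/\ a2 D = - (e1 + e2 + e3), a4 D = e1 * e2 + e1 * e3 + e2 * e3 & a6 D = - (e1 * e2 * e3)].

Lemma split_cubic_distinct e1 e2 e3 : split_cubic e1 e2 e3 ->
  [/\ e1 != e2, e1 != e3 & e2 != e3].
Proof.
move=> [h2 h4 h6]; have := sc_elliptic D; rewrite /elliptic.
have -> : disc D = 16 * ((e1 - e2) * (e1 - e3) * (e2 - e3)) ^+ 2.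
  by rewrite /disc /b2 /b4 /b6 /b8 sc_a1 sc_a3 h2 h4 h6; ring.
by rewrite mulf_eq0 sqrf_eq0 !mulf_eq0 !subr_eq0 !negb_or => /andP [_ /andP [/andP [-> ->] ->]].
Qed.

Lemma split_cubicE e1 e2 e3 : split_cubic e1 e2 e3 ->
  forall x, cubic D x = (x - e1) * (x - e2) * (x - e3).
Proof. by move=> [h2 h4 h6] x; rewrite /cubic h2 h4 h6; ring. Qed.

Lemma split_cubicC12 e1 e2 e3 : split_cubic e1 e2 e3 -> split_cubic e2 e1 e3.
Proof. by move=> [h2 h4 h6]; split; rewrite ?h2 ?h4 ?h6; ring. Qed.

Lemma split_cubicC23 e1 e2 e3 : split_cubic e1 e2 e3 -> split_cubic e1 e3 e2.
Proof. by move=> [h2 h4 h6]; split; rewrite ?h2 ?h4 ?h6; ring. Qed.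

Lemma disc_two_isogenous : a6 D = 0 ->
  elliptic (Weierstrass 0 (- 2 * a2 D) 0 (a2 D ^+ 2 - 4 * a4 D) 0).
Proof.
move=> a60; have := sc_elliptic D; rewrite /elliptic.
have -> : disc D = 16 * (a4 D ^+ 2 * (a2 D ^+ 2 - 4 * a4 D)).
  by rewrite /disc /b2 /b4 /b6 /b8 sc_a1 sc_a3 a60; ring.
have -> : disc (Weierstrass 0 (- 2 * a2 D) 0 (a2 D ^+ 2 - 4 * a4 D) 0) =
   16 * (16 * a4 D * (a2 D ^+ 2 - 4 * a4 D) ^+ 2).
  by rewrite /disc /b2 /b4 /b6 /b8 /=; ring.
move=> h; have [n16 n4 nd] : [/\ (16 : F) != 0, a4 D != 0 & a2 D ^+ 2 - 4 * a4 D != 0].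
  by split; apply: contraNneq h => ->; rewrite ?(mul0r, mulr0, expr0n).
by rewrite !mulf_neq0 ?expf_neq0.
Qed.

Lemma disc_shift e : cubic D e = 0 ->
  elliptic (Weierstrass 0 (a2 D + 3 * e) 0 (dcubic D e) 0).
Proof.
move=> fe; have := sc_elliptic D; rewrite /elliptic.
have h6 : a6 D = - (e ^+ 3 + a2 D * e ^+ 2 + a4 D * e).
  by apply: (lin_comb fe); rewrite /cubic; ring.
have -> // : disc D = disc (Weierstrass 0 (a2 D + 3 * e) 0 (dcubic D e) 0).
by rewrite /disc /b2 /b4 /b6 /b8 /= sc_a1 sc_a3 h6 /dcubic; ring.
Qed.

Definition shift_curve e (fe : cubic D e = 0) : scurve F :=
  @SCurve F (Weierstrass 0 (a2 D + 3 * e) 0 (dcubic D e) 0) erefl erefl (disc_shift fe) (sc_char D).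

Definition two_isogenous_curve (a60 : a6 D = 0) : scurve F :=
  @SCurve F (Weierstrass 0 (- 2 * a2 D) 0 (a2 D ^+ 2 - 4 * a4 D) 0) erefl erefl
    (disc_two_isogenous a60) (sc_char D).

End SplitCubic.

(** * Criteria for being Legendre isogenous *)

Section LegendreCriteria.
Variables (F : finFieldType) (K : closedFieldType) (iota : {rmorphism F -> K}).

Definition legendre_isog (W : weierstrass F) :=
  exists lam : F, [/\ lam != 0, lam != 1 & isog iota W (legendre lam)].

Lemma legendre_isog_trans (D D' : scurve F) :
  isog iota D D' -> legendre_isog D' -> legendre_isog D.
Proof.
move=> i [lam [l0 l1 i']]; exists lam; split=> //.
exact: (@isog_trans _ _ _ D D' (legendre_curve (sc_char D) l0 l1)).
Qed.

Lemma legendre_of_square (D : scurve F) e1 e2 e3 v :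
  split_cubic D e1 e2 e3 -> e2 - e1 = v ^+ 2 -> legendre_isog D.
Proof.
move=> sp vE; have [n12 n13 n23] := split_cubic_distinct sp; have [h2 h4 h6] := sp.
have v20 : v ^+ 2 != 0 by rewrite -vE subr_eq0 eq_sym.
have v0 : v != 0 by rewrite -sqrf_eq0.
have e2E : e2 = v ^+ 2 + e1 by rewrite -vE subrK.
pose lam := (e3 - e1) / v ^+ 2.
have l0 : lam != 0 by rewrite mulf_neq0 ?invr_eq0 // subr_eq0 eq_sym.
have l1 : lam != 1.
  apply: contra n23 => /eqP l1; rewrite eq_sym -(inj_eq (addIr (- e1))) vE; apply/eqP.
  by rewrite -[RHS]mul1r -l1 /lam divfK.
exists lam; split=> //.
(* The substitution x to [(x - e1) / v^2] carries e1, e2, e3 to 0, 1, lam. *)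
apply: (@isog_scale _ _ _ D (legendre_curve (sc_char D) l0 l1) v^-1 (- e1 / v ^+ 2)).
- by rewrite invr_eq0.
- by rewrite h2 e2E /= /lam; field.
- by rewrite h4 e2E /dcubic /= /lam; field.
by rewrite h6 e2E /cubic /= /lam; field.
Qed.

(** As the cubic takes the value [x^2 (a2 + 2 x)] at x, the hypotheses describe a rational point (x,
    x t) of order 4 over (0, 0). The quotient by (0, 0) has the roots 0, a2 + 2 x and a2 - 2 x, and
    the difference of the first two is a square. *)
Lemma legendre_of_four_torsion (D : scurve F) x t : a6 D = 0 ->
  x ^+ 2 = a4 D -> a2 D + 2 * x = t ^+ 2 -> legendre_isog D.
Proof.
move=> a60 xE tE.
pose D2 := two_isogenous_curve a60.
apply: (@legendre_isog_trans _ D2); first exact: isog_two.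
apply: (@legendre_of_square D2 0 (a2 D + 2 * x) (a2 D - 2 * x) t); last by rewrite subr0.
by split=> /=; rewrite -?xE; ring.
Qed.

Lemma shift_curve_eqs (D : scurve F) e (fe : cubic D e = 0) : let D1 := shift_curve fe in
  [/\ 1 ^+ 2 * a2 D = 3 * - e + a2 D1, 1 ^+ 4 * a4 D = dcubic D1 (- e) &
    1 ^+ 6 * a6 D = cubic D1 (- e)].
Proof.
split; rewrite /=; [by ring | by rewrite /dcubic /= /dcubic; ring |].
by apply: (lin_comb fe); rewrite /cubic /= /dcubic; ring.
Qed.

Lemma two_isog_at (D : scurve F) e : cubic D e = 0 ->
  exists (D2 : scurve F) (phi : point (bc iota D) -> point (bc iota D2)),
  [/\ mor iota phi, phi 0 = 0, forall P, P <> 0 -> phi P = 0 <-> cx P = iota e &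
    [/\ a2 D2 = - 2 * (a2 D + 3 * e), a4 D2 = (a2 D + 3 * e) ^+ 2 - 4 * dcubic D e &
        a6 D2 = 0]].
Proof.
move=> fe.
pose D1 := shift_curve fe; pose D2 := @two_isogenous_curve F D1 erefl.
have [h2 h4 h6] := shift_curve_eqs fe.
pose psi := @scale F K iota D D1 1 (- e) h2 h4 h6.
pose chi := @two_isog _ _ iota D1 D2 erefl erefl erefl erefl.
exists D2, (chi \o psi); split.
- exact: mor_comp (@mor_scale F K iota D D1 1 (- e) (oner_neq0 _) h2 h4 h6) 
    (@mor_two_isog F K iota D1 D2 erefl erefl erefl erefl).
- exact: val_inj.
- move=> P; case: (pointP P) => // x y h _; rewrite /cx hv_aff.
  have vE : val (chi (psi (aff h))) =
      if x - iota e == 0 then None else val (chi (psi (aff h))).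
    by rewrite /= !rmorph1 expr1n mul1r rmorphN; case: (x - iota e == 0).
  split=> [/(congr1 val)|/eqP xe].
    by rewrite /= !rmorph1 expr1n mul1r rmorphN; case: eqP => // /subr0_eq.
  by apply: val_inj; rewrite vE subr_eq0 xe.
by split.
Qed.

Lemma isog_of_kernel (D1 D2 : scurve F) (phi : point (bc iota D1) -> point (bc iota D2)) c :
  mor iota phi -> phi 0 = 0 -> (forall P, P <> 0 -> phi P = 0 <-> cx P = c) -> isog iota D1 D2.
Proof.
move=> m p0 ker; exists phi; split=> //.
have [x] := closed_avoid [:: c]; rewrite inE => xc.
have [y yx] := curve_point_over (bc iota D1) x; exists (aff yx) => /(ker _ (@aff_neq_origin _ _ _ _ yx)).
by move/eqP; rewrite /cx hv_aff (negPf xc).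
Qed.

End LegendreCriteria.

Section Nonsquares.
Variables (F : finFieldType) (K : closedFieldType) (iota : {rmorphism F -> K}).

Lemma frob_sqrt (b : F) (s : K) : s ^+ 2 = iota b -> (forall c, c ^+ 2 <> b) -> s ^+ #|F| = - s.
Proof.
move=> sE nsq; have : (s ^+ #|F|) ^+ 2 = s ^+ 2.
  by rewrite -exprM mulnC exprM sE frob_iota.
move/eqP; rewrite eqf_sqr => /orP [|/eqP //] /(frob_fixed iota) [c cE].
by case: (nsq c); apply: (fmorph_inj iota); rewrite rmorphXn -cE.
Qed.

(** Frobenius negates the square roots of b and of c in K, so it fixes their product. *)
Lemma mul_nonsquares (b c : F) : (forall x, x ^+ 2 <> b) -> (forall x, x ^+ 2 <> c) ->
  exists x, x ^+ 2 = b * c.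
Proof.
move=> nb nc; have [s sE] := closed_sqrt (iota b); have [t tE] := closed_sqrt (iota c).
have : (s * t) ^+ #|F| == s * t.
  by rewrite exprMn (frob_sqrt sE nb) (frob_sqrt tE nc) mulrNN.
case/(frob_fixed iota) => x xE; exists x; apply: (fmorph_inj iota).
by rewrite rmorphXn -xE exprMn sE tE rmorphM.
Qed.

End Nonsquares.

(** * Frobenius on the torsion of power-of-two order *)

Section HomMultiples.
Variables (U V : zmodType) (h : U -> V).
Hypothesis hom : forall u v, h (u + v) = h u + h v.

Lemma hom_mulrn u m : h (u *+ m) = h u *+ m.
Proof.
elim: m => [|m IHm]; last by rewrite !mulrS hom IHm.
by apply: (addrI (h 0)); rewrite -hom !addr0.
Qed.

Lemma hom_oppr u : h (- u) = - h u.
Proof. by apply/eqP; rewrite -addr_eq0 -hom addNr; have := hom_mulrn 0 0; rewrite !mulr0n => ->. Qed.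

Lemma hom_mulrz u m : h (u *~ m) = h u *~ m.
Proof. by case: m => m; rewrite ?NegzE ?mulrNz ?hom_oppr -!pmulrn hom_mulrn. Qed.

End HomMultiples.

Section IndependentTorsion.
Variables (V : zmodType).
Implicit Types A B T : V.

Lemma order2_mulrz T (u : int) : T *+ 2 = 0 -> T *~ u = if (2 %| u)%Z then 0 else T.
Proof.
move=> T2; have e j : T *~ (j * 2) = 0 by rewrite mulrC mulrzA -pmulrn T2 mul0rz.
case: ifP => [/dvdzP [j ->]|u2]; first exact: e.
have -> : u = (u %/ 2)%Z * 2 + 1.
  have := divz_eq u 2; have := modz_ge0 u (isT : (2 : int) != 0).
  have := ltz_pmod u (isT : (0 : int) < 2).
  have : (u %% 2)%Z != 0 by apply: contraFN u2 => /eqP /dvdz_mod0P.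
  by lia.
by rewrite mulrzDr e add0r mulr1z.
Qed.

(** If [2^i] divides u and w, multiplying the relation by [2^(k - i)] gives one between T1 and T2
    with the quotients as coefficients. T1 and T2 are independent of order 2, so both quotients are
    even. *)
Lemma independent_multiples A B T1 T2 k (u w : int) :
  A *+ 2 ^ k = T1 -> B *+ 2 ^ k = T2 -> T1 *+ 2 = 0 -> T2 *+ 2 = 0 ->
  T1 <> 0 -> T2 <> 0 -> T1 <> T2 -> A *~ u = B *~ w ->
  ((2 ^ k.+1)%:Z %| u)%Z && ((2 ^ k.+1)%:Z %| w)%Z.
Proof.
move=> AT BT T12 T22 n1 n2 n12 uw.
suff main i : (i <= k.+1)%N -> ((2 ^ i)%:Z %| u)%Z && ((2 ^ i)%:Z %| w)%Z by exact: main.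
elim: i => [|i IHi] ik; first by rewrite !dvd1z.
have /andP [/dvdzP [u' uE] /dvdzP [w' wE]] := IHi (ltnW ik).
have pw : (2 ^ k)%:Z = (2 ^ i)%:Z * (2 ^ (k - i))%:Z by rewrite -PoszM -expnD subnKC.
have mulT X T c : X *+ 2 ^ k = T -> X *~ (c * (2 ^ i)%:Z) *~ (2 ^ (k - i))%:Z = T *~ c.
  by move=> XT; rewrite -mulrzA -mulrA -pw mulrC mulrzA -pmulrn XT.
have := congr1 (fun X => X *~ (2 ^ (k - i))%:Z) uw; rewrite uE wE (mulT _ _ _ AT) (mulT _ _ _ BT).
rewrite !order2_mulrz //; case: ifP => [du|_]; case: ifP => [dw|_] // e; last by case: n2.
by rewrite expnS !PoszM !dvdz_mul.
Qed.

Lemma mulrz_dvd A k (u w : int) : A *+ 2 ^ k = 0 -> ((2 ^ k)%:Z %| u - w)%Z -> A *~ u = A *~ w.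
Proof.
move=> Ak /dvdzP [j uw]; apply: subr0_eq; rewrite -mulrzBr uw mulrC mulrzA -pmulrn Ak.
exact: mul0rz.
Qed.

End IndependentTorsion.

Section TwoTorsion.
Variables (F : finFieldType) (K : closedFieldType) (iota : {rmorphism F -> K}).
Variable D : scurve F.
Local Notation C := (bc iota D).

Lemma halving_iter (S : point C) k : exists H, H *+ 2 ^ k = S.
Proof.
elim: k => [|k [H HE]]; first by exists S.
by have [H' H'E] := halving H; exists H'; rewrite expnS mulrnA mulr2n H'E.
Qed.

Lemma double_eq0 x y (h : y ^+ 2 = cubic C x) : (aff h + aff h == 0) = (y == 0).
Proof.
apply/eqP/eqP => [e|y0]; last by apply: val_inj; rewrite /= y0 oppr0 !eqxx.
apply/eqP; apply: contraT => y0.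
by have := addp_double h y0; rewrite -[addp _ _]/(aff h + aff h) e.
Qed.

Variables e1 e2 e3 : F.
Hypothesis sp : split_cubic D e1 e2 e3.

Lemma cubic_split x : cubic C x = (x - iota e1) * (x - iota e2) * (x - iota e3).
Proof.
have [h2 h4 h6] := sp; rewrite /cubic /= h2 h4 h6.
by rewrite !(rmorphN, rmorphD, rmorphM); ring.
Qed.

Lemma cubic_e1 : cubic D e1 = 0.
Proof. by rewrite (split_cubicE sp) subrr !mul0r. Qed.

Lemma tors_proof : 0 ^+ 2 = cubic C (iota e1).
Proof. by rewrite cubic_iota cubic_e1 rmorph0 expr0n. Qed.

Definition tors : point C := aff tors_proof.

Lemma tors_neq0 : tors <> 0.
Proof. exact: aff_neq_origin. Qed.

Lemma tors_double : tors *+ 2 = 0.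
Proof. by rewrite mulr2n; apply/eqP; rewrite double_eq0. Qed.

Lemma torsP P : P <> 0 -> cx P = iota e1 -> P = tors.
Proof.
case: (pointP P) => // x y h _; rewrite /cx hv_aff => xe; subst x.
by apply: aff_eq => //; apply/eqP; rewrite -sqrf_eq0 h -tors_proof expr0n.
Qed.

End TwoTorsion.

Section FullTwoTorsion.
Variables (F : finFieldType) (K : closedFieldType) (iota : {rmorphism F -> K}).
Variables (D : scurve F) (e1 e2 e3 : F) (sp : split_cubic D e1 e2 e3).
Local Notation C := (bc iota D).
Local Notation T1 := (tors iota sp).
Local Notation T2 := (tors iota (split_cubicC12 sp)).
Local Notation T3 := (tors iota (split_cubicC12 (split_cubicC23 sp))).

Lemma tors12 : T1 <> T2.
Proof.
have [n12 _ _] := split_cubic_distinct sp.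
by move/(congr1 val) => [] /fmorph_inj /eqP; rewrite (negPf n12).
Qed.

Lemma two_torsion (P : point C) : (P *+ 2 == 0) = (P \in [:: 0; T1; T2; T3]).
Proof.
rewrite !inE; apply/eqP/idP => [|/or4P [] /eqP ->]; last 4 first.
- exact: mul0rn.
- exact: tors_double.
- exact: tors_double.
- exact: tors_double.
rewrite mulr2n; case: (pointP P) => [|x y h] /eqP; first by rewrite eqxx.
rewrite double_eq0 => /eqP y0; have : cubic C x == 0 by rewrite -h y0 expr0n.
rewrite (cubic_split iota sp).
have nz := @aff_neq_origin _ _ _ _ h.
rewrite !mulf_eq0 !subr_eq0 -orbA => /or3P [] /eqP xe; apply/or4P.
- by constructor 2; apply/eqP/torsP.
- by constructor 3; apply/eqP/torsP.
by constructor 4; apply/eqP/torsP.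
Qed.

Lemma two_torsion_uniq : uniq [:: 0; T1; T2; T3].
Proof.
have [n12 n13 n23] := split_cubic_distinct sp.
rewrite /= !inE !negb_or /= andbT -andbA; apply/and3P; split; apply/eqP => /(congr1 val);
  by case=> /fmorph_inj /eqP; apply/negP.
Qed.

Lemma tors_add : T1 + T2 = T3.
Proof.
have : (T1 + T2) *+ 2 == 0 by rewrite mulrnDl !tors_double addr0.
rewrite two_torsion !inE => /or4P [] /eqP // e.
- by case: tors12; apply: (addIr T2); rewrite e -mulr2n tors_double.
- by case: (@tors_neq0 _ _ iota _ _ _ _ (split_cubicC12 sp)); apply: (addrI T1); rewrite e addr0.
by case: (@tors_neq0 _ _ iota _ _ _ _ sp); apply: (addIr T2); rewrite e add0r.
Qed.

Lemma torsion_list k : exists l : seq (point C), [/\ uniq l, size l = (4 ^ k)%N &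
  forall P, (P \in l) = (P *+ 2 ^ k == 0)].
Proof.
elim: k => [|k [l [ul sl lE]]]; first by exists [:: 0]; split=> // P; rewrite inE mulr1n.
have kE P : (P \in [:: 0; T1; T2; T3]) = (P + P == 0) by rewrite -two_torsion mulr2n.
have [l' [ul' sl' l'E]] := preimage_list (fun u v => addrACA u v u v) (@halving _ C)
  two_torsion_uniq kE ul.
exists l'; split=> //; first by rewrite sl' sl expnS mulnC.
by move=> P; rewrite l'E lE -mulr2n -mulrnA -expnS.
Qed.

End FullTwoTorsion.

(** * Frobenius is scalar when no Legendre curve is isogenous *)

Section ScalarTorsion.
Variables (p n : nat) (F : finFieldType) (K : closedFieldType) (iota : {rmorphism F -> K}).
Hypotheses (p_prime : prime p) (card_F : #|F| = (p ^ n)%N).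
Local Notation fr := (frob p_prime card_F).

Definition scalar_on_torsion (D : scurve F) k := exists m : int,
  forall P : point (bc iota D), P *+ 2 ^ k = 0 -> fr P = P *~ m.

(** Neither e2 - e1 nor e3 - e1 is a square, by [legendre_of_square], so their product is one. This
    is what makes the 2-torsion of the quotient rational again, its nonzero roots being conjugate up
    to the sign of s. *)
Lemma two_isogenous_split (D : scurve F) e1 e2 e3 :
  split_cubic D e1 e2 e3 -> ~ legendre_isog iota D ->
  exists s (D2 : scurve F) (phi : point (bc iota D) -> point (bc iota D2)),
  [/\ s ^+ 2 = (e2 - e1) * (e3 - e1),
    [/\ mor iota phi, phi 0 = 0 & forall P, P <> 0 -> phi P = 0 <-> cx P = iota e1],
    split_cubic D2 0 (2 * e1 - e2 - e3 + 2 * s) (2 * e1 - e2 - e3 - 2 * s) &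
    ~ legendre_isog iota D2].
Proof.
move=> sp nl; have [s sE] : exists s, s ^+ 2 = (e2 - e1) * (e3 - e1).
  apply: (mul_nonsquares iota) => v vE; apply: nl.
    exact: legendre_of_square sp (esym vE).
  exact: legendre_of_square (split_cubicC23 sp) (esym vE).
have [D2 [phi [m p0 ker [h2 h4 h6]]]] := two_isog_at iota (cubic_e1 sp).
have [g2 g4 g6] := sp; exists s, D2, phi; split=> //.
  split; rewrite ?h2 ?h4 ?h6 /dcubic ?g2 ?g4; try ring.
  by apply: (lin_comb (eqM 4 sE)); ring.
by move=> l; apply: nl; apply: legendre_isog_trans (isog_of_kernel m p0 ker) l.
Qed.

(* Induct through E -> E / <T1>: Frobenius acts on P up to the kernel {0, T1},
   and T1 = 2^k P is itself a multiple of P. *)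
Lemma frob_scalar_above (D : scurve F) e1 e2 e3 (sp : split_cubic D e1 e2 e3) k :
  ~ legendre_isog iota D ->
  (forall (D2 : scurve F) f1 f2 f3, split_cubic D2 f1 f2 f3 -> ~ legendre_isog iota D2 ->
    scalar_on_torsion D2 k) ->
  forall P, P *+ 2 ^ k = tors iota sp -> exists m : int, fr P = P *~ m.
Proof.
move=> nl IH P PT; have [s [D2 [phi [_ [m p0 ker] sp2 nl2]]]] := two_isogenous_split sp nl.
have [j jE] := IH _ _ _ _ sp2 nl2; have hom := mor_is_hom (mor_extend m) p0.
have pT : phi (tors iota sp) = 0 by apply/(ker _ (@tors_neq0 _ _ _ _ _ _ _ sp)).
have := jE (phi P); rewrite -(hom_mulrn hom) PT => /(_ pT).
rewrite -(mor_frob_comm _ _ _ m) -(hom_mulrz hom) => e.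
have d0 : phi (fr P - P *~ j) = 0 by rewrite hom (hom_oppr hom) e subrr.
have [/subr0_eq ->|/eqP nz] := eqVneq (fr P - P *~ j) 0; first by exists j.
exists ((2 ^ k)%:Z + j); rewrite mulrzDr -pmulrn PT.
by rewrite -(torsP sp nz (proj1 (ker _ nz) d0)) subrK.
Qed.

(** A and B are points over T1 and T2, and Frobenius multiplies A, B and A + B by n1, n2 and n3.
    Independence makes these congruent modulo [2^(k+1)]. Any point of [E[2^(k+1)]] differs from 0,
    A, B or A + B by a point of [E[2^k]]. *)
Lemma frob_scalar_step (D : scurve F) e1 e2 e3 (sp : split_cubic D e1 e2 e3) k :
  ~ legendre_isog iota D ->
  (forall (D2 : scurve F) f1 f2 f3, split_cubic D2 f1 f2 f3 -> ~ legendre_isog iota D2 ->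
    scalar_on_torsion D2 k) ->
  scalar_on_torsion D k.+1.
Proof.
move=> nl IH; pose sp2 := split_cubicC12 sp; pose sp3 := split_cubicC12 (split_cubicC23 sp).
pose T1 := tors iota sp; pose T2 := tors iota sp2; pose T3 := tors iota sp3.
have [A AT] := halving_iter T1 k; have [B BT] := halving_iter T2 k.
have [n1 n1E] := frob_scalar_above nl IH AT; have [n2 n2E] := frob_scalar_above nl IH BT.
have [n3 n3E] : exists m : int, fr (A + B) = (A + B) *~ m.
  apply: (@frob_scalar_above _ _ _ _ sp3 k nl IH).
  by rewrite mulrnDl AT BT; apply: tors_add.
have T10 : T1 *+ 2 = 0 := tors_double iota sp.
have T20 : T2 *+ 2 = 0 := tors_double iota sp2.
have ind := independent_multiples AT BT T10 T20 (@tors_neq0 _ _ iota _ _ _ _ sp)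
  (@tors_neq0 _ _ iota _ _ _ _ sp2) (@tors12 _ _ iota _ _ _ _ sp).
have Ak : A *+ 2 ^ k.+1 = 0 by rewrite expnSr mulrnA AT.
have Bk : B *+ 2 ^ k.+1 = 0 by rewrite expnSr mulrnA BT.
have /ind/andP [d1 d2] : A *~ (n3 - n1) = B *~ (n2 - n3).
  rewrite !mulrzBr -n1E -n2E; apply/eqP; rewrite subr_eq addrAC eq_sym subr_eq.
  by rewrite addrC -(frobD_point p_prime card_F) n3E mulrzDl.
have fA : fr A = A *~ n3 by rewrite n1E; apply/esym/(mulrz_dvd Ak).
have fB : fr B = B *~ n3 by rewrite n2E; apply: (mulrz_dvd Bk).
have [m mE] := IH _ _ _ _ sp nl.
(* 2 A lies in [E[2^k]], so its image can be computed with m and with n3; this gives m = n3 modulo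
   [2^k]. *)
have /ind/andP [d3 _] : A *~ (2 * (n3 - m)) = B *~ 0.
  rewrite mulr0z mulrzA -pmulrn mulrzBr; apply/eqP; rewrite subr_eq0; apply/eqP.
  rewrite -mE; last by rewrite -mulrnA -expnS.
  by rewrite mulr2n frobD_point fA mulrzDl.
have dm : ((2 ^ k)%:Z %| m - n3)%Z.
  move: d3; rewrite expnS PoszM dvdz_mul2l // => d3.
  by rewrite -opprB rpredN.
have main (P X : point (bc iota D)) : P *+ 2 ^ k = X *+ 2 ^ k -> fr X = X *~ n3 -> fr P = P *~ n3.
  move=> PX fX; have k0 : (P - X) *+ 2 ^ k = 0 by rewrite mulrnBl PX subrr.
  by rewrite -[P](subrK X) frobD_point fX (mE _ k0) (mulrz_dvd k0 dm) -mulrzDl.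
exists n3 => P Pk; have : (P *+ 2 ^ k) *+ 2 == 0 by rewrite -mulrnA -expnSr Pk.
rewrite (two_torsion sp) !inE => /or4P [] /eqP e.
- by apply: (main P 0); [rewrite e mul0rn | rewrite mul0rz; apply: val_inj].
- by apply: (main P A); rewrite ?AT.
- by apply: (main P B); rewrite ?BT.
apply: (main P (A + B)) => //; rewrite e mulrnDl AT BT; exact/esym/tors_add.
Qed.

Lemma frob_scalar k : forall (D : scurve F) e1 e2 e3, split_cubic D e1 e2 e3 ->
  ~ legendre_isog iota D -> scalar_on_torsion D k.
Proof.
elim: k => [|k IHk] D e1 e2 e3 sp nl; last exact: (frob_scalar_step sp nl IHk).
by exists 0 => P; rewrite mulr1n => ->; rewrite mul0rz; apply: val_inj.
Qed.

(* With s^2 = (e2 - e1) (e3 - e1), the point of abscissa e1 + s doubles to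
   (e1, 0), and its ordinate is irrational since E is not Legendre isogenous. *)
Lemma scalar_mod4 (D : scurve F) e1 e2 e3 (m : int) : split_cubic D e1 e2 e3 ->
  ~ legendre_isog iota D ->
  (forall P : point (bc iota D), P *+ 4 = 0 -> fr P = P *~ m) -> (4 %| m + 1)%Z.
Proof.
move=> sp nl mE; have [s [D2 [phi [sE [mp p0 ker] sp2 nl2]]]] := two_isogenous_split sp nl.
(* d is a root of the cubic of D2, as is 0. A square d would therefore make D2 Legendre isogenous.
   The cubic of D takes the value [s^2 d] at e1 + s. *)
pose C := bc iota D; pose d := 2 * s + 2 * e1 - e2 - e3.
have [n12 n13 n23] := split_cubic_distinct sp.
have s0 : s != 0 by rewrite -sqrf_eq0 sE mulf_neq0 // subr_eq0 eq_sym.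
have nd c : c ^+ 2 <> d.
  move=> cE; apply: nl2; apply: (@legendre_of_square F K iota D2 _ _ _ c sp2).
  by rewrite cE /d; ring.
have [t tE] := closed_sqrt (iota d); have tq := frob_sqrt tE nd.
have n2 : (2 : K) != 0 by rewrite -(rmorph_nat iota) fmorph_eq0 (sc_char D).
have t0 : t != 0 by rewrite -sqrf_eq0 tE fmorph_eq0; apply/eqP => d0; apply: (nd 0); rewrite d0 expr0n.
have sK : iota s != 0 by rewrite fmorph_eq0.
have [h2 h4 h6] := sp.
have dE : iota d = 2 * iota s + 2 * iota e1 - iota e2 - iota e3.
  by rewrite /d !(rmorph_nat, rmorphB, rmorphD, rmorphM).
have sKE : iota s ^+ 2 = (iota e2 - iota e1) * (iota e3 - iota e1).
  by rewrite -rmorphXn sE rmorphM !rmorphB.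
have hQ : (iota s * t) ^+ 2 = cubic C (iota (e1 + s)).
  rewrite (cubic_split iota sp) rmorphD exprMn tE dE.
  by apply: (lin_comb (eqM (iota s) sKE)); ring.
have y0 : iota s * t != 0 by rewrite mulf_neq0.
have Q2 : aff hQ + aff hQ = tors iota sp.
  apply: val_inj; have := addp_double hQ y0; rewrite -[addp _ _]/(aff hQ + aff hQ) => ->.
  have a2E : a2 C = - (iota e1 + iota e2 + iota e3) by rewrite /= h2 rmorphN !rmorphD.
  have a4E : a4 C = iota e1 * iota e2 + iota e1 * iota e3 + iota e2 * iota e3.
    by rewrite /= h4 !rmorphD !rmorphM.
  have dc : dcubic C (iota (e1 + s)) = 2 * iota s * t ^+ 2.
    rewrite /dcubic a2E a4E tE dE rmorphD.
    by apply: (lin_comb (eqM (-1) sKE)); ring.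
  have lE : dcubic C (iota (e1 + s)) / (2 * (iota s * t)) = t.
    by rewrite dc; field; rewrite sK t0 n2.
  by rewrite lE /third_point a2E tE dE rmorphD /=; congr (Some (_, _)); ring.
(* B only completes Q to an independent pair, so that (m + 1) Q = 0 yields divisibility by 4. *)
have [B BT] := halving_iter (tors iota (split_cubicC12 sp)) 1.
have Q4 : aff hQ *+ 4 = 0 by rewrite (mulrnA _ 2 2) (Q2 : _ *+ 2 = _) tors_double.
have fQ : fr (aff hQ) = - aff hQ.
  by apply: val_inj; rewrite /= (frob_iota iota) exprMn (frob_iota iota) tq mulrN.
have ind := @independent_multiples _ (aff hQ) B _ _ 1 (m + 1) 0 Q2 BT
  (tors_double iota sp) (tors_double iota (split_cubicC12 sp)) (@tors_neq0 _ _ iota _ _ _ _ sp)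
  (@tors_neq0 _ _ iota _ _ _ _ (split_cubicC12 sp)) (@tors12 _ _ iota _ _ _ _ sp).
have /ind/andP [] // : aff hQ *~ (m + 1) = B *~ 0.
by rewrite mulr0z mulrzDr mulr1z -mE // fQ addNr.
Qed.

End ScalarTorsion.

(** Four times [m^2 - t m + q] is [(2 m - t)^2 + 4 q - t^2], so the degree is small for the member
    of a residue class nearest to t / 2. *)
Lemma nearest_residue (m t M : int) : 0 < M ->
  exists j : int, (2 * (m + M * j) - t) ^+ 2 <= M ^+ 2.
Proof.
move=> M0; exists (- ((2 * m - t + M) %/ (2 * M))%Z); set c := 2 * m - t + M.
have M20 : 0 < 2 * M by lia.
have r0 := modz_ge0 c (lt0r_neq0 M20); have r1 := ltz_pmod c M20; have := divz_eq c (2 * M).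
move: r0 r1; set r := (c %% _)%Z; set d := (c %/ _)%Z => r0 r1 e.
have -> : 2 * (m + M * - d) - t = r - M.
  by apply: (lin_comb e); rewrite /c; ring.
nia.
Qed.

(** Nonnegativity at the neighbours n - 1 and n + 1 of a root leaves t - 2 n in {-1, 0, 1}. In the
    outer cases q would be a product of two consecutive integers, hence even. *)
Lemma degree_zero_root (q : nat) (t n : int) : odd q ->
  (forall m : int, 0 <= m ^+ 2 - t * m + q%:Z) -> n ^+ 2 - t * n + q%:Z = 0 ->
  t = 2 * n /\ q%:Z = n ^+ 2.
Proof.
move=> oq pos dn; have := pos (n + 1); have := pos (n - 1).
have -> : (n - 1) ^+ 2 - t * (n - 1) + q = 1 + t - 2 * n.
  by apply: (lin_comb dn); ring.
have -> : (n + 1) ^+ 2 - t * (n + 1) + q = 1 - t + 2 * n.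
  by apply: (lin_comb dn); ring.
move=> le1 le2.
have qE : q%:Z = n * (t - n) by apply: (lin_comb dn); ring.
have [tE|[tE|tE]] : t = 2 * n \/ t = 2 * n + 1 \/ t = 2 * n - 1 by lia.
- by split=> //; rewrite qE tE; ring.
- exfalso; move: qE; rewrite tE (_ : 2 * n + 1 - n = n + 1); last by ring.
  move=> qE; have [j nE] : exists j, n = 2 * j \/ n = 2 * j + 1 by exists (n %/ 2)%Z; lia.
  by move: oq; rewrite -(odd_double_half q); case: nE => nE; nia.
exfalso; move: qE; rewrite tE (_ : 2 * n - 1 - n = n - 1); last by ring.
move=> qE; have [j nE] : exists j, n = 2 * j \/ n = 2 * j + 1 by exists (n %/ 2)%Z; lia.
by case: nE => nE; nia.
Qed.

(** * The number of points when no Legendre curve is isogenous *)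

Section NoLegendre.
Variables (p n : nat) (F : finFieldType) (K : closedFieldType) (iota : {rmorphism F -> K}).
Hypotheses (p_prime : prime p) (card_F : #|F| = (p ^ n)%N) (odd_q : odd #|F|).
Variable D : scurve F.
Hypothesis no_legendre : ~ legendre_isog iota D.

Lemma split_cubic_card e1 e2 e3 : split_cubic D e1 e2 e3 ->
  exists m : int, [/\ (#|F|)%:Z = m ^+ 2, (m = 1 %[mod 4])%Z &
    (card_points D)%:Z = (m + 1) ^+ 2].
Proof.
(* The estimate [2 d + 1 < 4^k] amounts to [4 q + 2 < 4^k] for a nearest residue, which this k
   satisfies; it also makes 4 an explicit factor of [2^k], so the residue class determines m modulo
   4. *)
move=> sp; pose q := #|F|; pose k := (4 * q + 2)%N; pose t := q.+1%:Z - (card_points D)%:Z.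
have [m0 m0E] := frob_scalar p_prime card_F k sp no_legendre.
have m4 : (4 %| m0 + 1)%Z.
  apply: (@scalar_mod4 p n F K iota p_prime card_F D e1 e2 e3 m0 sp no_legendre) => P P4.
  apply: m0E.
  have -> : (2 ^ k = 4 * 2 ^ (4 * q))%N by rewrite /k expnD mulnC.
  by rewrite mulrnA P4 mul0rn.
have M0 : 0 < (2 ^ k)%:Z by rewrite ltz_nat expn_gt0.
have [j] := nearest_residue m0 t M0; set m := m0 + _ => mt.
have mE (P : point (bc iota D)) : P *+ 2 ^ k = 0 -> frob p_prime card_F P = P *~ m.
  by move=> Pk; rewrite m0E // /m mulrzDr mulrzA -pmulrn Pk mul0rz addr0.
have pos (i : int) : 0 <= i ^+ 2 - t * i + q%:Z.
  have [a [b r]] := @mult_sub_frob_xrep p n F K iota p_prime card_F D i.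
  by rewrite -(degree_mult_sub_frob r).
have [l [ul sl lE]] := torsion_list iota sp k.
have dm : m ^+ 2 - t * m + q%:Z = 0.
  apply: (@torsion_scalar_degree p n F K iota p_prime card_F D m l ul) => [P|]; first by rewrite lE => /eqP /mE.
  have qk : (4 * q + 2 < 4 ^ k)%N by apply: ltn_expl.
  have : ((2 ^ k)%:Z ^+ 2 = (4 ^ k)%N%:Z) by rewrite expr2 -PoszM -expnMn.
  rewrite -/t -/q sl; move: mt qk; move: (2 ^ k)%N (4 ^ k)%N => x y; clear; nia.
have [tE qE] := degree_zero_root odd_q pos dm.
have [i iE] : exists i, m = -1 + 4 * i.
  have [i iE] := dvdzP m4; exists (i + (2 ^ (4 * q))%:Z * j).
  have -> : m = m0 + 4 * (2 ^ (4 * q))%:Z * j.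
    by rewrite /m -PoszM; congr (_ + _%:Z * _); rewrite /k expnD mulnC.
  by apply: (lin_comb iE); ring.
(* m is -1 modulo 4, so the square root of q that is 1 modulo 4 is - m. *)
exists (- m); split.
- by rewrite sqrrN.
- by rewrite iE; lia.
by move: tE; rewrite /t -/q => tE; have := qE; rewrite -/q => qE'; nia.
Qed.

End NoLegendre.

(** * Rational 2-torsion from divisibility by 4 *)

Section FullTwoTorsionFromCount.
Variables (p n : nat) (F : finFieldType) (K : closedFieldType) (iota : {rmorphism F -> K}).
Hypotheses (p_prime : prime p) (card_F : #|F| = (p ^ n)%N).

Lemma shift_isog (D : scurve F) e (fe : cubic D e = 0) : isog iota D (shift_curve fe).
Proof.
have [h2 h4 h6] := shift_curve_eqs fe.
by apply: (@isog_scale F K iota D _ 1 (- e)); rewrite ?oner_neq0.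
Qed.

(* If (0, 0) is the only rational point of order 2, the parity of the number
   of points forces a rational point of order 4 above it. *)
Lemma legendre_of_single_root (D : scurve F) : a6 D = 0 ->
  (forall x, x ^+ 2 + a2 D * x + a4 D != 0) -> (4 %| card_points D)%N -> legendre_isog iota D.
Proof.
move=> a60 nr; rewrite card_points_squares.
have -> : #|[set c | cubic D c == 0%R]| = 1%N.
  rewrite -(cards1 (0 : F)); apply: eq_card => x.
  by rewrite !inE cubicE // mulf_eq0 (negPf (nr x)) orbF.
move=> d4; have : odd #|square_fiber D| by move/dvdnP: d4 => [k]; lia.
rewrite odd_square_fiber //; have [->|[x]] := set_0Vmem [set c in square_fiber D | c ^+ 2 == a4 D].
  by rewrite cards0.
rewrite !inE => /andP [/andP [f0 /existsP [y /eqP yE]] /eqP xE] _.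
have x0 : x != 0 by apply: contra f0 => /eqP ->; rewrite cubicE // mul0r.
apply: (@legendre_of_four_torsion F K iota D x (y / x) a60 xE).
by rewrite expr_div_n yE cubicE // -xE; field.
Qed.

(** Without a rational root N is odd. Once a root e is moved to 0, either a second root appears and
    all three are rational, or [legendre_of_single_root] applies. *)
Lemma split_of_card (D : scurve F) : (4 %| card_points D)%N -> ~ legendre_isog iota D ->
  exists e1 e2 e3, split_cubic D e1 e2 e3.
Proof.
move=> d4 nl; have [s0|[e]] := set_0Vmem [set c | cubic D c == 0].
  move: d4; rewrite card_points_squares s0 cards0 => /dvdnP [k]; lia.
rewrite inE => /eqP fe; have i := shift_isog fe; pose D1 := shift_curve fe.
have card1 : card_points D = card_points D1.
  have [phi [m p0 nz]] := i; exact: (isogenous_card p_prime card_F m p0 nz).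
have [/existsP [x /eqP xE]|/existsPn nr] := boolP [exists x, x ^+ 2 + a2 D1 * x + a4 D1 == 0].
  (* The third root is read off from the sum of the roots, - a2. *)
  exists e, (e + x), (- a2 D - 2 * e - x); move: xE; rewrite /= /dcubic => xE.
  split; first by ring.
    by apply: (lin_comb xE); ring.
  by apply: (lin_comb (eqD fe (eqM (- e) xE))); rewrite /cubic; ring.
case: nl; apply: (legendre_isog_trans i); apply: legendre_of_single_root; rewrite -?card1 //.
Qed.

End FullTwoTorsionFromCount.

Theorem theorem1p1 (p q n : nat) (p_prime : prime p) (p_odd : odd p)
    (q_gt1 : (1 < q)%N) (q_pow : q = (p ^ n)%N)
    (F : finFieldType) (card_F : #|F| = q)
    (E : weierstrass F) (E_elliptic : elliptic E)
    (R : realType) (r : R) (r_sqr : r ^+ 2 = q%:R)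
    (r_int : (exists s : nat, q = (s ^ 2)%N) ->
       exists m : int, r = m%:~R /\ (m = 1 %[mod 4])%Z) :
  legendre_isogenous E <->
  (4 %| card_points E)%N /\ (card_points E)%:R <> (r + 1) ^+ 2.
Proof.
have card_F' : #|F| = (p ^ n)%N by rewrite card_F.
have char2 : (2 : F) != 0.
  have pF := card_finPcharP card_F' p_prime.
  rewrite -(dvdn_pcharf pF); apply: contraL p_odd => p2.
  by rewrite (eqP (_ : p == 2)%N) // -dvdn_prime2.
have odd_q : odd #|F| by rewrite card_F q_pow oddX p_odd orbT.
pose iota : {rmorphism F -> alg_closure F} := to_closure F.
pose D := short_curve E_elliptic char2.
have cE : card_points D = card_points E := card_short_model E char2.
have LE : legendre_isogenous E <-> legendre_isog iota D.
  split=> -[lam [l0 l1 i]]; exists lam; split=> //.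
    apply: (proj1 (isog_short_model iota E (legendre lam) char2)).
    by apply: (proj2 (isog_isogeny_over iota E (legendre lam))).
  apply: (proj1 (isog_isogeny_over iota E (legendre lam))).
  by apply: (proj2 (isog_short_model iota E (legendre lam) char2)).
rewrite LE -cE; split=> [[lam [l0 l1 [phi [m p0 nz]]]]|[d4 nr]].
  have := isogenous_card p_prime card_F' (D2 := legendre_curve char2 l0 l1) m p0 nz.
  move=> ->; split; first exact: dvdn4_card_legendre.
  set N := card_points _ => Nr.
  (* From [N = (r + 1)^2] the number 2 r = N - q - 1 is an integer with square 4 q. So q is a
     perfect square and [r_int] applies. *)
  pose z := N%:Z - q%:Z - 1.
  have zr : z%:~R = 2 * r.
    rewrite /z !rmorphB /= rmorph1 -!pmulrn Nr -r_sqr; ring.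
  have z2 : z ^+ 2 = 4 * q%:Z.
    apply: (@intr_inj R); rewrite rmorphXn /= zr rmorphM /= -pmulrn -r_sqr.
    by rewrite (_ : 4%:~R = 4) //; ring.
  have [i zi] : exists i, z = 2 * i by exists (z %/ 2)%Z; nia.
  have [|m' [rE m1]] := r_int.
    by exists `|i|%N; apply/eqP; rewrite -eqz_nat; apply/eqP; nia.
  have qm : (#|F|)%:Z = m' ^+ 2.
    by apply: (@intr_inj R); rewrite rmorphXn /= -rE r_sqr card_F.
  apply: (@card_legendre_neq p n F _ iota p_prime card_F' lam char2 l0 l1 m' qm m1).
  by apply: (@intr_inj R); rewrite rmorphXn rmorphD /= rmorph1 -rE -Nr.
apply: mathcomp.classical.boolp.contrapT => nl.
have [e1 [e2 [e3 sp]]] := split_of_card p_prime card_F' d4 nl.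
have [m [qm m1 Nm]] := split_cubic_card p_prime card_F' odd_q nl sp.
have [|m' [rE m1']] := r_int.
  by exists `|m|%N; apply/eqP; rewrite -eqz_nat -card_F; apply/eqP; nia.
have qm' : m' ^+ 2 = m ^+ 2.
  by rewrite -qm; apply: (@intr_inj R); rewrite rmorphXn /= -rE r_sqr card_F.
(* Equal squares leave m' = m or m' = - m, and both numbers are 1 modulo 4. *)
have mm : m' = m.
  move/eqP: qm'; rewrite eqf_sqr => /orP [/eqP //|/eqP me].
  by move: m1 m1'; rewrite me; lia.
by apply: nr; rewrite rE mm -[LHS]/((card_points D)%:Z%:~R) Nm rmorphXn rmorphD.
Qed.
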